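(* Let $(M,g)$ be a Riemannian manifold of dimension $n\ge2$ and let $G$ be a natural metric on $TM$ characterized by functions $\alpha,\beta$ such that $\alpha(t)+t\dot\alpha(t)>0$ for $t\ge0$. If $(TM,G)$ is Ricci flat, then $(M,g)$ and $(TM,G)$ are flat.
   Context: All objects are $C^\infty$; a dot denotes derivative. $\pi:TM\to M$ is the tangent bundle. The connection map $\kappa:TTM\to TM$ of the Levi-Civita connection $\nabla$ of $g$ sends the velocity at $0$ of a curve $Y(s)$ in $TM$ to its covariant derivative $\frac{\nabla Y}{ds}(0)$. For $q\in M$, $u=(u_1,\dots,u_n)$ an orthonormal basis of $M_q$, $\xi\in\mathbb{R}^n$ and $v=\sum_i\xi^iu_i$, let $e_i(q,u,\xi),e_{n+i}(q,u,\xi)\in(TM)_v$ ($1\le i\le n$) be the vectors with $\pi_*(e_i)=u_i$, $\kappa(e_i)=0$, $\pi_*(e_{n+i})=0$, $\kappa(e_{n+i})=u_i$. A natural metric on $TM$ is a Riemannian metric $G$ such that $\pi:(TM,G)\to(M,g)$ is a Riemannian submersion, the horizontal spaces $\ker\kappa_v$ and vertical spaces $\ker\pi_{*v}$ are $G$-orthogonal, and the matrix of $G$ in the basis $e_1(q,u,\xi),\dots,e_{2n}(q,u,\xi)$ depends only on $\xi$. Equivalently, there are differentiable functions $\alpha,\beta:[0,+\infty)\to\mathbb{R}$ with $\alpha(t)>0$ and $\alpha(t)+t\beta(t)>0$ for all $t\ge0$ (the functions characterizing $G$) such that at $(q,u,\xi)$: $G(e_i,e_j)=\delta_{ij}$,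 $G(e_i,e_{n+j})=0$, $G(e_{n+i},e_{n+j})=\alpha(|\xi|^2)\delta_{ij}+\beta(|\xi|^2)\xi^i\xi^j$ for $1\le i,j\le n$. Ricci flat means that the Ricci tensor vanishes identically; flat means that the curvature tensor vanishes identically. *)

(* Defs.v *)
From HB Require Import structures.
From mathcomp Require Import all_boot all_order all_algebra.
From mathcomp Require Import all_classical all_reals all_analysis.
Import Order.TTheory GRing.Theory Num.Theory.
Import numFieldNormedType.Exports.

Set Implicit Arguments.
Unset Strict Implicit.
Unset Printing Implicit Defensive.

Local Open Scope classical_set_scope.
Local Open Scope ring_scope.

(* All iterated directional derivatives of order at most k exist and are
   continuous on U; U is meant to be open. *)
Fixpoint Ck (R : realType) (V W : normedModType R) (k : nat) (U : set V)
    (f : V -> W) : Prop :=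
  (forall x, U x -> {for x, continuous f}) /\
  (if k is k'.+1 then
     forall v, (forall x, U x -> derivable f x v) /\ Ck k' U ('D_v f)
   else True).

Definition smooth_on (R : realType) (V W : normedModType R) (U : set V)
    (f : V -> W) : Prop :=
  open U /\ forall k, Ck k U f.

(* Functions on [0, +oo[ are represented by functions on R of which only the
   values at t >= 0 are used: the derivative is two-sided at t > 0 and
   one-sided at 0. *)
Definition quot_halfline (R : realType) (f : R -> R) (t s : R) : R :=
  (f s - f t) / (s - t).

Definition at_halfline (R : realType) (t : R) : set_system R :=
  within [set s : R | 0 <= s] t^'.

Definition derive_halfline (R : realType) (f : R -> R) (t : R) : R :=
  lim (quot_halfline f t @ at_halfline t).

Definition smooth_halfline (R : realType) (f : R -> R) : Prop :=
  forall (k : nat) (t : R), 0 <= t ->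
    cvg (quot_halfline (iter k (@derive_halfline R) f) t @ at_halfline t).

(* The charts are the restrictions of [coord i] to [dom i]; the values of
   [coord i] outside [dom i] are irrelevant. *)
Record atlas (R : realType) (n : nat) := Atlas {
  carrier :> Type ;
  index : Type ;
  dom : index -> set carrier ;
  coord : index -> carrier -> 'rV[R]_n }.

(* The local expression of f in the chart i, i.e. the composition of f with
   the inverse of the chart (with a default value outside [coord i @` dom i]) *)
Definition chart_rep (R : realType) (n : nat) (A : atlas R n)
    (W : pointedType) (i : index A) (f : A -> W) (x : 'rV[R]_n) : W :=
  get [set w | exists p, [/\ dom i p, coord i p = x & f p = w]].

Definition atlas_open (R : realType) (n : nat) (A : atlas R n) (B : set A) :=
  forall i : index A, open (coord i @` (dom i `&` B)).

Record is_manifold (R : realType) (n : nat) (A : atlas R n) : Prop := {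
  manifold_cover : forall p : A, exists i, dom i p ;
  manifold_inj : forall (i : index A) p q,
    dom i p -> dom i q -> coord i p = coord i q -> p = q ;
  manifold_transition : forall i j : index A,
    smooth_on (coord i @` (dom i `&` dom j)) (chart_rep i (coord j)) ;
  manifold_hausdorff : forall p q : A, p <> q -> exists B C : set A,
    [/\ atlas_open B, atlas_open C, B p, C q & B `&` C = set0] ;
  manifold_second_countable : exists B : nat -> set A,
    (forall k, atlas_open (B k)) /\
    (forall (C : set A) p, atlas_open C -> C p ->
       exists k, B k p /\ B k `<=` C) }.

(* A tangent vector is given by its components in all the charts around its
   base point, related by the derivatives of the transition maps. The last
   field normalizes the irrelevant components, so that Leibniz equality is
   the equality of tangent vectors. *)
Record tangent (R : realType) (n : nat) (A : atlas R n) := Tangent {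
  tpt : A ;
  tvec : index A -> 'rV[R]_n ;
  tvec_compat : forall i j, dom i tpt -> dom j tpt ->
    tvec j = 'D_(tvec i) (chart_rep i (coord j)) (coord i tpt) ;
  tvec_out : forall i, ~ dom i tpt -> tvec i = 0 }.

Definition tangent_atlas (R : realType) (n : nat) (A : atlas R n) :
    atlas R (n + n) :=
  {| carrier := tangent A ;
     index := index A ;
     dom := fun i => [set v | dom i (tpt v)] ;
     coord := fun i v => row_mx (coord i (tpt v)) (tvec v i) |}.

Definition tproj (R : realType) (n : nat) (A : atlas R n)
  (v : tangent_atlas A) : A := tpt v.

Definition is_tzero (R : realType) (n : nat) (A : atlas R n) (v : tangent A) :=
  forall i, tvec v i = 0.

Definition smooth_map (R : realType) (m n : nat) (A : atlas R m)
    (B : atlas R n) (f : A -> B) : Prop :=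
  forall (i : index A) (j : index B),
    smooth_on (coord i @` (dom i `&` [set p | dom j (f p)]))
      (chart_rep i (coord j \o f)).

(* [tmap f v w] : the differential f_* maps v to w *)
Definition tmap (R : realType) (m n : nat) (A : atlas R m) (B : atlas R n)
    (f : A -> B) (v : tangent A) (w : tangent B) : Prop :=
  tpt w = f (tpt v) /\
  forall (i : index A) (j : index B), dom i (tpt v) -> dom j (tpt w) ->
    tvec w j = 'D_(tvec v i) (chart_rep i (coord j \o f)) (coord i (tpt v)).

(* Curves are only considered near the parameter 0. *)
Definition smooth_curve (R : realType) (n : nat) (A : atlas R n)
    (c : R -> A) : Prop :=
  forall i : index A, dom i (c 0) -> exists U : set R,
    [/\ U 0, forall s, U s -> dom i (c s) & smooth_on U (coord i \o c)].

Definition velocity0 (R : realType) (n : nat) (A : atlas R n) (c : R -> A)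
    (v : tangent A) : Prop :=
  tpt v = c 0 /\
  forall i : index A, dom i (c 0) -> tvec v i = derive1 (coord i \o c) 0.

Section Local.
Context (R : realType) (n : nat).
Implicit Types (h : 'rV[R]_n -> 'M[R]_n) (a b c d : 'I_n) (x : 'rV[R]_n).

Definition partial (f : 'rV[R]_n -> R) a x : R := 'D_(delta_mx 0 a) f x.

(* Christoffel symbol with lower indices a, b and upper index c *)
Definition christoffel h a b c x : R :=
  2^-1 * \sum_d invmx (h x) c d *
    (partial (fun y => h y b d) a x + partial (fun y => h y a d) b x
     - partial (fun y => h y a b) d x).

(* The d-th component of R(X_a, X_b) X_c for the coordinate vector fields,
   with R(X, Y) = [nabla_X, nabla_Y] - nabla_[X, Y] *)
Definition riemann h a b c d x : R :=
  partial (christoffel h b c d) a x - partial (christoffel h a c d) b x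
  + \sum_e (christoffel h b c e x * christoffel h a e d x
            - christoffel h a c e x * christoffel h b e d x).

(* Ric(X_b, X_c), the trace of X |-> R(X, X_b) X_c *)
Definition ricci h b c x : R := \sum_a riemann h a b c a x.

End Local.

(* [mval v w] is only meaningful when v and w have the same base point; on the
   domain of the chart i, [mcoef i] is the matrix of the metric in the
   coordinate basis. *)
Record metric (R : realType) (n : nat) (A : atlas R n) := Metric {
  mval :> tangent A -> tangent A -> R ;
  mcoef : index A -> A -> 'M[R]_n ;
  mvalE : forall i v w, dom i (tpt v) -> tpt w = tpt v ->
    mval v w = (tvec v i *m mcoef i (tpt v) *m (tvec w i)^T) 0 0 ;
  mcoef_sym : forall i p, dom i p -> (mcoef i p)^T = mcoef i p ;
  mcoef_pos : forall i p (x : 'rV[R]_n), dom i p -> x != 0 ->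
    0 < (x *m mcoef i p *m x^T) 0 0 ;
  mcoef_smooth : forall i,
    smooth_on (coord i @` dom i) (chart_rep i (mcoef i)) }.

Definition local_metric (R : realType) (n : nat) (A : atlas R n)
    (g : metric A) (i : index A) : 'rV[R]_n -> 'M[R]_n :=
  chart_rep i (mcoef g i).

Definition flat (R : realType) (n : nat) (A : atlas R n) (g : metric A) :=
  forall (i : index A) p, dom i p -> forall a b c d,
    riemann (local_metric g i) a b c d (coord i p) = 0.

Definition ricci_flat (R : realType) (n : nat) (A : atlas R n)
    (g : metric A) :=
  forall (i : index A) p, dom i p -> forall b c,
    ricci (local_metric g i) b c (coord i p) = 0.

(* [z] is the covariant derivative at s = 0 of the vector field Y(s) along the
   curve tpt (Y s), for the Levi-Civita connection of g. *)
Definition covariant_derivative0 (R : realType) (n : nat) (A : atlas R n)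
    (g : metric A) (Y : R -> tangent_atlas A) (z : tangent A) : Prop :=
  tpt z = tpt (Y 0) /\
  forall i : index A, dom i (tpt (Y 0)) -> forall c,
    tvec z i 0 c =
      derive1 (fun s => tvec (Y s) i 0 c) 0 +
      \sum_a \sum_b
        christoffel (local_metric g i) a b c (coord i (tpt (Y 0)))
        * derive1 (fun s => coord i (tpt (Y s)) 0 a) 0 * tvec (Y 0) i 0 b.

(* [connection_map g w z] : the connection map of g sends w to z *)
Definition connection_map (R : realType) (n : nat) (A : atlas R n)
    (g : metric A) (w : tangent (tangent_atlas A)) (z : tangent A) : Prop :=
  exists Y : R -> tangent_atlas A,
    [/\ smooth_curve Y, velocity0 Y w & covariant_derivative0 g Y z].

Definition horizontal (R : realType) (n : nat) (A : atlas R n)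
    (g : metric A) (w : tangent (tangent_atlas A)) : Prop :=
  exists2 z, connection_map g w z & is_tzero z.

Definition tkernel (R : realType) (m n : nat) (A : atlas R m)
    (B : atlas R n) (f : A -> B) (w : tangent A) : Prop :=
  exists2 z, tmap f w z & is_tzero z.

Definition vertical (R : realType) (n : nat) (A : atlas R n)
    (w : tangent (tangent_atlas A)) : Prop := tkernel (@tproj R n A) w.

Definition riemannian_submersion (R : realType) (m n : nat) (A : atlas R m)
    (B : atlas R n) (G : metric A) (g : metric B) (f : A -> B) : Prop :=
  [/\ smooth_map f,
      forall q : B, exists p : A, f p = q,
      forall (p : A) (z : tangent B), tpt z = f p ->
        exists2 w : tangent A, tpt w = p & tmap f w z
    & forall (w w' : tangent A) (z z' : tangent B), tpt w' = tpt w ->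
        (forall k, tpt k = tpt w -> tkernel f k -> G w k = 0) ->
        (forall k, tpt k = tpt w -> tkernel f k -> G w' k = 0) ->
        tmap f w z -> tmap f w' z' -> G w w' = g z z'].

Definition orthonormal_basis (R : realType) (n : nat) (A : atlas R n)
    (g : metric A) (q : A) (u : 'I_n -> tangent A) : Prop :=
  (forall a, tpt (u a) = q) /\ (forall a b, g (u a) (u b) = (a == b)%:R).

(* [e] is the basis e_1, ..., e_2n at (q, u, xi) of the tangent space of TM at
   the vector v with components xi in the basis u. *)
Record adapted_basis (R : realType) (n : nat) (A : atlas R n) (g : metric A)
    (q : A) (u : 'I_n -> tangent A) (xi : 'rV[R]_n) (v : tangent_atlas A)
    (e : 'I_(n + n) -> tangent (tangent_atlas A)) : Prop := {
  adapted_u : orthonormal_basis g q u ;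
  adapted_pt : tpt v = q ;
  adapted_v : forall i, tvec v i = \sum_a xi 0 a *: tvec (u a) i ;
  adapted_e : forall a, tpt (e a) = v ;
  adapted_hor : forall a : 'I_n,
    tmap (@tproj R n A) (e (lshift n a)) (u a) /\
    horizontal g (e (lshift n a)) ;
  adapted_ver : forall a : 'I_n,
    vertical (e (rshift n a)) /\
    connection_map g (e (rshift n a)) (u a) }.

Definition natural_metric (R : realType) (n : nat) (A : atlas R n)
    (g : metric A) (G : metric (tangent_atlas A)) : Prop :=
  [/\ riemannian_submersion G g (@tproj R n A),
      forall w w', tpt w' = tpt w -> horizontal g w -> vertical w' ->
        G w w' = 0
    & exists m : 'rV[R]_n -> 'M[R]_(n + n), forall q u xi v e,
        adapted_basis g q u xi v e -> forall a b, G (e a) (e b) = m xi a b].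

Record characterized_by (R : realType) (n : nat) (A : atlas R n)
    (g : metric A) (G : metric (tangent_atlas A)) (alpha beta : R -> R) :
    Prop := {
  char_alpha_smooth : smooth_halfline alpha ;
  char_beta_smooth : smooth_halfline beta ;
  char_alpha_gt0 : forall t, 0 <= t -> 0 < alpha t ;
  char_sum_gt0 : forall t, 0 <= t -> 0 < alpha t + t * beta t ;
  char_matrix : forall q u xi v e, adapted_basis g q u xi v e ->
    let r := \sum_a xi 0 a ^+ 2 in
    forall a b : 'I_n,
    [/\ G (e (lshift n a)) (e (lshift n b)) = (a == b)%:R,
        G (e (lshift n a)) (e (rshift n b)) = 0
      & G (e (rshift n a)) (e (rshift n b)) =
          alpha r * (a == b)%:R + beta r * xi 0 a * xi 0 b] }.

(* Main.v *)
(* In the frame of horizontal lifts and vertical fields, O'Neill's formula reads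
   Ric_G(V_d, V_e) = Ric_F(V_d, V_e) - tr(A_d A_e) on vertical vectors, where F is
   the fibre with the metric alpha g + beta v^* v^* (v^* = g(v, .)) and A_d is, up to
   a factor, R(., .)v paired with V_d. Curvature endomorphisms being antisymmetric,
   A vanishes on the radial direction, so Ric_F(v, v) = 0. This is an ODE in
   t = |v|^2 with first integral (alpha + t alpha')^2 / (alpha (alpha + t beta)),
   whose value at t = 0 is 1. Hence F is the pull-back of a Euclidean metric by
   v |-> sqrt(alpha(|v|^2)) v and is flat; then tr(A_d A_d) = 0 with A_d
   antisymmetric, so A = 0 and g is flat. The same map then trivializes G outside
   the zero section, where the curvature vanishes by continuity. *)
Require Import Defs.
From HB Require Import structures.
From mathcomp Require Import all_boot all_order all_algebra.
From mathcomp Require Import all_classical all_reals all_analysis.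
From mathcomp Require Import ring lra.
Import Order.TTheory GRing.Theory Num.Theory.
Import numFieldNormedType.Exports.

Set Implicit Arguments.
Unset Strict Implicit.
Unset Printing Implicit Defensive.

Local Open Scope classical_set_scope.
Local Open Scope ring_scope.
Import Defs.

(** * Functions of class C^k *)

(** The Ricci hypothesis is stated in coordinates, whereas the metric of the total space is simple
    only in a moving frame. The bridge is [lc_frame]: a connection matrix that is metric and torsion
    free in some coframe determines the Christoffel symbols, and the curvature by conjugation.
    Connections are therefore guessed and verified, for four coframes: horizontal lifts with
    vertical fields, the Jacobian of the rescaling map, the development of the total space, and the
    Jacobian of a change of charts. Only Ric(vertical, vertical) is computed: there the Christoffel
    matrices are block triangular with a traceless horizontal block, and no horizontal derivative
    survives. The computations stay where |v|^2 > 0, since [alpha] and [beta] have only one-sided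
    derivatives at 0. The dimension enters through the factor n - 1 of Ric_F(v, v). The value 1 of
    the first integral means beta = 2 alpha' + t alpha'^2 / alpha, which is the coefficient of v^*
    v^* in the pull-back of g by the rescaling map. *)

Section Lines.
Context (R : realType) (V : normedModType R).

Lemma is_derive_line (W : normedModType R) (f : V -> W) x v (t : R) :
  derivable f (t *: v + x) v ->
  is_derive t 1 (fun s : R => f (s *: v + x)) ('D_v f (t *: v + x)).
Proof.
have E : (fun h : R => h^-1 *: (f ((h *: 1 + t) *: v + x) - f (t *: v + x))) =
  (fun h : R => h^-1 *: (f (h *: v + (t *: v + x)) - f (t *: v + x))).
  by apply/funext => h; rewrite [h *: 1]mulr1 scalerDl addrA.
by move=> df; split; rewrite /derivable /derive E.
Qed.

Lemma line_continuous (x v : V) : continuous (fun s : R => s *: v + x).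
Proof.
move=> s; apply: cvgD; last exact: cvg_cst.
by apply: cvgZr_tmp; apply: cvg_id.
Qed.

Lemma line_MVT (f : V -> R) x v (t : R) : 0 <= t ->
  (forall s, 0 <= s <= t -> derivable f (s *: v + x) v) ->
  exists2 c, 0 <= c <= t & f (t *: v + x) - f x = t * 'D_v f (c *: v + x).
Proof.
move=> t0 df.
have := @MVT_segment R (fun s => f (s *: v + x)) (fun s => 'D_v f (s *: v + x)) 0 t t0.
case.
- by move=> s; rewrite in_itv /= => /andP[s0 st]; apply: is_derive_line; apply: df; rewrite !ltW.
- apply: derivable_within_continuous => s; rewrite in_itv /= => st.
  by have [] := is_derive_line (df s st).
- move=> c; rewrite in_itv /= => ct; rewrite scale0r add0r subr0 => ->.
  by exists c => //; rewrite mulrC.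
Qed.

Lemma derivableZdir (W : normedModType R) (f : V -> W) x v (c : R) :
  derivable f x v -> derivable f x (c *: v) /\ 'D_(c *: v) f x = c *: 'D_v f x.
Proof.
have [->|c0] := eqVneq c 0.
  by move=> _; rewrite !scale0r; split; [exact: derivable0|exact: derive0].
move=> df.
(* Scaling by [c] must preserve punctured neighbourhoods of 0, whence the separate treatment of
   [c = 0]. *)
have sc : (fun h : R => h * c) @ 0^' --> (0 : R)^'.
  move=> A; rewrite /= !nbhs_filterE => -[e e0 eA].
  exists (e / `|c|); first by rewrite /= divr_gt0 ?normr_gt0.
  move=> h /=; rewrite sub0r normrN => he hn0; apply: eA; last by rewrite mulf_neq0.
  by rewrite /= sub0r normrN normrM -ltr_pdivlMr ?normr_gt0.
have E : (fun h : R => h^-1 *: (f (h *: (c *: v) + x) - f x)) =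
   (fun h => c *: (h^-1 *: (f (h *: v + x) - f x))) \o (fun h => h * c).
  apply/funext => h /=; rewrite invfM -!scalerA scalerA [c *: _]scalerA.
  by rewrite scalerA mulrAC divff // mul1r.
have cv : (fun h : R => h^-1 *: (f (h *: (c *: v) + x) - f x)) @ 0^' --> c *: 'D_v f x.
  rewrite E; apply: cvg_comp sc _; apply: cvgZl_tmp; exact: df.
by split; [apply/cvg_ex; exists (c *: 'D_v f x)|apply: cvg_lim].
Qed.

End Lines.

Section CkTheory.
Context (R : realType) (V : normedModType R).
Implicit Types (U : set V) (k : nat).

Lemma CkS (W : normedModType R) U k (f : V -> W) : Ck k.+1 U f -> Ck k U f.
Proof.
elim: k f => [|k IH] f [cf df]; split=> // v; have [dfv ckf] := df v.
by split=> //; apply: IH.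
Qed.

Lemma Ck0 (W : normedModType R) U k (f : V -> W) : Ck k U f -> Ck 0 U f.
Proof. by case: k => [|k] [cf _]; split. Qed.

Lemma Ck_le (W : normedModType R) U k l (f : V -> W) : (l <= k)%N -> Ck k U f -> Ck l U f.
Proof.
elim: k => [|k IH] lk ckf; first by move: lk; rewrite leqn0 => /eqP ->.
by move: lk; rewrite leq_eqVlt => /orP[/eqP->//|/IH]; apply; apply: CkS.
Qed.

Lemma Ck_derivable (W : normedModType R) U k (f : V -> W) x v :
  Ck k.+1 U f -> U x -> derivable f x v.
Proof. by move=> [_ /(_ v)[d _]] /d. Qed.

Lemma CkW (W : normedModType R) U U' k (f : V -> W) :
  U' `<=` U -> Ck k U f -> Ck k U' f.
Proof.
move=> U'U; elim: k f => [|k IH] f [cf df]; split=> //; try by move=> x /U'U; apply: cf.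
move=> v; have [dfv ckf] := df v; split; last exact: IH.
by move=> x /U'U; apply: dfv.
Qed.

Lemma open_near_eq (W : normedModType R) U (f g : V -> W) x :
  open U -> (forall y, U y -> f y = g y) -> U x -> {near x, f =1 g}.
Proof.
by move=> oU fg Ux; apply: filterS fg _; apply: open_nbhs_nbhs.
Qed.

Lemma derive_open (W : normedModType R) U (f g : V -> W) x v :
  open U -> (forall y, U y -> f y = g y) -> U x -> 'D_v f x = 'D_v g x.
Proof. by move=> oU fg Ux; apply: near_eq_derive; apply: open_near_eq oU fg Ux. Qed.

Lemma Ck_eq (W : normedModType R) U k (f g : V -> W) : open U ->
  (forall x, U x -> f x = g x) -> Ck k U f -> Ck k U g.
Proof.
move=> oU; elim: k f g => [|k IH] f g fg [cf df]; split => //.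
- move=> x Ux; rewrite /prop_for /continuous_at -(fg _ Ux).
  apply: cvg_trans (cf x Ux); apply: near_eq_cvg.
  exact: open_near_eq oU fg Ux.
- move=> x Ux; rewrite /prop_for /continuous_at -(fg _ Ux).
  apply: cvg_trans (cf x Ux); apply: near_eq_cvg.
  exact: open_near_eq oU fg Ux.
- move=> v; have [dfv ckf] := df v; split.
    by move=> x Ux; apply: near_eq_derivable (dfv x Ux); apply: open_near_eq oU fg Ux.
  by apply: IH ckf => x Ux; apply: derive_open oU fg Ux.
Qed.

Lemma Ck_cst (W : normedModType R) U k (c : W) : Ck k U (fun=> c).
Proof.
elim: k c => [|k IH] c; split=> //; try by move=> x _; apply: cst_continuous.
move=> v; split; first by move=> x _; apply: derivable_cst.
have -> : 'D_v (fun=> c) = fun=> (0 : W) by apply/funext => x; rewrite (derive_cst c x v).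
exact: IH.
Qed.

Lemma CkD (W : normedModType R) U k (f g : V -> W) : open U ->
  Ck k U f -> Ck k U g -> Ck k U (fun x => f x + g x).
Proof.
move=> oU; elim: k f g => [|k IH] f g [cf df] [cg dg]; split => //;
  try by move=> x Ux; apply: continuousD; [apply: cf|apply: cg].
move=> v; have [dfv ckf] := df v; have [dgv ckg] := dg v; split.
  by move=> x Ux; apply: derivableD; [apply: dfv|apply: dgv].
apply: (Ck_eq (f := fun x => 'D_v f x + 'D_v g x)) => //; last exact: IH.
by move=> x Ux; rewrite -deriveD //; [apply: dfv|apply: dgv].
Qed.

(** An affine map carries difference quotients along [v] to difference quotients along [L v], so no
    chain rule is involved. This covers block projections, slices of ['rV_(n + n)] and straight
    lines. *)
Lemma Ck_comp_affine (V' W : normedModType R) U (U' : set V') k (f : V' -> W) (T L : V -> V') :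
  continuous T -> (forall h x v, T (h *: v + x) = h *: L v + T x) ->
  (forall x, U x -> U' (T x)) ->
  Ck k U' f -> Ck k U (fun x => f (T x)).
Proof.
move=> cT TL UU'; elim: k f => [|k IH] f [cf df]; split => //;
  try by move=> x Ux; apply: continuous_comp; [exact: cT|apply: cf; apply: UU'].
move=> v; have [dfv ckf] := df (L v).
have E x : (fun h : R => h^-1 *: (f (T (h *: v + x)) - f (T x))) =
  (fun h : R => h^-1 *: (f (h *: L v + T x) - f (T x))).
  by apply/funext => h; rewrite TL.
split; first by move=> x Ux; rewrite /derivable E; apply: dfv; apply: UU'.
have -> : 'D_v (fun x => f (T x)) = fun x => 'D_(L v) f (T x).
  by apply/funext => x; rewrite /derive E.
exact: (IH ('D_(L v) f)).
Qed.

Lemma CkZ (U : set V) k (W : normedModType R) (f : V -> W) (c : R) : open U ->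
  Ck k U f -> Ck k U (fun x => c *: f x).
Proof.
move=> oU; elim: k f => [|k IH] f [cf df]; split => //;
  try by move=> x Ux; apply: cvgZl_tmp; apply: cf.
move=> v; have [dfv ckf] := df v; split.
  by move=> x Ux; apply: derivableZ; apply: dfv.
apply: (Ck_eq (f := fun x => c *: 'D_v f x)) => //; last exact: IH.
by move=> x Ux; rewrite -deriveZ //; apply: dfv.
Qed.

Implicit Types f g : V -> R.

Lemma CkN U k f : open U -> Ck k U f -> Ck k U (fun x => - f x).
Proof.
move=> oU ck; apply: (Ck_eq (f := fun x => (-1) *: f x)) => //.
  by move=> x _; rewrite scaleN1r.
exact: CkZ.
Qed.

Lemma CkM U k f g : open U ->
  Ck k U f -> Ck k U g -> Ck k U (fun x => f x * g x).
Proof.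
move=> oU; elim: k f g => [|k IH] f g ckf ckg.
  have [cf _] := ckf; have [cg _] := ckg; split=> // x Ux.
  by apply: continuousM; [apply: cf|apply: cg].
have [cf df] := ckf; have [cg dg] := ckg; split.
  by move=> x Ux; apply: continuousM; [apply: cf|apply: cg].
move=> v; have [dfv ckfv] := df v; have [dgv ckgv] := dg v; split.
  by move=> x Ux; apply: derivableM; [apply: dfv|apply: dgv].
apply: (Ck_eq (f := fun x => f x * 'D_v g x + g x * 'D_v f x)) => //.
  by move=> x Ux; apply/esym/(deriveM (dfv x Ux) (dgv x Ux)).
by apply: CkD => //; apply: IH => //; apply: CkS.
Qed.

Lemma Ck_sum U k (I : Type) (r : seq I) (P : pred I) (F : I -> V -> R) : open U ->
  (forall i, P i -> Ck k U (F i)) -> Ck k U (fun x => \sum_(i <- r | P i) F i x).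
Proof.
move=> oU H; elim: r => [|a r IH].
  by apply: Ck_eq (Ck_cst U k 0) => // x _; rewrite big_nil.
case Pa : (P a); last by apply: Ck_eq IH => // x _; rewrite big_cons Pa.
by apply: Ck_eq (CkD oU (H a Pa) IH) => // x _; rewrite big_cons Pa.
Qed.

Lemma Ck_prod U k (I : Type) (r : seq I) (P : pred I) (F : I -> V -> R) : open U ->
  (forall i, P i -> Ck k U (F i)) -> Ck k U (fun x => \prod_(i <- r | P i) F i x).
Proof.
move=> oU H; elim: r => [|a r IH].
  by apply: Ck_eq (Ck_cst U k (1 : R)) => // x _; rewrite big_nil.
case Pa : (P a); last by apply: Ck_eq IH => // x _; rewrite big_cons Pa.
by apply: Ck_eq (CkM oU (H a Pa) IH) => // x _; rewrite big_cons Pa.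
Qed.

Lemma Ck_inv U k f : open U -> (forall x, U x -> f x != 0) ->
  Ck k U f -> Ck k U (fun x => (f x)^-1).
Proof.
move=> oU f0; elim: k => [|k IH] ckf.
  by have [cf _] := ckf; split=> // x Ux; apply: continuousV; [apply: f0|apply: cf].
have [cf df] := ckf; split.
  by move=> x Ux; apply: continuousV; [apply: f0|apply: cf].
move=> v; have [dfv ckfv] := df v; split.
  by move=> x Ux; apply: derivableV; [apply: f0|apply: dfv].
have ci := IH (CkS ckf).
apply: (Ck_eq (f := fun x => - ((f x)^-1 * (f x)^-1) * 'D_v f x)) => //.
  move=> x Ux; rewrite -expr2 exprVn; apply/esym.
  exact: (deriveV (f0 x Ux) (dfv x Ux)).
by apply: CkM => //; apply: CkN => //; apply: CkM.
Qed.

(** Only derivability along [v] is known, so the one-variable chain rule is applied to the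
    restriction of [f] to the line through [x]. *)
Lemma derive_comp1 f (phi : R -> R) x v : derivable phi (f x) 1 -> derivable f x v ->
  derivable (fun y => phi (f y)) x v /\
  'D_v (fun y => phi (f y)) x = 'D_1 phi (f x) * 'D_v f x.
Proof.
move=> dphi df.
have := is_derive_line (t := 0) (f := f) (x := x) (v := v).
rewrite scale0r add0r => /(_ df) [df0 df0E].
have fx : f (0 *: v + x) = f x by rewrite scale0r add0r.
have dc : derivable (fun y => phi (f y)) x v.
  apply/derivable1P/derivable1_diffP.
  apply: (@differentiable_comp _ _ _ _ (fun s : R => f (s *: v + x)) phi).
    by move/derivable1_diffP : df0.
  by rewrite fx; move/derivable1_diffP : dphi.
split => //.
have := is_derive_line (t := 0) (f := fun y => phi (f y)) (x := x) (v := v).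
rewrite scale0r add0r => /(_ dc) [_ <-].
rewrite -df0E -!derive1E.
have := @derive1_comp R (fun s : R => f (s *: v + x)) phi 0 df0.
by rewrite fx => /(_ dphi) ->.
Qed.

Lemma Ck_comp1 U (I : set R) k f (phi : R -> R) : open U ->
  (forall x, U x -> I (f x)) -> Ck k I phi ->
  Ck k U f -> Ck k U (fun x => phi (f x)).
Proof.
move=> oU fI; elim: k f phi fI => [|k IH] f phi fI ckp ckf.
  have [cf _] := ckf; have [cp _] := ckp; split=> // x Ux.
  by apply: continuous_comp; [apply: cf|apply: cp; apply: fI].
have [cf df] := ckf; have [cp dp] := ckp; split.
  by move=> x Ux; apply: continuous_comp; [apply: cf|apply: cp; apply: fI].
move=> v; have [dfv ckfv] := df v; have [dp1 ckp1] := dp 1.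
have D x : U x -> _ := fun Ux => derive_comp1 (dp1 _ (fI x Ux)) (dfv x Ux).
split; first by move=> x /D [].
apply: (Ck_eq (f := fun x => 'D_1 phi (f x) * 'D_v f x)) => //.
  by move=> x /D[].
by apply: CkM => //; apply: (IH f ('D_1 phi)) => //; apply: CkS.
Qed.

Lemma Ck_lin U k f : continuous f -> (forall h x v, f (h *: v + x) = h * f v + f x) ->
  Ck k U f.
Proof.
move=> cf fl; case: k => [|k]; split=> //; try by move=> x _; apply: cf.
move=> v.
have cv (x : V) : (fun h : R => h^-1 *: (f (h *: v + x) - f x)) @ 0^' --> f v.
  apply: cvg_near_cst; near=> h; rewrite fl addrK [_ *: _]mulrA mulVf ?mul1r //.
  by near: h; apply: nbhs_dnbhs_neq.
split; first by move=> x _; apply/cvg_ex; exists (f v); exact: cv.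
have -> : 'D_v f = fun=> f v by apply/funext => x; apply: cvg_lim => //; exact: cv.
exact: Ck_cst.
Unshelve. all: by end_near. Qed.

Lemma Ck_mx U k p q (A : V -> 'M[R]_(p, q)) :
  open U -> (Ck k U A <-> forall i j, Ck k U (fun x => A x i j)).
Proof.
move=> oU; split.
  elim: k A => [|k IH] A [cA dA] i j; split=> //;
    try by move=> x Ux; exact: (continuous_comp (cA x Ux) (@coord_continuous _ _ _ i j (A x))).
  move=> v; have [dv cv] := dA v; split.
    by move=> x Ux; move/derivable_mxP: (dv x Ux); apply.
  apply: Ck_eq (IH _ cv i j) => // x Ux.
  by rewrite derive_mx ?mxE //; apply: dv.
have C (B : V -> 'M[R]_(p, q)) : (forall i j, Ck 0 U (fun x => B x i j)) -> Ck 0 U B.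
  move=> cB; split=> // x Ux; apply/cvgrPdist_le => /= e e0; near=> y.
  rewrite [leLHS]/Num.Def.normr/= mx_normrE (bigmax_le _ (ltW e0))//= => i _.
  rewrite !mxE; move: i; near: y; apply: filter_forall => /= i.
  by have [c _] := cB i.1 i.2; move/cvgrPdist_le : (c x Ux) => /(_ e e0).
elim: k A => [|k IH] A cA; first exact: C.
split; first by have [] := C A (fun i j => Ck0 (cA i j)).
move=> v; have dA x : U x -> derivable A x v.
  by move=> Ux; apply/derivable_mxP => i j; have [_ /(_ v)[d _]] := cA i j; apply: d.
split=> //; apply: IH => i j; have [_ /(_ v)[_]] := cA i j; apply: Ck_eq => // x Ux.
by rewrite derive_mx ?mxE //; apply: dA.
Unshelve. all: by end_near. Qed.

End CkTheory.

(** * Differentiability of functions of class C^1 *)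

Section Differentiability.
Context (R : realType) (m : nat).
Implicit Types (U : set 'rV[R]_m) (f : 'rV[R]_m -> R) (x v h : 'rV[R]_m).

Lemma mx_norm_leP h (e : R) : 0 <= e -> (forall i, `|h 0 i| <= e) -> `|h| <= e.
Proof.
move=> e0 he; rewrite [leLHS]/Num.Def.normr/= mx_normrE bigmax_le // => -[i j] _ /=.
by rewrite ord1.
Qed.

Lemma mx_norm_coord h i : `|h 0 i| <= `|h|.
Proof.
rewrite [leRHS]/Num.Def.normr/= mx_normrE.
exact: (le_bigmax _ (fun ij => `|h ij.1 ij.2|) (0, i)).
Qed.

Lemma Ck_coord U k i : Ck k U (fun x => x 0 i).
Proof.
apply: Ck_lin; first exact: coord_continuous.
by move=> h x v; rewrite !mxE.
Qed.

(** The vertices of a staircase from 0 to [h] along the coordinate axes. *)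
Definition truncate_row h k : 'rV[R]_m := \row_j (if (j < k)%N then h 0 j else 0).

Lemma truncate_rowS h (i : 'I_m) :
  truncate_row h i.+1 = (h 0 i) *: delta_mx 0 i + truncate_row h i.
Proof.
apply/rowP => j; rewrite !mxE eqxx /= ltnS leq_eqVlt.
have [/val_inj ->|ji] := eqVneq (j : nat) i.
  by rewrite eqxx ltnn addr0 mulr1.
have -> : (j == i) = false by apply/eqP => jj; rewrite jj eqxx in ji.
by rewrite mulr0 add0r.
Qed.

(** The increment telescopes along the staircase [truncate_row]; each step moves one coordinate and
    is controlled by the mean value theorem and the continuity of one partial derivative. *)
Lemma C1_increment U f x : Ck 1 U f -> U x -> open U ->
  forall e : R, 0 < e -> \forall h \near (0 : 'rV[R]_m),
  `|f (h + x) - f x - \sum_i h 0 i * partial f i x| <= e * `|h|.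
Proof.
move=> [cf df] Ux oU e e0.
(* Each of the [m] steps of the staircase costs [e1 * |h|]; the [+ 1] keeps the quotient meaningful
   for [m = 0]. *)
pose e1 := e / (m%:R + 1).
have e10 : 0 < e1 by rewrite divr_gt0 // ltr_wpDl.
have : \forall y \near x, U y /\ forall i, `|partial f i x - partial f i y| <= e1.
  near=> y; split; first by near: y; exact: open_nbhs_nbhs.
  near: y; apply: filter_forall => i.
  have [_ [cd _]] := df (delta_mx 0 i).
  by move/cvgrPdist_le : (cd x Ux) => /(_ e1 e10).
move=> /nbhs_ballP[d /= d0 dP]; near=> h.
have hd : `|h| < d by near: h; exact: (@nbhs0_lt R 'rV[R]_m d d0).
have hin (i : 'I_m) (c : R) : 0 <= c <= 1 ->
    ball x d (c *: ((h 0 i) *: delta_mx 0 i) + (truncate_row h i + x)).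
  move=> /andP[c0 c1]; rewrite -ball_normE /= addrA opprD addrCA subrr addr0 normrN.
  apply: le_lt_trans hd; apply: mx_norm_leP => // j; rewrite !mxE eqxx /=.
  have [->|ji] := eqVneq j i.
    rewrite ltnn addr0 mulr1 normrM (ger0_norm c0).
    by apply: le_trans (mx_norm_coord h i); rewrite ler_piMl.
  rewrite !mulr0 add0r; case: ifP => _; first exact: mx_norm_coord.
  by rewrite normr0.
have tele : f (h + x) - f x = \sum_(i < m) (f (truncate_row h i.+1 + x) - f (truncate_row h i + x)).
  rewrite -(big_mkord xpredT (fun i => f (truncate_row h i.+1 + x) - f (truncate_row h i + x))).
  rewrite telescope_sumr //; congr (f (_ + _) - f _).
    by apply/rowP => j; rewrite mxE ltn_ord.
  by rewrite -[LHS]add0r; congr (_ + _); apply/rowP => j; rewrite !mxE.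
have step (i : 'I_m) : `|f (truncate_row h i.+1 + x) - f (truncate_row h i + x) - h 0 i * partial f i x|
    <= e1 * `|h|.
  have dv y : ball x d y -> derivable f y (h 0 i *: delta_mx 0 i) /\
      'D_(h 0 i *: delta_mx 0 i) f y = h 0 i *: partial f i y.
    by move=> /dP[Uy _]; apply: derivableZdir; have [d1 _] := df (delta_mx 0 i); apply: d1.
  have [s /(hin i) /dv [] //|] :=
    @line_MVT R _ f (truncate_row h i + x) (h 0 i *: delta_mx 0 i) 1 ler01.
  move=> c /(hin i) cb; rewrite scale1r mul1r addrA -truncate_rowS => ->.
  have [_ ->] := dv _ cb; rewrite -mulrBr normrM mulrC.
  apply: ler_pM => //; last exact: mx_norm_coord.
  by have [_ /(_ i)] := dP _ cb; rewrite distrC.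
rewrite tele -sumrB; apply: le_trans (ler_norm_sum _ _ _) _.
apply: (@le_trans _ _ (\sum_(i < m) e1 * `|h|)).
  by apply: ler_sum => i _; exact: step.
rewrite sumr_const card_ord -mulrnAl; apply: ler_wpM2r => //.
rewrite -mulr_natr /e1 -mulrA ler_piMr ?ltW // mulrC ltr_pdivrMr ?mul1r ?ltrDl //.
Unshelve. all: by end_near. Qed.

Definition grad_form f x h : R := \sum_i h 0 i * partial f i x.

Lemma grad_form_linear f x : linear (grad_form f x).
Proof.
move=> a u v; rewrite /grad_form scaler_sumr -big_split /=; apply: eq_bigr => i _.
by rewrite !mxE mulrDl scalerAl.
Qed.

(** [Ck] speaks of directional derivatives only. The total differential makes them linear in the
    direction and gives the chain rule along arbitrary curves. *)
Lemma C1_differentiable U f x : Ck 1 U f -> open U -> U x ->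
  differentiable f x /\ forall v, 'd f x v = grad_form f x v.
Proof.
move=> c1 oU Ux.
pose L : {linear 'rV[R]_m -> R} := HB.pack (grad_form f x)
  (GRing.isLinear.Build _ _ _ _ _ (grad_form_linear f x)).
have cL : continuous L.
  rewrite (_ : (L : _ -> _) = fun h => \sum_i h 0 i * partial f i x) //.
  have [c _] : Ck 0 setT (fun h : 'rV[R]_m => \sum_i h 0 i * partial f i x).
    apply: Ck_sum openT _ => i _; apply: CkM openT _ (Ck_cst _ _ _).
    exact: Ck_coord.
  by move=> h; exact: c.
have Lo : f \o shift x = cst (f x) + L +o_ (0 : 'rV[R]_m) id.
  apply/eqaddoP => e e0; near=> h.
  have : `|f (h + x) - f x - \sum_i h 0 i * partial f i x| <= e * `|h|.
    by near: h; apply: C1_increment c1 Ux oU _ e0.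
  by rewrite /= !fctE /= opprD addrA.
have dL := diff_unique cL Lo.
split; last by move=> v; rewrite dL.
apply/diff_locallyP; split; rewrite dL //.
Unshelve. all: by end_near. Qed.

End Differentiability.

(** * Symmetry of second derivatives *)

Section Schwarz.
Context (R : realType) (V : normedModType R).

(** The mean value theorem along [v] for y |-> f (t w + y) - f y, and then along [w] for
    ['D_v f]. *)
Lemma second_difference (U : set V) (f : V -> R) x v w (t : R) :
  0 <= t -> Ck 2 U f ->
  (forall a b : R, 0 <= a <= t -> 0 <= b <= t -> U (a *: v + (b *: w + x))) ->
  exists a b, [/\ 0 <= a <= t, 0 <= b <= t &
    f (t *: v + (t *: w + x)) - f (t *: v + x) - (f (t *: w + x) - f x)
    = t * t * 'D_w ('D_v f) (a *: v + (b *: w + x))].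
Proof.
move=> t0 [cf df] Uab.
have [dv [cv dv2]] := df v.
have [dw _] := dv2 w.
have Ua (a : R) : 0 <= a <= t -> U (a *: v + x).
  by move=> at_; have := Uab a 0 at_; rewrite scale0r add0r lexx; apply.
pose F y := f (t *: w + y) - f y.
have dF (a : R) : 0 <= a <= t -> is_derive (a *: v + x) v F
    ('D_v f (t *: w + (a *: v + x)) - 'D_v f (a *: v + x)).
  move=> a0; have Uat : U (t *: w + (a *: v + x)) by rewrite addrCA; apply: Uab => //; rewrite t0 lexx.
  apply: is_deriveB; last by apply: derivableP; apply: dv; apply: Ua.
  have E : (fun h : R => h^-1 *: (f (t *: w + (h *: v + (a *: v + x))) - f (t *: w + (a *: v + x))))
    = (fun h : R => h^-1 *: (f (h *: v + (t *: w + (a *: v + x))) - f (t *: w + (a *: v + x)))).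
    by apply/funext => h; rewrite addrCA.
  by split; rewrite /derivable /derive E //; apply: dv.
have [] := @line_MVT R V F x v t t0; first by move=> s /dF[].
move=> a at_; have [_ ->] := dF a at_; rewrite /F => EF.
have [|b bt] := @line_MVT R V ('D_v f) (a *: v + x) w t t0.
  by move=> s st; apply: dw; rewrite addrCA; apply: Uab.
move=> E2; exists a, b; split; [exact: at_|exact: bt|].
rewrite [b *: w + _]addrCA in E2.
by rewrite [t *: v + (_ + _)]addrCA EF E2 mulrA.
Qed.

(** The second difference over a parallelogram is symmetric in [v] and [w], so the two mixed
    derivatives agree at some two points of every small parallelogram; continuity carries this to
    [x]. *)
Lemma schwarz (U : set V) (f : V -> R) x v w : open U -> U x -> Ck 2 U f ->
  'D_v ('D_w f) x = 'D_w ('D_v f) x.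
Proof.
move=> oU Ux c2; have [_ df] := c2.
have [_ [_ dv2]] := df v; have [_ [cwv _]] := dv2 w.
have [_ [_ dw2]] := df w; have [_ [cvw _]] := dw2 v.
apply/eqP; rewrite -subr_eq0 -normr_eq0; apply/negPn/negP => n0.
set e := `|_| in n0.
have e0 : 0 < e by rewrite lt_neqAle eq_sym n0 normr_ge0.
have e3 : 0 < e / 3 by rewrite divr_gt0.
have nU : nbhs x U by apply: open_nbhs_nbhs.
have /cvgrPdist_lt/(_ _ e3) n1 := cwv x Ux.
have /cvgrPdist_lt/(_ _ e3) n2 := cvw x Ux.
have [d /= d0 dP] := (nbhs_ballP _ _).1 (filterI nU (filterI n1 n2)).
(* Parallelograms with sides [t v] and [t w] must stay in the ball of radius [d]; the [+ 1] makes
   [N] positive when both directions vanish. *)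
pose N := `|v| + `|w| + 1.
have N0 : 0 < N by rewrite ltr_wpDl // addr_ge0.
pose t := d / 2 / N.
have t0 : 0 < t by rewrite !divr_gt0.
have Bt (a b : R) (v' w' : V) : `|v'| + `|w'| <= N -> 0 <= a <= t -> 0 <= b <= t -> ball x d (a *: v' + (b *: w' + x)).
  move=> vw /andP[a0 at_] /andP[b0 bt].
  rewrite -ball_normE /= addrA opprD addrCA subrr addr0 normrN.
  apply: le_lt_trans (ler_normD _ _) _; rewrite !normrZ (ger0_norm a0) (ger0_norm b0).
  apply: (@le_lt_trans _ _ (t * (`|v'| + `|w'|))).
    by rewrite mulrDr lerD // ler_wpM2r.
  apply: (@le_lt_trans _ _ (t * N)); first by rewrite ler_wpM2l // ltW.
  by rewrite /t divfK ?gt_eqF // ltr_pdivrMr // ltr_pMr // ltr1n.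
have vwN : `|v| + `|w| <= N by rewrite lerDl.
have wvN : `|w| + `|v| <= N by rewrite [leLHS]addrC lerDl.
have [|a [b [at_ bt E1]]] := @second_difference U f x v w t (ltW t0) c2.
  by move=> a b at_ bt; have [] := dP _ (Bt a b _ _ vwN at_ bt).
have [|a' [b' [at' bt' E2]]] := @second_difference U f x w v t (ltW t0) c2.
  by move=> a' b' at' bt'; have [] := dP _ (Bt a' b' _ _ wvN at' bt').
have EE : 'D_w ('D_v f) (a *: v + (b *: w + x)) = 'D_v ('D_w f) (a' *: w + (b' *: v + x)).
  apply: (@mulfI _ (t * t)); first by rewrite mulf_neq0 // gt_eqF.
  have swap (A B C D : R) : A - B - (C - D) = A - C - (B - D) by ring.
  rewrite [t *: w + (t *: v + _)]addrCA in E2.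
  by apply: etrans E2; apply: etrans (esym E1) _; exact: swap.
have [_ [A1 _]] := dP _ (Bt _ _ _ _ vwN at_ bt).
have [_ [_ A2]] := dP _ (Bt _ _ _ _ wvN at' bt').
rewrite EE in A1.
have : e < e; last by rewrite ltxx.
rewrite distrC in A1; have := ltrD A2 A1.
rewrite {1 2}/e => /(le_lt_trans (ler_distD _ _ _))/lt_trans; apply.
by rewrite -/e; clear -e0; lra.
Qed.

End Schwarz.

Lemma derive_line (R : realType) (V W : normedModType R) (f : V -> W) (x v : V) :
  'D_1 (fun s : R => f (s *: v + x)) 0 = 'D_v f x.
Proof.
rewrite /derive; congr (lim (_ @ 0^')); apply/funext => h.
by rewrite /= scale0r add0r addr0 [h *: 1]mulr1.
Qed.

Lemma Ck_derive (R : realType) (V W : normedModType R) (U : set V) k (f : V -> W) v :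
  Ck k.+1 U f -> Ck k U ('D_v f).
Proof. by move=> [_ /(_ v)[]]. Qed.

Lemma open_pos (R : realType) : open [set t : R | 0 < t].
Proof. exact: open_gt. Qed.

Section OneDimensional.
Context (R : realType).

Lemma Ck_antiderivative k (I : set R) (f f' : R -> R) : open I ->
  (forall x, I x -> is_derive x (1 : R) f (f' x)) -> Ck k I f' -> Ck k.+1 I f.
Proof.
move=> oI df cf'; split.
  move=> x Ix; apply: differentiable_continuous; apply/derivable1_diffP.
  by have [] := df x Ix.
move=> v; have dv x : I x -> derivable f x v /\ 'D_v f x = v * f' x.
  move=> Ix; have [d <-] := df x Ix.
  by have := derivableZdir v d; rewrite [v *: 1]mulr1.
split; first by move=> x /dv[].
apply: (Ck_eq (f := fun x => v * f' x)) => //; first by move=> x /dv[].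
exact: CkM oI (Ck_cst _ _ _) cf'.
Qed.

(** The derivative 1 / (2 sqrt) is as regular as the square root itself, so each step gains one
    order. *)
Lemma Ck_sqrt k : Ck k [set t : R | 0 < t] Num.sqrt.
Proof.
elim: k => [|k IH]; first by split=> // x _; exact: sqrt_continuous.
have dS (x : R) : 0 < x -> is_derive x (1 : R) Num.sqrt (2 * Num.sqrt x)^-1.
  exact: is_derive1_sqrt.
apply: (Ck_antiderivative (@open_pos R) dS); apply: (Ck_inv (@open_pos R)).
  by move=> x x0; rewrite mulf_neq0 // gt_eqF // sqrtr_gt0.
exact: CkM (@open_pos R) (Ck_cst _ _ _) IH.
Qed.

End OneDimensional.

(** * Functions smooth on the closed half-line *)

Section HalfLine.
Context (R : realType).
Local Notation Ipos := [set t : R | 0 < t].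
Implicit Types (f : R -> R) (t : R).

Lemma halfline_is_derive f t : 0 < t -> cvg (quot_halfline f t @ at_halfline t) ->
  is_derive t (1 : R) f (derive_halfline f t).
Proof.
move=> t0 cf.
have sh : (fun h : R => h *: (1 : R) + t) @ 0^' --> at_halfline t.
  move=> A [e e0 eA].
  (* The bound [t] on the increment keeps [h + t] in the half-line, so the restricted filter sees
     every small increment. *)
  exists (Num.min e t) => /=; first by rewrite lt_min e0.
  move=> h /=; rewrite sub0r normrN lt_min => /andP[he ht] h0.
  have E : h *: (1 : R) + t = h + t by rewrite [h *: 1]mulr1.
  rewrite /= E; apply: eA => /=.
  - by rewrite opprD addrCA subrr addr0 normrN.
  - by rewrite -subr_eq0 addrK.
  - by move: ht; rewrite ltr_norml => /andP[h1 h2]; clear -h1; lra.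
have c := cvg_comp _ _ sh cf.
have E : quot_halfline f t \o (fun h : R => h *: (1 : R) + t) =
    (fun h : R => h^-1 *: (f (h *: (1 : R) + t) - f t)).
  by apply/funext => h; rewrite /quot_halfline /= addrK [h *: 1]mulr1 mulrC.
have {}c : (fun h : R => h^-1 *: (f (h *: (1 : R) + t) - f t)) @ 0^' --> derive_halfline f t.
  by rewrite -E; exact: c.
by split; [apply/cvg_ex; exists (derive_halfline f t)|apply: cvg_lim].
Qed.

(** Stated for every iterated derivative, so that the induction on the class can pass from one to
    the next. *)
Lemma smooth_halfline_Ck f k j : smooth_halfline f -> Ck k Ipos (iter j (@derive_halfline R) f).
Proof.
move=> sf; have d i t : 0 < t -> is_derive t (1 : R) (iter i (@derive_halfline R) f)
    (iter i.+1 (@derive_halfline R) f t).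
  by move=> t0; apply: halfline_is_derive => //; apply: sf; exact: ltW.
elim: k j => [|k IH] j.
  split=> // x x0; apply: differentiable_continuous; apply/derivable1_diffP.
  by have [] := d j x x0.
exact: Ck_antiderivative (@open_pos R) (d j) (IH j.+1).
Qed.

(** From f(t) = f(0) + quotient * t. Smoothness at 0 enters the proof only through such limits from
    the right. *)
Lemma halfline_cvg0 f : cvg (quot_halfline f 0 @ at_halfline 0) -> f t @[t --> 0^'+] --> f 0.
Proof.
move=> cf.
have sub : (fun t : R => t) @ 0^'+ --> at_halfline (0 : R).
  move=> A [e e0 eA]; exists e => // s /= se s0.
  by apply: eA => //=; [rewrite gt_eqF|exact: ltW].
have c := cvg_comp _ _ sub cf.
have idc : (fun t : R => t) @ 0^'+ --> (0 : R) by apply: cvg_at_right_filter; exact: cvg_id.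
set l := lim _ in c.
have : (fun t => f 0 + quot_halfline f 0 t * t) @ 0^'+ --> f 0 + l * 0.
  by apply: cvgD; [exact: cvg_cst|apply: cvgM; [exact: c|exact: idc]].
rewrite mulr0 addr0; apply: cvg_trans; apply: near_eq_cvg; near=> t.
have t0 : 0 < t by near: t; exact: nbhs_right_gt.
by rewrite /= /quot_halfline subr0 divfK ?gt_eqF // addrC subrK.
Unshelve. all: by end_near. Qed.

End HalfLine.

Section Entries.
Context (R : realType) (m : nat).
Implicit Types (U : set 'rV[R]_m) (k : nat).

Lemma Ck_entry p q U k (A : 'rV[R]_m -> 'M[R]_(p, q)) i j : open U ->
  Ck k U A -> Ck k U (fun x => A x i j).
Proof. by move=> oU /(Ck_mx _ _ oU). Qed.

Lemma Ck_entries p q U k (A : 'rV[R]_m -> 'M[R]_(p, q)) : open U ->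
  (forall i j, Ck k U (fun x => A x i j)) -> Ck k U A.
Proof. by move=> oU /(Ck_mx _ _ oU). Qed.

Lemma Ck_partial U k (f : 'rV[R]_m -> R) a : Ck k.+1 U f -> Ck k U (partial f a).
Proof. by move=> [_ /(_ (delta_mx 0 a))[_]]. Qed.

End Entries.

(** * Coordinates (x, v) on the tangent bundle and their slices *)

Section RowBlocks.
Context (R : realType) (n : nat).
Implicit Types (x v : 'rV[R]_n) (z : 'rV[R]_(n + n)).

Lemma lsubmx_affine (h : R) (w z : 'rV[R]_(n + n)) :
  lsubmx (h *: w + z) = h *: lsubmx w + lsubmx z.
Proof. by apply/matrixP => i j; rewrite !mxE. Qed.

Lemma rsubmx_affine (h : R) (w z : 'rV[R]_(n + n)) :
  rsubmx (h *: w + z) = h *: rsubmx w + rsubmx z.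
Proof. by apply/matrixP => i j; rewrite !mxE. Qed.

Lemma derive_lsubmx (W : normedModType R) (f : 'rV[R]_n -> W) z w :
  'D_w (fun y => f (lsubmx y)) z = 'D_(lsubmx w) f (lsubmx z).
Proof.
have E : (fun h : R => h^-1 *: (f (lsubmx (h *: w + z)) - f (lsubmx z))) =
  (fun h => h^-1 *: (f (h *: lsubmx w + lsubmx z) - f (lsubmx z))).
  by apply/funext => h; rewrite lsubmx_affine.
by rewrite /derive E.
Qed.

Lemma derive_rslice (W : normedModType R) (f : 'rV[R]_(n + n) -> W) z v :
  'D_(row_mx 0 v) f z = 'D_v (fun y => f (row_mx (lsubmx z) y)) (rsubmx z).
Proof.
have E : (fun h : R => h^-1 *: (f (h *: row_mx 0 v + z) - f z)) =
  (fun h => h^-1 *: (f (row_mx (lsubmx z) (h *: v + rsubmx z)) - f (row_mx (lsubmx z) (rsubmx z)))).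
  apply/funext => h; rewrite hsubmxK; congr (_ *: (f _ - _)).
  by rewrite -{1}(hsubmxK z) scale_row_mx scaler0 add_row_mx add0r.
by rewrite /derive E.
Qed.

Lemma lsubmx_continuous : continuous (@lsubmx R 1 n n).
Proof. by move=> z; apply: differentiable_continuous; exact: differentiable_lsubmx. Qed.

Lemma rsubmx_continuous : continuous (@rsubmx R 1 n n).
Proof. by move=> z; apply: differentiable_continuous; exact: differentiable_rsubmx. Qed.

Lemma row_mx_continuous x : continuous (fun v => row_mx x v).
Proof.
have [c _] : Ck 0 setT (fun v => row_mx x v); last by move=> v; exact: c.
apply: (Ck_entries openT) => i j; case: (split_ordP j) => k ->.
  by apply: (Ck_eq openT _ (Ck_cst setT 0 (x i k))) => v _; rewrite row_mxEl.
by apply: (Ck_eq openT _ (Ck_coord setT 0 k)) => v _; rewrite row_mxEr ord1.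
Qed.

Lemma Ck_lsub k (W : normedModType R) (U : set 'rV[R]_n) (V : set 'rV[R]_(n + n)) (f : 'rV[R]_n -> W) :
  (forall z, V z -> U (lsubmx z)) -> Ck k U f -> Ck k V (fun z => f (lsubmx z)).
Proof.
move=> VU; apply: (@Ck_comp_affine _ _ _ _ _ _ _ _ (@lsubmx R 1 n n) (@lsubmx R 1 n n)) => //.
- exact: lsubmx_continuous.
- by move=> h z w; rewrite lsubmx_affine.
Qed.

Lemma Ck_rsub k (W : normedModType R) (U : set 'rV[R]_n) (V : set 'rV[R]_(n + n)) (f : 'rV[R]_n -> W) :
  (forall z, V z -> U (rsubmx z)) -> Ck k U f -> Ck k V (fun z => f (rsubmx z)).
Proof.
move=> VU; apply: (@Ck_comp_affine _ _ _ _ _ _ _ _ (@rsubmx R 1 n n) (@rsubmx R 1 n n)) => //.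
- exact: rsubmx_continuous.
- by move=> h z w; rewrite rsubmx_affine.
Qed.

Lemma Ck_rslice k (W : normedModType R) (V : set 'rV[R]_(n + n)) (f : 'rV[R]_(n + n) -> W) x :
  Ck k V f -> Ck k [set v | V (row_mx x v)] (fun v => f (row_mx x v)).
Proof.
apply: (@Ck_comp_affine _ _ _ _ _ _ _ _ (fun v => row_mx x v) (fun v => row_mx 0 v)) => //.
- exact: row_mx_continuous.
- by move=> h z w; rewrite scale_row_mx scaler0 add_row_mx add0r.
Qed.

End RowBlocks.

(** * Matrix calculus and moving frames *)

#[local] Opaque derive Ck.

HB.lock Definition pd (R : realType) (m p q : nat) (a : 'I_m)
    (A : 'rV[R]_m -> 'M[R]_(p, q)) (x : 'rV[R]_m) : 'M[R]_(p, q) :=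
  \matrix_(i, j) partial (fun y => A y i j) a x.

(** Row [b] and column [c] carry Gamma_ab^c: on row vectors the covariant derivative along the a-th
    coordinate field is Y |-> d_a Y + Y Gamma_a. *)
HB.lock Definition chris (R : realType) (m : nat) (h : 'rV[R]_m -> 'M[R]_m)
    (a : 'I_m) (x : 'rV[R]_m) : 'M[R]_m :=
  \matrix_(b, c) christoffel h a b c x.

(** R(X_a, X_b) as an endomorphism acting on row vectors from the right. *)
HB.lock Definition riem (R : realType) (m : nat) (h : 'rV[R]_m -> 'M[R]_m)
    (a b : 'I_m) (x : 'rV[R]_m) : 'M[R]_m :=
  \matrix_(c, d) riemann h a b c d x.

Section MatrixCalculus.
Context (R : realType) (m : nat).
Implicit Types (U : set 'rV[R]_m) (k : nat) (x : 'rV[R]_m) (a b : 'I_m).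

Lemma pdE p q a (A : 'rV[R]_m -> 'M[R]_(p, q)) x i j :
  pd a A x i j = partial (fun y => A y i j) a x.
Proof. by rewrite pd.unlock mxE. Qed.

Lemma eq_partial (f g : 'rV[R]_m -> R) a x : f =1 g -> partial f a x = partial g a x.
Proof. by move=> /funext ->. Qed.

Lemma Ck_pd p q U k (A : 'rV[R]_m -> 'M[R]_(p, q)) a : open U ->
  Ck k.+1 U A -> Ck k U (pd a A).
Proof.
move=> oU cA; apply: Ck_entries => // i j.
have := Ck_partial a (Ck_entry i j oU cA); apply: Ck_eq => // x _.
by rewrite pdE.
Qed.

Lemma Ck_mulmx p q r U k (A : 'rV[R]_m -> 'M[R]_(p, q)) (B : 'rV[R]_m -> 'M[R]_(q, r)) :
  open U -> Ck k U A -> Ck k U B -> Ck k U (fun x => A x *m B x).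
Proof.
move=> oU cA cB; apply: Ck_entries => // i j.
apply: (Ck_eq (f := fun x => \sum_l A x i l * B x l j)) => //.
  by move=> x _; rewrite mxE.
by apply: Ck_sum => // l _; apply: CkM => //; apply: Ck_entry.
Qed.

Lemma Ck_scalemx p q U k (f : 'rV[R]_m -> R) (A : 'rV[R]_m -> 'M[R]_(p, q)) :
  open U -> Ck k U f -> Ck k U A -> Ck k U (fun x => f x *: A x).
Proof.
move=> oU cf cA; apply: Ck_entries => // i j.
apply: (Ck_eq (f := fun x => f x * A x i j)) => //.
  by move=> x _; rewrite mxE.
by apply: CkM => //; apply: Ck_entry.
Qed.

Lemma Ck_oppmx p q U k (A : 'rV[R]_m -> 'M[R]_(p, q)) :
  open U -> Ck k U A -> Ck k U (fun x => - A x).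
Proof.
move=> oU cA; apply: Ck_entries => // i j.
apply: (Ck_eq (f := fun x => - A x i j)) => //.
  by move=> x _; rewrite mxE.
by apply: CkN => //; apply: Ck_entry.
Qed.

Lemma Ck_trmx p q U k (A : 'rV[R]_m -> 'M[R]_(p, q)) :
  open U -> Ck k U A -> Ck k U (fun x => (A x)^T).
Proof.
move=> oU cA; apply: Ck_entries => // i j.
apply: (Ck_eq (f := fun x => A x j i)) => //.
  by move=> x _; rewrite mxE.
exact: Ck_entry.
Qed.

Lemma Ck_block p1 p2 q1 q2 U k (A : 'rV[R]_m -> 'M[R]_(p1, q1))
  (B : 'rV[R]_m -> 'M[R]_(p1, q2)) (C : 'rV[R]_m -> 'M[R]_(p2, q1)) (D : 'rV[R]_m -> 'M[R]_(p2, q2)) :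
  open U -> Ck k U A -> Ck k U B -> Ck k U C -> Ck k U D ->
  Ck k U (fun x => block_mx (A x) (B x) (C x) (D x)).
Proof.
move=> oU cA cB cC cD; apply: Ck_entries => // i j.
case: (split_ordP i) => i' ->; case: (split_ordP j) => j' ->.
- by apply: Ck_eq (Ck_entry i' j' oU cA) => // x _; rewrite block_mxEul.
- by apply: Ck_eq (Ck_entry i' j' oU cB) => // x _; rewrite block_mxEur.
- by apply: Ck_eq (Ck_entry i' j' oU cC) => // x _; rewrite block_mxEdl.
- by apply: Ck_eq (Ck_entry i' j' oU cD) => // x _; rewrite block_mxEdr.
Qed.

Lemma Ck_det p U k (A : 'rV[R]_m -> 'M[R]_p) :
  open U -> Ck k U A -> Ck k U (fun x => \det (A x)).
Proof.
move=> oU cA; apply: Ck_sum => // s _; apply: CkM => //; first exact: Ck_cst.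
by apply: Ck_prod => // i _; apply: Ck_entry.
Qed.

(** Cramer's rule: cofactors divided by a determinant that does not vanish. *)
Lemma Ck_invmx p U k (A : 'rV[R]_m -> 'M[R]_p) : open U ->
  (forall x, U x -> A x \in unitmx) -> Ck k U A -> Ck k U (fun x => invmx (A x)).
Proof.
move=> oU uA cA; apply: Ck_entries => // i j.
apply: (Ck_eq (f := fun x => (\det (A x))^-1 * cofactor (A x) j i)) => //.
  by move=> x Ux; rewrite /invmx uA // !mxE.
apply: CkM => //.
  apply: Ck_inv => //; last exact: Ck_det.
  by move=> x Ux; have := uA x Ux; rewrite unitmxE unitfE.
apply: CkM => //; first exact: Ck_cst.
apply: Ck_det => //; apply: Ck_entries => // i' j'.
apply: (Ck_eq (f := fun x => A x (lift j i') (lift i j'))) => //.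
  by move=> x _; rewrite !mxE.
exact: Ck_entry.
Qed.

#[local] Opaque invmx.

Lemma pd_eq p q U a (A B : 'rV[R]_m -> 'M[R]_(p, q)) x : open U -> U x ->
  (forall y, U y -> A y = B y) -> pd a A x = pd a B x.
Proof.
move=> oU Ux AB; apply/matrixP => i j; rewrite 2!pdE.
by apply: derive_open oU _ Ux => y Uy; rewrite AB.
Qed.

Lemma pd_cst p q a (A : 'M[R]_(p, q)) x : pd a (fun=> A) x = 0.
Proof. by apply/matrixP => i j; rewrite pdE mxE; exact: derive_cst. Qed.

Lemma pdM p q r U a (A : 'rV[R]_m -> 'M[R]_(p, q)) (B : 'rV[R]_m -> 'M[R]_(q, r)) x :
  open U -> U x -> Ck 1 U A -> Ck 1 U B ->
  pd a (fun y => A y *m B y) x = pd a A x *m B x + A x *m pd a B x.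
Proof.
move=> oU Ux cA cB; apply/matrixP => i j; rewrite pdE !mxE -big_split /=.
have dA l : derivable (fun y => A y i l) x (delta_mx 0 a).
  exact: Ck_derivable (Ck_entry i l oU cA) Ux.
have dB l : derivable (fun y => B y l j) x (delta_mx 0 a).
  exact: Ck_derivable (Ck_entry l j oU cB) Ux.
have -> : (fun y => (A y *m B y) i j) = \sum_l (fun y => A y i l * B y l j).
  by apply/funext => y; rewrite mxE fct_sumE.
rewrite /partial derive_sum; last by move=> l; apply: derivableM.
apply: eq_bigr => l _; rewrite (deriveM (dA l) (dB l)) 2!pdE /partial addrC.
by congr (_ + _); rewrite -[LHS]mulrC.
Qed.

Lemma pdD p q U a (A B : 'rV[R]_m -> 'M[R]_(p, q)) x :
  open U -> U x -> Ck 1 U A -> Ck 1 U B ->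
  pd a (fun y => A y + B y) x = pd a A x + pd a B x.
Proof.
move=> oU Ux cA cB; apply/matrixP => i j; rewrite [RHS]mxE 3!pdE.
rewrite (_ : (fun y => (A y + B y) i j) = (fun y => A y i j) \+ (fun y => B y i j)).
  by apply: deriveD; [exact: Ck_derivable (Ck_entry i j oU cA) Ux
                    |exact: Ck_derivable (Ck_entry i j oU cB) Ux].
by apply/funext => y; rewrite mxE.
Qed.

Lemma pdZ p q U a (f : 'rV[R]_m -> R) (A : 'rV[R]_m -> 'M[R]_(p, q)) x :
  open U -> U x -> Ck 1 U f -> Ck 1 U A ->
  pd a (fun y => f y *: A y) x = partial f a x *: A x + f x *: pd a A x.
Proof.
move=> oU Ux cf cA; apply/matrixP => i j; rewrite [RHS]mxE [X in _ = X + _]mxE [X in _ = _ + X]mxE 2!pdE.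
rewrite (_ : (fun y => (f y *: A y) i j) = f * (fun y => A y i j)); last first.
  by apply/funext => y; rewrite mxE.
rewrite {1}/partial (deriveM (Ck_derivable cf Ux) (Ck_derivable (Ck_entry i j oU cA) Ux)).
by rewrite addrC; congr (_ + _); rewrite -[LHS]mulrC.
Qed.

Lemma pd_trmx p q a (A : 'rV[R]_m -> 'M[R]_(p, q)) x :
  pd a (fun y => (A y)^T) x = (pd a A x)^T.
Proof.
apply/matrixP => i j; rewrite [LHS]pdE [RHS]mxE pdE.
by apply: eq_partial => y; rewrite mxE.
Qed.

Lemma pd_block p1 p2 q1 q2 a (A : 'rV[R]_m -> 'M[R]_(p1, q1))
  (B : 'rV[R]_m -> 'M[R]_(p1, q2)) (C : 'rV[R]_m -> 'M[R]_(p2, q1)) (D : 'rV[R]_m -> 'M[R]_(p2, q2)) x :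
  pd a (fun y => block_mx (A y) (B y) (C y) (D y)) x =
  block_mx (pd a A x) (pd a B x) (pd a C x) (pd a D x).
Proof.
apply/matrixP => i j.
case: (split_ordP i) => i' ->; case: (split_ordP j) => j' ->;
  rewrite ?(block_mxEul, block_mxEur, block_mxEdl, block_mxEdr) [LHS]pdE [RHS]pdE.
- by apply: eq_partial => y; rewrite block_mxEul.
- by apply: eq_partial => y; rewrite block_mxEur.
- by apply: eq_partial => y; rewrite block_mxEdl.
- by apply: eq_partial => y; rewrite block_mxEdr.
Qed.

Lemma pdC p q U a b (A : 'rV[R]_m -> 'M[R]_(p, q)) x : open U -> U x -> Ck 2 U A ->
  pd a (pd b A) x = pd b (pd a A) x.
Proof.
move=> oU Ux cA; apply/matrixP => i j; rewrite [LHS]pdE [RHS]pdE.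
have E c : (fun y => pd c A y i j) = partial (fun y => A y i j) c.
  by apply/funext => y; rewrite pdE.
rewrite !E; exact: (@schwarz _ _ U (fun y => A y i j) x _ _ oU Ux (Ck_entry i j oU cA)).
Qed.

Lemma partial_trace p a (A : 'rV[R]_m -> 'M[R]_p) U x : open U -> U x -> Ck 1 U A ->
  partial (fun y => \tr (A y)) a x = \tr (pd a A x).
Proof.
move=> oU Ux cA.
have -> : (fun y => \tr (A y)) = \sum_l (fun y => A y l l).
  by apply/funext => y; rewrite fct_sumE.
rewrite /partial derive_sum; last by move=> l; exact: Ck_derivable (Ck_entry l l oU cA) Ux.
by apply: eq_bigr => l _; rewrite pdE.
Qed.

End MatrixCalculus.

Section Frames.
Context (R : realType) (m : nat).
Implicit Types (U : set 'rV[R]_m) (h : 'rV[R]_m -> 'M[R]_m) (x : 'rV[R]_m) (a b : 'I_m).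

Lemma chrisE h a x b c : chris h a x b c = christoffel h a b c x.
Proof. by rewrite chris.unlock mxE. Qed.

Lemma riem_entry h a b x c d : riem h a b x c d = riemann h a b c d x.
Proof. by rewrite riem.unlock mxE. Qed.

(** With nabla_a Y = d_a Y + Y w_a on row vectors, the commutator of nabla_a and nabla_b acts on the
    right by this matrix; this fixes the order of the products. *)
Definition curv p (w : 'I_m -> 'rV[R]_m -> 'M[R]_p) a b x : 'M[R]_p :=
  pd a (w b) x - pd b (w a) x + (w b x *m w a x - w a x *m w b x).

Lemma riemE h a b x : riem h a b x = curv (chris h) a b x.
Proof.
apply/matrixP => c d; rewrite riem_entry /riemann /curv.
have E a' : (fun y => chris h a' y c d) = christoffel h a' c d.
  by apply/funext => y; rewrite chrisE.
rewrite sumrB 3!mxE [in RHS]mxE 2!pdE !E; congr (_ + _).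
by rewrite 3!mxE; congr (_ - _); apply: eq_bigr => e _; rewrite !chrisE.
Qed.

Lemma Ck_chris U k h a : open U -> (forall x, U x -> h x \in unitmx) ->
  Ck k.+1 U h -> Ck k U (chris h a).
Proof.
move=> oU uh ch; apply: Ck_entries => // b c.
apply: (Ck_eq (f := christoffel h a b c)) => //; first by move=> x _; rewrite chrisE.
have cp i j l : Ck k U (partial (fun y => h y i j) l).
  exact: Ck_partial (Ck_entry i j oU ch).
apply: CkM => //; first exact: Ck_cst.
apply: Ck_sum => // d _; apply: CkM => //.
  exact: Ck_entry (Ck_invmx oU uh (CkS ch)).
apply: CkD => //; last exact: CkN.
exact: CkD.
Qed.

Lemma Ck_riem U k h a b : open U -> (forall x, U x -> h x \in unitmx) ->
  Ck k.+2 U h -> Ck k U (riem h a b).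
Proof.
move=> oU uh ch.
apply: (Ck_eq (f := curv (chris h) a b)) => //; first by move=> x _; rewrite riemE.
have cc c : Ck k.+1 U (chris h c) by exact: Ck_chris.
have c0 c : Ck k U (chris h c) by exact: CkS.
by do ![apply: CkD|apply: Ck_oppmx|apply: Ck_mulmx|apply: Ck_pd] => //.
Qed.

(** Multiplication by [h] lowers the upper index and leaves the Christoffel symbols of the first
    kind, free of the inverse matrix. *)
Lemma chris_mul h a x : (h x)^T = h x -> h x \in unitmx ->
  forall b c, (chris h a x *m h x) b c =
  2^-1 * (pd a h x b c + pd b h x a c - pd c h x a b).
Proof.
move=> hs hu b c.
pose K d := pd a h x b d + pd b h x a d - pd d h x a b.
have chE d : chris h a x b d = 2^-1 * \sum_e invmx (h x) d e * K e.
  rewrite chrisE /christoffel; congr (_ * _); apply: eq_bigr => e _.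
  by rewrite /K (pdE a) (pdE b) (pdE e).
transitivity (2^-1 * \sum_d K d * (invmx (h x) *m h x) d c).
  rewrite [LHS]mxE; under eq_bigr do rewrite chE -mulrA mulr_suml.
  rewrite -mulr_sumr exchange_big /=; congr (_ * _); apply: eq_bigr => d _.
  rewrite [in RHS]mxE mulr_sumr; apply: eq_bigr => e _.
  have -> : invmx (h x) e d = invmx (h x) d e.
    by rewrite -[in RHS]hs -trmx_inv mxE.
  by rewrite mulrCA mulrA.
rewrite mulVmx // (bigD1 c) //= big1 ?addr0; last first.
  by move=> d dc; rewrite mxE (negbTE dc) mulr0.
by rewrite mxE eqxx mulr1.
Qed.

Variables (U : set 'rV[R]_m) (h th et : 'rV[R]_m -> 'M[R]_m)
  (w : 'I_m -> 'rV[R]_m -> 'M[R]_m).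

(* [th] is the matrix of a coframe (rows are indexed by the coordinates), [et]
   the metric in that frame and [w a] the connection form evaluated on the
   a-th coordinate field; the connection is metric and torsion free. *)
Record lc_frame : Prop := LcFrame {
  fr_open : open U ;
  fr_unit : forall x, U x -> h x \in unitmx ;
  fr_th : Ck 1 U th ;
  fr_et : Ck 1 U et ;
  fr_et_sym : forall x, U x -> (et x)^T = et x ;
  fr_h : forall x, U x -> h x = th x *m et x *m (th x)^T ;
  fr_metric : forall x a, U x -> pd a et x = w a x *m et x + et x *m (w a x)^T ;
  fr_torsion : forall x a b, U x ->
    row b (pd a th x + th x *m w a x) = row a (pd b th x + th x *m w b x) }.

Hypothesis fr : lc_frame.

Lemma fr_th_unit x : U x -> th x \in unitmx.
Proof.
by move=> Ux; have := fr_unit fr Ux; rewrite fr_h // !unitmx_mul => /andP[/andP[]].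
Qed.

Lemma fr_et_unit x : U x -> et x \in unitmx.
Proof.
by move=> Ux; have := fr_unit fr Ux; rewrite fr_h // !unitmx_mul => /andP[/andP[]].
Qed.

(** Uniqueness of the Levi-Civita connection. With all indices lowered to coordinates, metricity
    reads [pd c h x = M c + (M c)^T], vanishing torsion is the symmetry of [M] in its first two
    indices, and Koszul's formula recovers [M]. *)
Lemma frame_christoffel x a : U x -> chris h a x *m th x = pd a th x + th x *m w a x.
Proof.
move=> Ux; have oU := fr_open fr.
pose T c := pd c th x + th x *m w c x.
pose M c := T c *m et x *m (th x)^T.
have pdh c : pd c h x = M c + (M c)^T.
  rewrite (pd_eq c oU Ux (fr_h fr)) (pdM c oU Ux) ?(pdM c oU Ux); first last.
  - exact: Ck_trmx oU (fr_th fr).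
  - exact: Ck_mulmx oU (fr_th fr) (fr_et fr).
  - exact: fr_et fr.
  - exact: fr_th fr.
  rewrite fr_metric // pd_trmx /M /T !trmx_mul !linearD /= !trmxK fr_et_sym // trmx_mul.
  rewrite !(mulmxDl, mulmxDr) !mulmxA -!addrA; congr (_ + _).
  by congr (_ + _); rewrite addrC.
have Msym i j k : M i j k = M j i k.
  have := fr_torsion fr i j Ux; rewrite -/(T i) -/(T j) => E.
  have : row j (M i) = row i (M j) by rewrite /M -!mulmxA !row_mul E.
  by move/rowP/(_ k); rewrite !mxE.
have hs : (h x)^T = h x by rewrite fr_h // !trmx_mul trmxK fr_et_sym // mulmxA.
have : chris h a x *m h x = M a.
  apply/matrixP => b c; rewrite chris_mul ?fr_unit // !pdh.
  rewrite ![(_ + _^T)%R _ _]mxE ![(_^T)%R _ _]mxE.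
  rewrite (Msym b a) (Msym b c a) (Msym c a) (Msym a c).
  have -> : M c a b = M a c b by rewrite Msym.
  by field.
rewrite {1}fr_h // /M !mulmxA => /(congr1 (mulmx ^~ (invmx (th x)^T))).
rewrite !mulmxK ?unitmx_tr ?fr_th_unit // => /(congr1 (mulmx ^~ (invmx (et x)))).
by rewrite !mulmxK ?fr_et_unit.
Qed.

(** Differentiate [frame_christoffel] and antisymmetrize: the second derivatives of [th] cancel by
    symmetry, its first derivatives cancel against the quadratic terms, and only the curvature of
    [w] remains. *)
Lemma frame_riemann x a b : Ck 2 U th -> (forall c, Ck 1 U (w c)) -> Ck 2 U h -> U x ->
  riem h a b x *m th x = th x *m curv w a b x.
Proof.
move=> cth cw ch Ux; have oU := fr_open fr.
have cc c : Ck 1 U (chris h c) by exact: Ck_chris oU (fr_unit fr) ch.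
have D c d : pd c (chris h d) x *m th x =
    pd c (pd d th) x + pd c th x *m w d x + th x *m pd c (w d) x - chris h d x *m pd c th x.
  apply/eqP; rewrite eq_sym subr_eq eq_sym; apply/eqP.
  have E := pd_eq c oU Ux (fun y => @frame_christoffel y d).
  have cth1 := CkS cth; have cm := Ck_mulmx oU cth1 (cw d).
  rewrite (pdM c oU Ux (cc d) cth1) (pdD c oU Ux (Ck_pd d oU cth) cm) in E.
  by rewrite (pdM c oU Ux cth1 (cw d)) addrA in E.
have E c d : chris h d x *m chris h c x *m th x =
   chris h d x *m pd c th x + (pd d th x + th x *m w d x) *m w c x.
  by rewrite -mulmxA frame_christoffel // mulmxDr mulmxA frame_christoffel.
rewrite riemE /curv !mulmxDl !mulNmx (D a b) (D b a) (E a b) (E b a) (pdC a b oU Ux cth).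
rewrite !(mulmxDl, mulmxDr, mulmxN, mulmxA).
move: (pd b (pd a th) x) (pd a th x *m w b x) (th x *m pd a (w b) x) (chris h b x *m pd a th x)
  (pd b th x *m w a x) (th x *m pd b (w a) x) (chris h a x *m pd b th x)
  (th x *m w b x *m w a x) (th x *m w a x *m w b x) => t1 t2 t3 t4 t5 t6 t7 t8 t9.
apply/matrixP => i j; rewrite !mxE; ring.
Qed.

End Frames.

Section Slices.
Context (R : realType) (n : nat).
Implicit Types (x v : 'rV[R]_n) (z : 'rV[R]_(n + n)) (a d : 'I_n).

Lemma delta_lshift a : delta_mx 0 (lshift n a) = row_mx (delta_mx 0 a) 0 :> 'rV[R]_(n + n).
Proof.
apply/rowP => j; case: (split_ordP j) => k ->; rewrite ?row_mxEl ?row_mxEr !mxE eqxx /=.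
  by rewrite (inj_eq (@lshift_inj _ _)).
by rewrite eq_rlshift.
Qed.

Lemma delta_rshift a : delta_mx 0 (rshift n a) = row_mx 0 (delta_mx 0 a) :> 'rV[R]_(n + n).
Proof.
apply/rowP => j; case: (split_ordP j) => k ->; rewrite ?row_mxEl ?row_mxEr !mxE eqxx /=.
  by rewrite eq_lrshift.
by rewrite (inj_eq (@rshift_inj _ _)).
Qed.

Lemma partial_lsub_l (f : 'rV[R]_n -> R) a z :
  partial (fun y => f (lsubmx y)) (lshift n a) z = partial f a (lsubmx z).
Proof. by rewrite /partial derive_lsubmx delta_lshift row_mxKl. Qed.

Lemma partial_lsub_r (f : 'rV[R]_n -> R) a z :
  partial (fun y => f (lsubmx y)) (rshift n a) z = 0.
Proof. by rewrite /partial derive_lsubmx delta_rshift row_mxKl derive0. Qed.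

Lemma partial_rslice (f : 'rV[R]_(n + n) -> R) a z :
  partial f (rshift n a) z = partial (fun y => f (row_mx (lsubmx z) y)) a (rsubmx z).
Proof. by rewrite /partial delta_rshift derive_rslice. Qed.

Lemma pd_lsub_l p q (A : 'rV[R]_n -> 'M[R]_(p, q)) a z :
  pd (lshift n a) (fun y => A (lsubmx y)) z = pd a A (lsubmx z).
Proof. by apply/matrixP => i j; rewrite !pdE (partial_lsub_l (fun y => A y i j)). Qed.

Lemma pd_lsub_r p q (A : 'rV[R]_n -> 'M[R]_(p, q)) a z :
  pd (rshift n a) (fun y => A (lsubmx y)) z = 0.
Proof. by apply/matrixP => i j; rewrite pdE mxE (partial_lsub_r (fun y => A y i j)). Qed.

Lemma pd_rslice p q (A : 'rV[R]_(n + n) -> 'M[R]_(p, q)) a z :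
  pd (rshift n a) A z = pd a (fun y => A (row_mx (lsubmx z) y)) (rsubmx z).
Proof. by apply/matrixP => i j; rewrite !pdE partial_rslice. Qed.

Lemma Ck_id m k (U : set 'rV[R]_m) : open U -> Ck k U (fun y => y).
Proof.
move=> oU; apply: Ck_entries => // i j; rewrite ord1; exact: Ck_coord.
Qed.

Lemma Ck_rsubmx k (V : set 'rV[R]_(n + n)) : Ck k V (@rsubmx R 1 n n).
Proof.
by apply: (Ck_rsub (U := setT) _ (Ck_id k openT)).
Qed.

Lemma partial_coord m (i j : 'I_m) (x : 'rV[R]_m) :
  partial (fun y : 'rV[R]_m => y 0 j) i x = (i == j)%:R.
Proof.
rewrite /partial; transitivity ((delta_mx 0 i : 'rV[R]_m) 0 j); last by rewrite mxE eqxx eq_sym.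
apply: cvg_lim => //; apply: cvg_near_cst; near=> h.
rewrite /= !mxE addrK [_ *: _]mulrA mulVf ?mul1r //.
by near: h; apply: nbhs_dnbhs_neq.
Unshelve. all: by end_near. Qed.

Lemma pd_rsubmx_l a z : pd (lshift n a) (@rsubmx R 1 n n) z = 0.
Proof.
apply/rowP => j; rewrite pdE !mxE.
rewrite (@eq_partial _ _ _ (fun y => y 0 (rshift n j))); last by move=> y; rewrite mxE.
by rewrite partial_coord eq_lrshift.
Qed.

Lemma pd_rsubmx_r a z : pd (rshift n a) (@rsubmx R 1 n n) z = delta_mx 0 a.
Proof.
apply/rowP => j; rewrite pdE !mxE eqxx /=.
rewrite (@eq_partial _ _ _ (fun y => y 0 (rshift n j))); last by move=> y; rewrite mxE.
by rewrite partial_coord (inj_eq (@rshift_inj _ _)) eq_sym.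
Qed.

End Slices.

(** * The Ricci tensor through Christoffel matrices *)

Section RicciMatrix.
Context (R : realType) (m : nat).
Implicit Types (U : set 'rV[R]_m) (h : 'rV[R]_m -> 'M[R]_m) (x : 'rV[R]_m) (a b c : 'I_m).

Lemma christoffel_sym U h x : open U -> U x -> (forall y, U y -> (h y)^T = h y) ->
  forall a b c, christoffel h a b c x = christoffel h b a c x.
Proof.
move=> oU Ux hs a b c; rewrite /christoffel; congr (_ * _); apply: eq_bigr => d _.
have -> : partial (fun y => h y a b) d x = partial (fun y => h y b a) d x.
  by apply: derive_open oU _ Ux => y Uy; rewrite -{1}hs // mxE.
by rewrite [X in _ * (X - _)]addrC.
Qed.

Lemma chris_sym U h x : open U -> U x -> (forall y, U y -> (h y)^T = h y) ->
  forall a b c, chris h a x b c = chris h b x a c.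
Proof. by move=> oU Ux hs a b c; rewrite !chrisE (christoffel_sym oU). Qed.

Lemma chris_metric U h a x : open U -> U x -> (forall y, U y -> (h y)^T = h y) ->
  h x \in unitmx -> pd a h x = chris h a x *m h x + h x *m (chris h a x)^T.
Proof.
move=> oU Ux hs hu.
have ps d : (pd d h x)^T = pd d h x.
  by rewrite -pd_trmx; apply: pd_eq oU Ux _ => y Uy; rewrite hs.
have ps' d b c : pd d h x b c = pd d h x c b by rewrite -[in LHS]ps mxE.
have -> : h x *m (chris h a x)^T = (chris h a x *m h x)^T by rewrite trmx_mul hs.
apply/matrixP => b c; rewrite [RHS]mxE [X in _ = _ + X]mxE !chris_mul ?hs // (ps' a c b).
by field.
Qed.

(** The symmetry of the lower indices turns the contractions into divergences and traces of the
    matrices [chris], so that a block structure of these can be used term by term. *)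
Lemma ricciE U h b c x : open U -> U x -> (forall y, U y -> (h y)^T = h y) ->
  (forall y, U y -> h y \in unitmx) -> Ck 2 U h ->
  ricci h b c x =
  \sum_k partial (fun y => chris h b y c k) k x
  - partial (fun y => \tr (chris h c y)) b x
  + \sum_l chris h b x c l * \tr (chris h l x) - \tr (chris h c x *m chris h b x).
Proof.
move=> oU Ux hs hu hC; rewrite (partial_trace b oU Ux (Ck_chris c oU hu hC)).
rewrite /ricci /riemann !big_split /= sumrN -[RHS]addrA; congr (_ + _).
  congr (_ - _); apply: eq_bigr => k _.
    by apply: eq_partial => y; rewrite chrisE.
  rewrite pdE; apply: (derive_open _ oU _ Ux) => y Uy.
  by rewrite chrisE (christoffel_sym oU Uy hs).
under eq_bigr do rewrite sumrB.
rewrite sumrB; congr (_ - _).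
  rewrite exchange_big /=; apply: eq_bigr => l _.
  rewrite chrisE /mxtrace mulr_sumr; apply: eq_bigr => k _.
  by rewrite chrisE (christoffel_sym oU Ux hs l).
rewrite /mxtrace; apply: eq_bigr => k _; rewrite mxE; apply: eq_bigr => l _.
by rewrite !chrisE (christoffel_sym oU Ux hs c).
Qed.

End RicciMatrix.

(** * O'Neill's formula for the vertical Ricci tensor *)

(** Row [a] is v^b Gamma_ab^f: the horizontal lift of the a-th coordinate field of the base is the
    a-th coordinate field of the total space minus this vertical vector. *)
HB.lock Definition hor_mx (R : realType) (n : nat) (g : 'rV[R]_n -> 'M[R]_n)
    (z : 'rV[R]_(n + n)) : 'M[R]_n :=
  \matrix_a (rsubmx z *m chris g a (lsubmx z)).

Section HorizontalMatrix.
Context (R : realType) (n : nat) (g : 'rV[R]_n -> 'M[R]_n).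
Implicit Types (z : 'rV[R]_(n + n)) (a b c d e f : 'I_n).

Lemma row_hor_mx a z : row a (hor_mx g z) = rsubmx z *m chris g a (lsubmx z).
Proof. by rewrite hor_mx.unlock rowK. Qed.

Lemma hor_mxE a f z : hor_mx g z a f = (rsubmx z *m chris g a (lsubmx z)) 0 f.
Proof. by rewrite -row_hor_mx mxE. Qed.

Lemma riem_antisym a b (x : 'rV[R]_n) : riem g a b x = - riem g b a x.
Proof.
rewrite !riemE /curv.
by rewrite opprD !opprB.
Qed.

Variables (U : set 'rV[R]_n) (V : set 'rV[R]_(n + n)).
Hypotheses (oU : open U) (oV : open V) (VU : forall z, V z -> U (lsubmx z)).
Hypotheses (gs : forall x, U x -> (g x)^T = g x) (gu : forall x, U x -> g x \in unitmx).
Hypothesis (gC : Ck 2 U g).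

Let Gl a z := chris g a (lsubmx z).

Lemma Ck_Gl a : Ck 1 V (Gl a).
Proof. exact: Ck_lsub VU (Ck_chris _ oU gu gC). Qed.

Lemma Ck_hor_mx : Ck 1 V (hor_mx g).
Proof.
apply: (Ck_entries oV) => a f.
apply: (Ck_eq oV _ (Ck_entry 0 f oV (Ck_mulmx oV (Ck_rsubmx 1 V) (Ck_Gl a)))).
by move=> z _; rewrite hor_mxE.
Qed.

Lemma pd_hor_mx i a z : V z ->
  row a (pd i (hor_mx g) z) = pd i (@rsubmx R 1 n n) z *m Gl a z + rsubmx z *m pd i (Gl a) z.
Proof.
move=> Vz; rewrite -(pdM i oV Vz (Ck_rsubmx 1 V) (Ck_Gl a)).
apply/rowP => f; rewrite mxE 2!pdE; apply: eq_partial => y; exact: hor_mxE.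
Qed.

Lemma pd_hor_mx_r d a z : V z -> row a (pd (rshift n d) (hor_mx g) z) = row d (Gl a z).
Proof.
move=> Vz; rewrite pd_hor_mx // pd_rsubmx_r (pd_lsub_r (chris g a)) mulmx0 addr0.
by rewrite -rowE.
Qed.

Lemma pd_hor_mx_l b a z : V z ->
  row a (pd (lshift n b) (hor_mx g) z) = rsubmx z *m pd b (chris g a) (lsubmx z).
Proof. by move=> Vz; rewrite pd_hor_mx // pd_rsubmx_l mul0mx add0r (pd_lsub_l (chris g a)). Qed.

(** The defect of integrability of the horizontal distribution is R(X_a, X_b)v. This is the source
    of O'Neill's tensor in the torsion equation. *)
Lemma hor_mx_curvature a b z : V z ->
  row b (pd (lshift n a) (hor_mx g) z) + row b (hor_mx g z) *m Gl a z
  - (row a (pd (lshift n b) (hor_mx g) z) + row a (hor_mx g z) *m Gl b z)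
  = rsubmx z *m riem g a b (lsubmx z).
Proof.
move=> Vz; rewrite !pd_hor_mx_l // !row_hor_mx riemE /curv /Gl !(mulmxDr, mulmxN) !mulmxA.
by rewrite opprD -!addrA; congr (_ + _); rewrite addrCA.
Qed.

End HorizontalMatrix.

Section Fibration.
Context (R : realType) (n : nat) (g : 'rV[R]_n -> 'M[R]_n).
Variables (U : set 'rV[R]_n) (V : set 'rV[R]_(n + n)).
Variables (W : 'rV[R]_(n + n) -> 'M[R]_n) (h : 'rV[R]_(n + n) -> 'M[R]_(n + n)).
Implicit Types (z : 'rV[R]_(n + n)) (a b c d e f : 'I_n).

(** Row [i] expresses the i-th coordinate field in the frame of horizontal lifts followed by
    vertical fields. *)
Definition fibration_frame z : 'M[R]_(n + n) := block_mx 1%:M (hor_mx g z) 0 1%:M.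

(* [h] is the metric on the total space of a vector bundle whose horizontal
   distribution is that of the Levi-Civita connection of [g], with fibre metric
   [W]; the last hypothesis says that parallel transport is isometric. *)
Record natural_fibration : Prop := NaturalFibration {
  nf_oU : open U ;
  nf_oV : open V ;
  nf_VU : forall z, V z -> U (lsubmx z) ;
  nf_gs : forall x, U x -> (g x)^T = g x ;
  nf_gu : forall x, U x -> g x \in unitmx ;
  nf_gC : Ck 2 U g ;
  nf_Ws : forall z, V z -> (W z)^T = W z ;
  nf_Wu : forall z, V z -> W z \in unitmx ;
  nf_WC : Ck 2 V W ;
  nf_h : forall z, V z -> h z =
    fibration_frame z *m block_mx (g (lsubmx z)) 0 0 (W z) *m (fibration_frame z)^T ;
  nf_parallel : forall a z, V z -> pd (lshift n a) W z =
    chris g a (lsubmx z) *m W z + W z *m (chris g a (lsubmx z))^T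
    + \sum_c hor_mx g z a c *: pd (rshift n c) W z }.

Hypothesis nf : natural_fibration.

Let oU := nf_oU nf.
Let oV := nf_oV nf.

(** Row [b] is R(X_a, X_b)v, that is, minus the bracket of the horizontal lifts of X_a and X_b. *)
Definition curv_vec a z : 'M[R]_n := \matrix_b (rsubmx z *m riem g a b (lsubmx z)).

Definition oneill_low d z : 'M[R]_n := \matrix_(a, b) (curv_vec a z *m W z) b d.

(* O'Neill's tensor of the submersion. *)
Definition oneill d z : 'M[R]_n := 2^-1 *: (oneill_low d z *m invmx (g (lsubmx z))).

Definition fibre_chris d z : 'M[R]_n :=
  chris (fun v => W (row_mx (lsubmx z) v)) d (rsubmx z).

(* The Levi-Civita connection in the frame of horizontal lifts and vertical
   fields; the first argument of [block_mx] is the horizontal block. *)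
Definition fibration_conn (i : 'I_(n + n)) z : 'M[R]_(n + n) :=
  match fintype.split i with
  | inl a => block_mx (chris g a (lsubmx z) + \sum_c hor_mx g z a c *: oneill c z)
      (- 2^-1 *: curv_vec a z) (\matrix_(c, b) oneill c z a b)
      (chris g a (lsubmx z) + \sum_c hor_mx g z a c *: fibre_chris c z)
  | inr d => block_mx (oneill d z) 0 0 (fibre_chris d z)
  end.

Lemma fibration_conn_l a z : fibration_conn (lshift n a) z =
  block_mx (chris g a (lsubmx z) + \sum_c hor_mx g z a c *: oneill c z)
      (- 2^-1 *: curv_vec a z) (\matrix_(c, b) oneill c z a b)
      (chris g a (lsubmx z) + \sum_c hor_mx g z a c *: fibre_chris c z).
Proof. by rewrite /fibration_conn (unsplitK (inl a)). Qed.

Lemma fibration_conn_r d z : fibration_conn (rshift n d) z =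
  block_mx (oneill d z) 0 0 (fibre_chris d z).
Proof. by rewrite /fibration_conn (unsplitK (inr d)). Qed.

Lemma curv_vec_antisym a b z : row b (curv_vec a z) = - row a (curv_vec b z).
Proof. by rewrite /curv_vec !rowK riem_antisym mulmxN. Qed.

Lemma oneill_low_antisym d z : (oneill_low d z)^T = - oneill_low d z.
Proof.
apply/matrixP => a b; rewrite !mxE -sumrN; apply: eq_bigr => e _.
by have := curv_vec_antisym a b z => /rowP/(_ e); rewrite !mxE => ->; rewrite mulNr opprK.
Qed.

Lemma oneill_mul d z : V z -> oneill d z *m g (lsubmx z) = 2^-1 *: oneill_low d z.
Proof. by move=> Vz; rewrite /oneill -scalemxAl mulmxKV // (nf_gu nf (nf_VU nf Vz)). Qed.

Lemma oneill_metric d z : V z ->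
  oneill d z *m g (lsubmx z) + g (lsubmx z) *m (oneill d z)^T = 0.
Proof.
move=> Vz; have -> : g (lsubmx z) *m (oneill d z)^T = (oneill d z *m g (lsubmx z))^T.
  by rewrite trmx_mul (nf_gs nf (nf_VU nf Vz)).
by rewrite oneill_mul // linearZ /= oneill_low_antisym scalerN subrr.
Qed.

Lemma trace_oneill d z : V z -> \tr (oneill d z) = 0.
Proof.
move=> Vz; rewrite /oneill linearZ /=.
have Uz := nf_VU nf Vz.
suff /eqP : \tr (oneill_low d z *m invmx (g (lsubmx z))) = - \tr (oneill_low d z *m invmx (g (lsubmx z))).
  by rewrite -addr_eq0 -mulr2n mulrn_eq0 /= => /eqP ->; rewrite mulr0.
rewrite -{1}mxtrace_tr trmx_mul trmx_inv (nf_gs nf) // oneill_low_antisym mxtrace_mulC.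
by rewrite mulNmx linearN.
Qed.

Lemma fibre_open z : open [set v | V (row_mx (lsubmx z) v)].
Proof.
by apply: (open_comp (f := fun v => row_mx (lsubmx z) v)) => [v _|//]; exact: row_mx_continuous.
Qed.

Lemma fibre_in z : V z -> [set v | V (row_mx (lsubmx z) v)] (rsubmx z).
Proof. by rewrite /= hsubmxK. Qed.

Lemma fibre_chris_sym a b c z : V z -> fibre_chris a z b c = fibre_chris b z a c.
Proof.
move=> Vz; apply: (chris_sym (@fibre_open z)); first exact: fibre_in.
by move=> v /= Vv; rewrite (nf_Ws nf).
Qed.

Lemma fibre_metric d z : V z ->
  pd (rshift n d) W z = fibre_chris d z *m W z + W z *m (fibre_chris d z)^T.
Proof.
move=> Vz; rewrite pd_rslice.
have := @chris_metric R n _ (fun v => W (row_mx (lsubmx z) v)) d (rsubmx z) (@fibre_open z) (fibre_in Vz).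
rewrite hsubmxK; apply; last exact: (nf_Wu nf).
by move=> v /= Vv; rewrite (nf_Ws nf).
Qed.

Lemma pd_frame i z : pd i fibration_frame z = block_mx 0 (pd i (hor_mx g) z) 0 0.
Proof. by rewrite /fibration_frame pd_block !pd_cst. Qed.

(** Metricity: [oneill] is skew for [g], the mixed blocks are adjoint up to sign, and on vertical
    vectors [nf_parallel] accounts for the horizontal directions. Torsion: for two horizontal
    arguments the curvature of [hor_mx] is absorbed by two opposite halves of [curv_vec], and the
    other cases rest on the symmetry of Christoffel symbols. *)
Lemma fibration_lc_frame : lc_frame V h fibration_frame
  (fun z => block_mx (g (lsubmx z)) 0 0 (W z)) fibration_conn.
Proof.
have Pu z : fibration_frame z \in unitmx.
  by rewrite unitmxE /fibration_frame det_ublock !det1 mulr1 unitr1.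
have c0 p q k : Ck k V (fun=> 0 : 'M[R]_(p, q)) by exact: Ck_cst.
have c1 p k : Ck k V (fun=> 1%:M : 'M[R]_p) by exact: Ck_cst.
split.
- exact: oV.
- move=> z Vz; rewrite (nf_h nf) // !unitmx_mul unitmx_tr Pu andbT /=.
  rewrite unitmxE det_ublock unitrM -!unitmxE (nf_Wu nf) // (nf_gu nf) //.
  exact: nf_VU nf _ Vz.
- exact: Ck_block oV (c1 _ _) (Ck_hor_mx oU oV (nf_VU nf) (nf_gu nf) (nf_gC nf)) (c0 _ _ _) (c1 _ _).
- exact: Ck_block oV (Ck_lsub (nf_VU nf) (CkS (nf_gC nf))) (c0 _ _ _) (c0 _ _ _) (CkS (nf_WC nf)).
- by move=> z Vz; rewrite tr_block_mx !trmx0 (nf_Ws nf) // (nf_gs nf (nf_VU nf Vz)).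
- exact: nf_h nf.
- move=> z i Vz; have Uz := nf_VU nf Vz.
  rewrite pd_block !pd_cst; case: (split_ordP i) => a ->.
  + rewrite fibration_conn_l pd_lsub_l tr_block_mx !mulmx_block add_block_mx.
    rewrite !mulmx0 !mul0mx !addr0 !add0r.
    (* The two mixed blocks are adjoint up to sign with respect to [g] and [W]; both mixed
       components of metricity follow from this one identity. *)
    have AE : - 2^-1 *: curv_vec a z *m W z = - (g (lsubmx z) *m (\matrix_(c, b) oneill c z a b)^T).
      rewrite scaleNr mulNmx; congr (- _); apply/matrixP => b d.
      have /matrixP/(_ a b) E := oneill_mul d Vz.
      rewrite [RHS]mxE [(oneill_low _ _) _ _]mxE in E.
      rewrite -scalemxAl [LHS]mxE -E !mxE; apply: eq_bigr => c _.
      have -> : g (lsubmx z) b c = g (lsubmx z) c b by rewrite -[in LHS](nf_gs nf) // mxE.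
      by rewrite !mxE mulrC.
    congr block_mx.
    * rewrite (chris_metric a oU Uz (nf_gs nf) (nf_gu nf Uz)).
      rewrite linearD /= mulmxDl mulmxDr addrACA -[LHS]addr0; congr (_ + _).
      rewrite mulmx_suml linear_sum /= mulmx_sumr -big_split /= big1 // => c _.
      by rewrite [(_ *: _)^T]linearZ /= -scalemxAl -scalemxAr -scalerDr oneill_metric // scaler0.
    * by rewrite AE addNr.
    * have /(congr1 trmx) : - 2^-1 *: curv_vec a z *m W z
        + g (lsubmx z) *m (\matrix_(c, b) oneill c z a b)^T = 0 by rewrite AE addNr.
      rewrite trmx0 [(_ + _)^T]linearD /= 2!trmx_mul trmxK (nf_gs nf (nf_VU nf Vz)) (nf_Ws nf) //.
      by rewrite addrC.
    * rewrite (nf_parallel nf) // linearD /= mulmxDl mulmxDr addrACA; congr (_ + _).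
      rewrite mulmx_suml linear_sum /= mulmx_sumr -big_split /=; apply: eq_bigr => c _.
      by rewrite [(_ *: _)^T]linearZ /= -scalemxAl -scalemxAr -scalerDr fibre_metric.
  + rewrite fibration_conn_r pd_lsub_r tr_block_mx !mulmx_block add_block_mx !trmx0.
    rewrite !mulmx0 !mul0mx !addr0 !add0r oneill_metric // -fibre_metric //.
- move=> z i j Vz; have Uz := nf_VU nf Vz; rewrite !pd_frame.
  have gsym := chris_sym oU Uz (nf_gs nf).
  have fsym a b c := fibre_chris_sym a b c Vz.
  have Tl a : block_mx 0 (pd (lshift n a) (hor_mx g) z) 0 0 + fibration_frame z *m fibration_conn (lshift n a) z =
    block_mx (chris g a (lsubmx z) + \sum_c hor_mx g z a c *: oneill c z + hor_mx g z *m \matrix_(c, b) oneill c z a b)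
     (- 2^-1 *: curv_vec a z + (pd (lshift n a) (hor_mx g) z + hor_mx g z *m chris g a (lsubmx z)) +
        hor_mx g z *m \sum_c hor_mx g z a c *: fibre_chris c z)
     (\matrix_(c, b) oneill c z a b) (chris g a (lsubmx z) + \sum_c hor_mx g z a c *: fibre_chris c z).
    rewrite fibration_conn_l /fibration_frame mulmx_block add_block_mx !mul1mx !mul0mx !add0r mulmxDr.
    by congr block_mx; rewrite addrCA !addrA.
  have Tr d : block_mx 0 (pd (rshift n d) (hor_mx g) z) 0 0 + fibration_frame z *m fibration_conn (rshift n d) z =
    block_mx (oneill d z) (pd (rshift n d) (hor_mx g) z + hor_mx g z *m fibre_chris d z) 0 (fibre_chris d z).
    rewrite fibration_conn_r /fibration_frame mulmx_block add_block_mx !mul1mx !mul0mx !mulmx0 !add0r.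
    by rewrite !addr0.
  have Tlr a d : row (rshift n d) (block_mx 0 (pd (lshift n a) (hor_mx g) z) 0 0 + fibration_frame z *m fibration_conn (lshift n a) z)
    = row (lshift n a) (block_mx 0 (pd (rshift n d) (hor_mx g) z) 0 0 + fibration_frame z *m fibration_conn (rshift n d) z).
    rewrite Tl Tr /block_mx rowKd rowKu !row_row_mx; congr row_mx.
      by apply/rowP => b; rewrite !mxE.
    rewrite !linearD /= (pd_hor_mx_r oU oV (nf_VU nf) (nf_gu nf) (nf_gC nf)) //.
    congr (_ + _); apply/rowP => f.
    rewrite [LHS]mxE summxE [RHS]mxE mxE; apply: eq_bigr => c _.
    by rewrite [LHS]mxE fsym.
  case: (split_ordP i) => a ->; case: (split_ordP j) => b ->.
  + rewrite !Tl /block_mx !rowKu !row_row_mx; congr row_mx.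
      apply/rowP => c; rewrite !mxE gsym -!addrA; congr (_ + _).
      rewrite !summxE addrC; congr (_ + _); apply: eq_bigr => k _; by rewrite !mxE.
    have E := hor_mx_curvature oU oV (nf_VU nf) (nf_gu nf) (nf_gC nf) a b Vz.
    (* The terms quadratic in [hor_mx] agree by the symmetry of the fibre Christoffel symbols. *)
    rewrite !linearD /=; congr (_ + _); last first.
      have Q a' b' k f : row b' (hor_mx g z *m (hor_mx g z a' k *: fibre_chris k z)) 0 f =
          \sum_l hor_mx g z b' l * hor_mx g z a' k * fibre_chris k z l f.
        rewrite mxE -scalemxAr [LHS]mxE [(_ *m _) b' f]mxE mulr_sumr.
        by apply: eq_bigr => l _; rewrite mulrA [_ * hor_mx _ _ _ _]mulrC.
      rewrite 2!linear_sum /= 2!linear_sum; apply/rowP => f; rewrite !summxE.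
      under eq_bigr do rewrite Q.
      under [RHS]eq_bigr do rewrite Q.
      rewrite exchange_big /=; apply: eq_bigr => k _; apply: eq_bigr => l _.
      by rewrite fsym [_ * hor_mx _ _ _ _]mulrC.
    rewrite !row_mul; move/eqP : E; rewrite subr_eq => /eqP ->.
    rewrite !linearZ /= /curv_vec !rowK (riem_antisym g b a) mulmxN.
    move: (rsubmx z *m riem g a b (lsubmx z)) (row a _ + _) => r X.
    by apply/rowP => f; rewrite !mxE; field.
  + by rewrite Tlr.
  + by rewrite -Tlr.
  + rewrite !Tr /block_mx !rowKd !row_row_mx; congr row_mx.
      by apply/rowP => f; rewrite !mxE.
    by apply/rowP => f; rewrite !mxE fsym.
Qed.

(** The vanishing lower left block is the reason for working with vertical indices: the trace of
    this matrix is that of the fibre, [oneill] being traceless. *)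
Lemma chris_vertical d z : V z -> chris h (rshift n d) z =
  block_mx (oneill d z) (pd (rshift n d) (hor_mx g) z + hor_mx g z *m fibre_chris d z
     - oneill d z *m hor_mx g z) 0 (fibre_chris d z).
Proof.
move=> Vz; have fr := fibration_lc_frame.
apply: (can_inj (mulmxK (fr_th_unit fr Vz))).
rewrite (frame_christoffel fr) // pd_frame fibration_conn_r /fibration_frame !mulmx_block add_block_mx.
by rewrite !mul1mx !mulmx1 !mulmx0 !mul0mx !addr0 !add0r [oneill d z *m _ + _]addrC subrK.
Qed.

(** In [ricciE] the zero block of [chris_vertical] removes the horizontal part of the divergence and
    of the third term, and all traces reduce to the fibre. The horizontal block survives only in the
    trace of the product, which yields the O'Neill term. *)
Lemma ricci_vertical d e z : Ck 2 V h -> V z ->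
  ricci h (rshift n d) (rshift n e) z =
  ricci (fun v => W (row_mx (lsubmx z) v)) d e (rsubmx z) - \tr (oneill e z *m oneill d z).
Proof.
move=> hC Vz; have fr := fibration_lc_frame.
have hs y : V y -> (h y)^T = h y.
  by move=> Vy; rewrite (fr_h fr) // !trmx_mul trmxK (fr_et_sym fr) // mulmxA.
have Ws v : V (row_mx (lsubmx z) v) -> (W (row_mx (lsubmx z) v))^T = W (row_mx (lsubmx z) v).
  exact: (nf_Ws nf).
have Wu v : V (row_mx (lsubmx z) v) -> W (row_mx (lsubmx z) v) \in unitmx.
  exact: (nf_Wu nf).
have tr_chris c y : V y -> \tr (chris h (rshift n c) y) = \tr (fibre_chris c y).
  by move=> Vy; rewrite chris_vertical // mxtrace_block trace_oneill // add0r.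
rewrite (ricciE _ _ oV Vz hs (fr_unit fr) hC).
rewrite (ricciE _ _ (@fibre_open z) (fibre_in Vz) Ws Wu (Ck_rslice (lsubmx z) (nf_WC nf))).
have slice c v : fibre_chris c (row_mx (lsubmx z) v) = chris (fun v => W (row_mx (lsubmx z) v)) c v.
  by rewrite /fibre_chris row_mxKl row_mxKr.
rewrite -addrA -[RHS]addrA -[in RHS]addrA; congr (_ + _); [congr (_ - _)|congr (_ + _)].
- rewrite big_split_ord /= big1 ?add0r; last first.
    move=> a _; transitivity (partial (fun=> 0 : R) (lshift n a) z); last exact: derive_cst.
    by apply: (derive_open _ oV _ Vz) => y Vy; rewrite chris_vertical // block_mxEdl mxE.
  apply: eq_bigr => f _; rewrite partial_rslice.
  apply: (derive_open _ (@fibre_open z) _ (fibre_in Vz)) => v /= Vv.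
  by rewrite chris_vertical // block_mxEdr slice.
- rewrite partial_rslice.
  apply: (derive_open _ (@fibre_open z) _ (fibre_in Vz)) => v /= Vv.
  by rewrite tr_chris // slice.
- rewrite big_split_ord /= big1 ?add0r; last first.
    by move=> a _; rewrite chris_vertical // block_mxEdl mxE mul0r.
  by apply: eq_bigr => f _; rewrite chris_vertical // block_mxEdr tr_chris.
- rewrite -opprD !chris_vertical // mulmx_block mxtrace_block !mulmx0 !mul0mx !addr0 add0r.
  by rewrite addrC.
Qed.

End Fibration.

Lemma Ck_trace (R : realType) (m p : nat) (U : set 'rV[R]_m) k (A : 'rV[R]_m -> 'M[R]_p) :
  open U -> Ck k U A -> Ck k U (fun x => \tr (A x)).
Proof.
move=> oU cA.
exact: (@Ck_sum _ _ U k _ _ xpredT (fun i x => A x i i) oU (fun i _ => Ck_entry i i oU cA)).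
Qed.

Lemma Ck_sum_ord (R : realType) (V : normedModType R) (U : set V) k p (F : 'I_p -> V -> R) :
  open U -> (forall i, Ck k U (F i)) -> Ck k U (fun x => \sum_i F i x).
Proof. by move=> oU FC; apply: Ck_sum oU _ => i _; exact: FC. Qed.

Lemma sum_delta (R : realType) p (k : 'I_p) (F : 'I_p -> R) :
  \sum_i (k == i)%:R * F i = F k.
Proof.
rewrite (bigD1 k) //= eqxx mul1r big1 ?addr0 // => i ik.
by rewrite eq_sym (negbTE ik) mul0r.
Qed.

Section PartialRules.
Context (R : realType) (m : nat) (U : set 'rV[R]_m) (x : 'rV[R]_m) (a : 'I_m).
Hypotheses (oU : open U) (Ux : U x).

Lemma partialM (f g : 'rV[R]_m -> R) : Ck 1 U f -> Ck 1 U g ->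
  partial (fun y => f y * g y) a x = partial f a x * g x + f x * partial g a x.
Proof.
move=> fC gC; rewrite /partial.
rewrite [LHS](deriveM (Ck_derivable fC Ux) (Ck_derivable gC Ux)) addrC.
by congr (_ + _); rewrite -[LHS]mulrC.
Qed.

Lemma partial_sum p (F : 'I_p -> 'rV[R]_m -> R) : (forall i, Ck 1 U (F i)) ->
  partial (fun y => \sum_i F i y) a x = \sum_i partial (F i) a x.
Proof.
move=> FC; have -> : (fun y => \sum_i F i y) = \sum_i F i by apply/funext => y; rewrite fct_sumE.
by rewrite /partial derive_sum // => i; exact: Ck_derivable (FC i) Ux.
Qed.

End PartialRules.

(** * The fibre metric *)

HB.lock Definition flat_co (R : realType) (n : nat) (g : 'M[R]_n) (v : 'rV[R]_n) : 'rV[R]_n := v *m g.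

HB.lock Definition sqn (R : realType) (n : nat) (g : 'M[R]_n) (v : 'rV[R]_n) : R :=
  (v *m g *m v^T) 0 0.

HB.lock Definition radial_metric (R : realType) (n : nat) (alpha beta : R -> R)
    (g : 'M[R]_n) (v : 'rV[R]_n) : 'M[R]_n :=
  alpha (sqn g v) *: g + beta (sqn g v) *: ((flat_co g v)^T *m flat_co g v).

Section Radial.
Context (R : realType) (n : nat) (g : 'M[R]_n).
Implicit Types (v : 'rV[R]_n) (a b c d e p : 'I_n).
Variables (alpha beta : R -> R).
Local Notation Ipos := [set t : R | 0 < t].
Hypotheses (gs : g^T = g) (aC : Ck 2 Ipos alpha) (bC : Ck 2 Ipos beta).
Hypotheses (a_gt0 : forall t, Ipos t -> 0 < alpha t)
  (phi_gt0 : forall t, Ipos t -> 0 < alpha t + t * beta t).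
Hypothesis (gu : g \in unitmx).

Let phi t := alpha t + t * beta t.
Let D := [set v : 'rV[R]_n | 0 < sqn g v].
Let vl := flat_co g.
Let r := sqn g.
Let W := radial_metric alpha beta g.

Lemma flat_coE v d : vl v 0 d = \sum_e v 0 e * g e d.
Proof. by rewrite /vl flat_co.unlock mxE. Qed.

Lemma sqn_flat v : (v *m (vl v)^T) = (r v)%:M.
Proof.
rewrite /vl /r flat_co.unlock sqn.unlock trmx_mul gs mulmxA; exact: mx11_scalar.
Qed.

Lemma flat_sqn v : (vl v *m v^T) = (r v)%:M.
Proof.
rewrite /vl /r flat_co.unlock sqn.unlock; exact: mx11_scalar.
Qed.

Lemma sum_flat v : \sum_d v 0 d * vl v 0 d = r v.
Proof.
have := congr1 (fun A : 'M[R]_1 => A 0 0) (sqn_flat v); rewrite [X in _ = X]mxE eqxx mulr1n => <-.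
by rewrite mxE; apply: eq_bigr => d _; rewrite [in RHS]mxE.
Qed.

Lemma sum_g v p : \sum_d v 0 d * g d p = vl v 0 p.
Proof. by rewrite flat_coE. Qed.

Lemma pd_id d v : pd d (fun y : 'rV[R]_n => y) v = delta_mx 0 d.
Proof. by apply/rowP => j; rewrite pdE partial_coord !mxE eqxx eq_sym. Qed.

Lemma Ck_flat U k : open U -> Ck k U vl.
Proof.
move=> oU; rewrite /vl flat_co.unlock.
exact: Ck_mulmx oU (Ck_id _ oU) (Ck_cst _ _ _).
Qed.

Lemma Ck_sqn U k : open U -> Ck k U r.
Proof.
move=> oU; rewrite /r sqn.unlock; apply: (Ck_entry 0 0 oU).
exact: Ck_mulmx oU (Ck_mulmx oU (Ck_id _ oU) (Ck_cst _ _ _)) (Ck_trmx oU (Ck_id _ oU)).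
Qed.

Lemma pd_flat d v : pd d vl v = row d g.
Proof.
have i1 := Ck_id (R := R) (m := n) 1 openT.
have g1 : Ck 1 [set: 'rV[R]_n] (fun=> g) := Ck_cst _ _ _.
rewrite /vl flat_co.unlock (pdM d openT Logic.I i1 g1).
by rewrite pd_cst mulmx0 addr0 pd_id rowE.
Qed.

Lemma partial_sqn d v : partial r d v = 2 * vl v 0 d.
Proof.
transitivity (pd d (fun y => vl y *m y^T) v 0 0).
  rewrite pdE; apply: eq_partial => y; rewrite flat_sqn mxE eqxx mulr1n //.
have i1 := Ck_id (R := R) (m := n) 1 openT.
rewrite (pdM d openT Logic.I (Ck_flat 1 openT) (Ck_trmx openT i1)) pd_flat pd_trmx pd_id.
rewrite mxE.
have -> : (row d g *m v^T) 0 0 = vl v 0 d.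
  rewrite mxE flat_coE; apply: eq_bigr => e _; rewrite !mxE mulrC.
  by rewrite -[in LHS]gs mxE.
have -> : (vl v *m (delta_mx 0 d : 'rV[R]_n)^T) 0 0 = vl v 0 d.
  by rewrite trmx_delta -colE mxE.
ring.
Qed.

Lemma open_D : open D.
Proof.
have [c _] := Ck_sqn 0 openT.
apply: (@open_comp _ R r [set t | 0 < t]); last exact: (@open_pos R).
by move=> v _; exact: c.
Qed.

Lemma partial_radial (f : R -> R) d v : Ck 1 Ipos f -> D v ->
  partial (fun y => f (r y)) d v = 'D_1 f (r v) * (2 * vl v 0 d).
Proof.
move=> fC Dv; rewrite -partial_sqn.
have [] // := derive_comp1 (phi := f) (f := r) (x := v) (v := delta_mx 0 d).
  exact: Ck_derivable fC Dv.
by apply: (Ck_derivable (Ck_sqn 1 openT)).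
Qed.

Lemma Ck_radial_comp (f : R -> R) k : Ck k Ipos f -> Ck k D (fun v => f (r v)).
Proof. by move=> fC; apply: Ck_comp1 open_D _ fC (Ck_sqn _ open_D). Qed.

Lemma Ck_radial : Ck 2 D W.
Proof.
rewrite /W radial_metric.unlock.
apply: (CkD open_D); apply: (Ck_scalemx open_D).
- exact: Ck_radial_comp.
- exact: Ck_cst.
- exact: Ck_radial_comp.
- exact: (Ck_mulmx open_D (Ck_trmx open_D (Ck_flat 2 open_D)) (Ck_flat 2 open_D)).
Qed.

Lemma pd_radial d p e v : D v -> pd d W v p e =
  vl v 0 d * (2 * 'D_1 alpha (r v) * g p e + 2 * 'D_1 beta (r v) * (vl v 0 p * vl v 0 e))
  + beta (r v) * (g d p * vl v 0 e + vl v 0 p * g d e).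
Proof.
move=> Dv; have oD := open_D; rewrite /W radial_metric.unlock.
have aR := Ck_radial_comp (CkS aC); have bR := Ck_radial_comp (CkS bC).
have gR : Ck 1 D (fun=> g) := Ck_cst _ _ _.
have vC := Ck_flat 1 oD; have vvC := Ck_mulmx oD (Ck_trmx oD vC) vC.
rewrite (pdD d oD Dv (Ck_scalemx oD aR gR) (Ck_scalemx oD bR vvC)).
rewrite (pdZ d oD Dv aR gR) (pdZ d oD Dv bR vvC) pd_cst scaler0 addr0.
rewrite (pdM d oD Dv (Ck_trmx oD vC) vC) pd_trmx pd_flat.
rewrite (partial_radial _ (CkS aC)) // (partial_radial _ (CkS bC)) //.
have E1 (x y : 'rV[R]_n) : (x^T *m y) p e = x 0 p * y 0 e.
  by rewrite mxE big_ord1 mxE.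
rewrite mxE [X in X + _]mxE [X in _ + X]mxE [X in _ + (X + _)]mxE [X in _ + (_ + X)]mxE.
rewrite [X in _ + (_ + _ * X)]mxE !E1 -/(vl v) -/(r v) ![row d g 0 _]mxE; ring.
Qed.

Lemma radial_sym v : (W v)^T = W v.
Proof.
by rewrite /W radial_metric.unlock [LHS]linearD /= !linearZ /= gs trmx_mul trmxK.
Qed.

(** The radial direction is an eigenvector of [W] relative to [g], with eigenvalue phi = alpha + t
    beta; this is how [phi] enters every formula below. *)
Lemma radial_mul v : v *m W v = phi (r v) *: vl v.
Proof.
rewrite /W radial_metric.unlock mulmxDr -!scalemxAr -/(r v) mulmxA -/(vl v) sqn_flat.
rewrite mul_scalar_mx scalerA /phi scalerDl [r v * _]mulrC; congr (_ *: _ + _).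
by rewrite /vl flat_co.unlock.
Qed.

Lemma radial_unit v : D v -> W v \in unitmx.
Proof.
(* The Sherman-Morrison inverse of a perturbation of rank one. *)
move=> Dv; pose X := (alpha (r v))^-1 *: invmx g - (beta (r v) / (alpha (r v) * phi (r v))) *: (v^T *m v).
suff /mulmx1_unit[] : W v *m X = 1%:M by [].
have a0 : alpha (r v) != 0 by rewrite gt_eqF // a_gt0.
have p0 : phi (r v) != 0 by rewrite gt_eqF // phi_gt0.
have E1 : W v *m v^T = phi (r v) *: (vl v)^T.
  by have := congr1 trmx (radial_mul v); rewrite trmx_mul radial_sym linearZ.
rewrite /X mulmxBr -!scalemxAr mulmxA E1 -scalemxAl scalerA.
rewrite {1}/W radial_metric.unlock mulmxDl -!scalemxAl mulmxV // -/(r v) -/(vl v).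
have -> : (vl v)^T *m vl v *m invmx g = (vl v)^T *m v.
  by rewrite -mulmxA; congr (_ *m _); rewrite /vl flat_co.unlock mulmxK.
rewrite scalerDr !scalerA mulVf // scale1r -addrA -scalerBl.
rewrite (_ : _ - _ = 0) ?scale0r ?addr0 //.
by rewrite mulrC; field; rewrite a0 p0.
Qed.

Definition log_der (f : R -> R) (t : R) : R := 'D_1 f t / f t.

(** For the Euler field V = v^d d/dv^d one has nabla_Y V = Y + Y *m [radial_endo v]. *)
Definition radial_endo v : 'M[R]_n := \sum_d v 0 d *: chris W d v.

Lemma phiC : Ck 2 Ipos phi.
Proof.
apply: (CkD (@open_pos R) aC (CkM (@open_pos R) _ bC)).
by apply: Ck_lin => //; move=> x; exact: cvg_id.
Qed.

Lemma D1phi t : Ipos t -> 'D_1 phi t = 'D_1 alpha t + beta t + t * 'D_1 beta t.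
Proof.
move=> It; rewrite /phi.
have da : derivable alpha t 1 by exact: Ck_derivable aC It.
have db : derivable beta t 1 by exact: Ck_derivable bC It.
have did : derivable (@id R) t 1 by exact: derivable_id.
transitivity ('D_1 (alpha + id * beta) t); first by [].
rewrite (deriveD da (derivableM did db)) (deriveM did db) derive_id -addrA.
by congr (_ + _); rewrite addrC [_ *: 1]mulr1.
Qed.

(** Both sides are compared after multiplication by [W], which leaves symbols of the first kind
    contracted with v. The eigenvalues are t phi'/phi on v and t alpha'/alpha on its orthogonal
    complement, where t = |v|^2. *)
Lemma radial_endoE v : D v -> radial_endo v =
  (log_der alpha (r v) * r v)%:M + (log_der phi (r v) - log_der alpha (r v)) *: ((vl v)^T *m v).
Proof.
move=> Dv; apply: (can_inj (mulmxK (radial_unit Dv))).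
have a0 : alpha (r v) != 0 by rewrite gt_eqF // a_gt0.
have p0 : phi (r v) != 0 by rewrite gt_eqF // phi_gt0.
have -> : radial_endo v *m W v =
    (r v * 'D_1 alpha (r v)) *: g + (r v * 'D_1 beta (r v) + beta (r v)) *: ((vl v)^T *m vl v).
  apply/matrixP => p e; rewrite /radial_endo mulmx_suml summxE.
  rewrite [RHS]mxE [X in X + _]mxE [X in _ + X]mxE [((vl v)^T *m vl v) p e]mxE big_ord1 [(vl v)^T p 0]mxE.
  pose A := 'D_1 alpha (r v) * g p e + 'D_1 beta (r v) * (vl v 0 p * vl v 0 e).
  pose B := (beta (r v) - 'D_1 alpha (r v)) * vl v 0 e.
  pose C := 'D_1 alpha (r v) * vl v 0 p.
  transitivity (\sum_d (A * (v 0 d * vl v 0 d) + B * (v 0 d * g d p) + C * (v 0 d * g d e))).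
    apply: eq_bigr => d _; rewrite -scalemxAl mxE chris_mul ?radial_sym ?radial_unit //.
    rewrite !pd_radial // /A /B /C.
    have -> : g p d = g d p by rewrite -[in LHS]gs mxE.
    have -> : g e d = g d e by rewrite -[in LHS]gs mxE.
    have -> : g e p = g p e by rewrite -[in LHS]gs mxE.
    by field.
  rewrite !big_split /= -!mulr_sumr sum_flat !sum_g /A /B /C; ring.
rewrite mulmxDl mul_scalar_mx -scalemxAl -mulmxA radial_mul -scalemxAr scalerA.
rewrite {1}/W radial_metric.unlock scalerDr !scalerA -addrA -scalerDl -/(r v) -/(vl v).
rewrite /log_der; congr (_ *: _ + _ *: _); first by field.
rewrite D1phi // /phi; move: p0; rewrite /phi => p0; field.
by rewrite p0 a0.
Qed.

Lemma radial_traceE v : D v -> \tr (radial_endo v) =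
  r v * ((n%:R - 1) * log_der alpha (r v) + log_der phi (r v)).
Proof.
move=> Dv; rewrite radial_endoE // linearD /= mxtrace_scalar linearZ /= mxtrace_mulC.
by rewrite sqn_flat mxtrace_scalar mulr1n -mulr_natl; ring.
Qed.

Lemma Ck_log_der (f : R -> R) : (forall t, Ipos t -> 0 < f t) -> Ck 2 Ipos f -> Ck 1 Ipos (log_der f).
Proof.
move=> f0 fC; have nz t : Ipos t -> f t != 0 by move=> It; rewrite gt_eqF // f0.
have dC := Ck_derive (1 : R) fC; exact: CkM (@open_pos R) dC (Ck_inv (@open_pos R) nz (CkS fC)).
Qed.

Lemma D1_mul_id (f : R -> R) (t : R) : derivable f t 1 ->
  'D_1 (fun t : R => t * f t) t = f t + t * 'D_1 f t.
Proof.
move=> df; have did : derivable (@id R) t 1 by exact: derivable_id.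
transitivity ('D_1 (id * f) t); first by [].
by rewrite (deriveM did df) derive_id addrC [_ *: 1]mulr1.
Qed.

(** The Ricci tensor is evaluated on the Euler field V in the manner of Bochner's formula: what is
    needed is the divergence of nabla_V V, the radial derivative of div V and the trace of a square,
    and [radial_endoE] makes all three functions of |v|^2. *)
Lemma radial_ricci v : D v -> let t : R := r v in
  let a : R -> R := log_der alpha in let s : R -> R := log_der phi in
  \sum_b \sum_c v 0 b * (v 0 c * ricci W b c v) =
  (n%:R - 1) * t * (s t - 3 * a t - 2 * t * 'D_1 a t + t * a t * s t - t * a t ^+ 2).
Proof.
move=> Dv t a s; have oD := open_D.
have Wu y : D y -> W y \in unitmx by exact: radial_unit.
have Ws y : D y -> (W y)^T = W y by move=> _; exact: radial_sym.
have cC b : Ck 1 D (chris W b) := Ck_chris b oD Wu Ck_radial.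
have ceC b c k : Ck 1 D (fun y => chris W b y c k) := Ck_entry c k oD (cC b).
have xC b : Ck 1 D (fun y => y 0 b) := Ck_coord D 1 b.
pose tr_ c y := \tr (chris W c y).
have trC c : Ck 1 D (tr_ c) := Ck_trace oD (cC c).
(* In terms of the Euler field V, [T] is div V - n and [Y] below is nabla_V V - V. *)
pose T (y : 'rV[R]_n) := \sum_c y 0 c * tr_ c y.
have TE y : T y = \tr (radial_endo y).
  by rewrite /T /radial_endo linear_sum /=; apply: eq_bigr => c _; rewrite linearZ.
pose Y k (y : 'rV[R]_n) := \sum_b \sum_c y 0 b * (y 0 c * chris W b y c k).
have YE k y : Y k y = (y *m radial_endo y) 0 k.
  rewrite /Y exchange_big mxE; apply: eq_bigr => c _ /=.
  rewrite /radial_endo summxE mulr_sumr; apply: eq_bigr => b _.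
  by rewrite mxE mulrCA.
have divY : \sum_k partial (Y k) k v =
    2 * T v + \sum_b \sum_c v 0 b * (v 0 c * \sum_k partial (fun y => chris W b y c k) k v).
  have E k : partial (Y k) k v = \sum_c v 0 c * chris W k v c k + \sum_b v 0 b * chris W b v k k
      + \sum_b \sum_c v 0 b * (v 0 c * partial (fun y => chris W b y c k) k v).
    have gC b c : Ck 1 D (fun y => y 0 c * chris W b y c k) := CkM oD (xC c) (ceC b c k).
    have ggC b c : Ck 1 D (fun y => y 0 b * (y 0 c * chris W b y c k)) := CkM oD (xC b) (gC b c).
    rewrite /Y (partial_sum k Dv) => [|b]; last exact: Ck_sum_ord oD (ggC b).
    have E1 b : partial (fun y => \sum_c y 0 b * (y 0 c * chris W b y c k)) k v =
       (k == b)%:R * \sum_c v 0 c * chris W b v c k + v 0 b * chris W b v k k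
       + \sum_c v 0 b * (v 0 c * partial (fun y => chris W b y c k) k v).
      rewrite (partial_sum k Dv) => [|c]; last exact: ggC.
      under eq_bigr => c _.
        rewrite (partialM k Dv (xC b) (gC b c)) (partialM k Dv (xC c) (ceC b c k)) !partial_coord.
        rewrite mulrDr addrA.
        over.
      rewrite 2!big_split /= mulr_sumr; congr (_ + _ + _).
      rewrite -(sum_delta k (fun c => v 0 b * chris W b v c k)).
      by apply: eq_bigr => c _; rewrite mulrCA.
    under eq_bigr do rewrite E1.
    rewrite 2!big_split /=; congr (_ + _ + _).
    by rewrite (sum_delta k (fun b => \sum_c v 0 c * chris W b v c k)).
  under eq_bigr do rewrite E.
  rewrite 2!big_split /= mulr2n mulrDl mul1r; congr (_ + _ + _).
  - rewrite exchange_big /=; apply: eq_bigr => c _.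
    rewrite /tr_ /mxtrace mulr_sumr; apply: eq_bigr => k _.
    by rewrite (chris_sym oD Dv Ws k).
  - rewrite exchange_big /=; apply: eq_bigr => c _.
    by rewrite /tr_ /mxtrace mulr_sumr.
  - rewrite exchange_big /=; apply: eq_bigr => b _.
    rewrite exchange_big /=; apply: eq_bigr => c _.
    by rewrite !mulr_sumr.
have radT : \sum_b v 0 b * partial T b v =
    T v + \sum_b \sum_c v 0 b * (v 0 c * partial (tr_ c) b v).
  rewrite -big_split /=; apply: eq_bigr => b _.
  rewrite /T (partial_sum b Dv) => [|c]; last exact: CkM oD (xC c) (trC c).
  have E5 c : partial (fun y => y 0 c * tr_ c y) b v =
      (b == c)%:R * tr_ c v + v 0 c * partial (tr_ c) b v.
    have := partialM b Dv (xC c) (trC c); rewrite partial_coord; exact.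
  rewrite (eq_bigr _ (fun c _ => E5 c)).
  by rewrite big_split /= mulrDr (sum_delta b (fun c => tr_ c v)) [X in _ + X]mulr_sumr.
have E3 : \sum_b \sum_c v 0 b * (v 0 c * \sum_l chris W b v c l * tr_ l v) =
    \sum_l Y l v * tr_ l v.
  rewrite /Y.
  under [RHS]eq_bigr do rewrite mulr_suml.
  rewrite [RHS]exchange_big /=; apply: eq_bigr => b _.
  under [RHS]eq_bigr do rewrite mulr_suml.
  rewrite [RHS]exchange_big /=; apply: eq_bigr => c _.
  by rewrite !mulr_sumr; apply: eq_bigr => l _; rewrite !mulrA.
have E4 : \sum_b \sum_c v 0 b * (v 0 c * \tr (chris W c v *m chris W b v)) =
    \tr (radial_endo v *m radial_endo v).
  rewrite {2}/radial_endo mulmx_sumr linear_sum /=; apply: eq_bigr => b _.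
  rewrite -scalemxAr linearZ /= /radial_endo mulmx_suml linear_sum /= mulr_sumr.
  by apply: eq_bigr => c _; rewrite -scalemxAl linearZ.
(* The corrections [2 * T v] and [T v] remove the derivatives that fall on the coefficients v^b and
   v^c, which are not differentiated in [ricciE]. *)
have -> : \sum_b \sum_c v 0 b * (v 0 c * ricci W b c v) =
    (\sum_k partial (Y k) k v - 2 * T v) - (\sum_b v 0 b * partial T b v - T v)
    + \sum_l Y l v * tr_ l v - \tr (radial_endo v *m radial_endo v).
  rewrite divY radT -E3 -E4 [2 * T v + _]addrC [T v + _]addrC !addrK.
  rewrite -!sumrB -big_split -sumrB /=; apply: eq_bigr => b _.
  rewrite -!sumrB -big_split -sumrB /=; apply: eq_bigr => c _.
  by rewrite (ricciE b c oD Dv Ws Wu Ck_radial); ring.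
have aC1 : Ck 1 Ipos a := Ck_log_der a_gt0 aC.
have sC1 : Ck 1 Ipos s := Ck_log_der phi_gt0 phiC.
have da : derivable a t 1 by exact: Ck_derivable aC1 Dv.
have ds : derivable s t 1 by exact: Ck_derivable sC1 Dv.
pose rho (u : R) : R := u * s u.
pose tau (u : R) : R := u * ((n%:R - 1) * a u + s u).
have idC : Ck 1 Ipos (fun u : R => u) by apply: Ck_lin => // u; exact: cvg_id.
have rhoC : Ck 1 Ipos rho := CkM (@open_pos R) idC sC1.
have tC : Ck 1 Ipos (fun u => (n%:R - 1) * a u + s u).
  exact: CkD (@open_pos R) (CkM (@open_pos R) (Ck_cst _ _ _) aC1) sC1.
have tauC : Ck 1 Ipos tau := CkM (@open_pos R) idC tC.
have D1rho : 'D_1 rho t = s t + t * 'D_1 s t by exact: D1_mul_id.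
have D1tau : 'D_1 tau t = (n%:R - 1) * a t + s t + t * ((n%:R - 1) * 'D_1 a t + 'D_1 s t).
  rewrite D1_mul_id; last exact: Ck_derivable tC Dv.
  congr (_ + _ * _); transitivity ('D_1 ((n%:R - 1) *: a + s) t); first by [].
  have dZ : derivable ((n%:R - 1) *: a) t 1 by exact: derivableZ.
  by rewrite (deriveD dZ ds) deriveZ.
have YE' k y : D y -> Y k y = rho (r y) * y 0 k.
  move=> Dy; rewrite YE radial_endoE // mulmxDr -scalemxAr mulmxA sqn_flat.
  rewrite mul_mx_scalar mul_scalar_mx scalerA -scalerDl mxE /rho /s /a; ring.
have TE' y : D y -> T y = tau (r y) by move=> Dy; rewrite TE radial_traceE.
have dY k : partial (Y k) k v = 'D_1 rho t * (2 * vl v 0 k) * v 0 k + rho t.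
  rewrite /partial (derive_open (g := fun y => rho (r y) * y 0 k) _ oD _ Dv); last exact: YE'.
  rewrite -/(partial _ k v) (partialM k Dv (Ck_radial_comp rhoC) (xC k)) (partial_radial k rhoC Dv).
  by rewrite partial_coord eqxx mulr1.
have dT b : partial T b v = 'D_1 tau t * (2 * vl v 0 b).
  rewrite /partial (derive_open (g := fun y => tau (r y)) _ oD _ Dv); last exact: TE'.
  exact: partial_radial.
have radial_sum (c : R) : \sum_k c * (2 * vl v 0 k) * v 0 k = 2 * t * c.
  rewrite /t -(sum_flat v) mulr_sumr mulr_suml; apply: eq_bigr => k _; ring.
have -> : \sum_k partial (Y k) k v = 2 * t * 'D_1 rho t + n%:R * rho t.
  under eq_bigr do rewrite dY.
  by rewrite big_split /= sumr_const card_ord -[rho t *+ n]mulr_natl radial_sum.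
have -> : \sum_b v 0 b * partial T b v = 2 * t * 'D_1 tau t.
  under eq_bigr do rewrite dT mulrC.
  exact: radial_sum.
have -> : \sum_l Y l v * tr_ l v = rho t * tau t.
  under eq_bigr do rewrite YE' // -mulrA.
  by rewrite -mulr_sumr -TE'.
have -> : \tr (radial_endo v *m radial_endo v) = t ^+ 2 * ((n%:R - 1) * a t ^+ 2 + s t ^+ 2).
  rewrite radial_endoE // -/a -/s -/t.
  rewrite mulmxDl mul_scalar_mx -scalemxAl mulmxDr mul_mx_scalar -scalemxAr.
  rewrite mulmxA -(mulmxA (vl v)^T v) sqn_flat mul_mx_scalar -scalemxAl -/t.
  have trK : \tr ((vl v)^T *m v) = t by rewrite mxtrace_mulC sqn_flat mxtrace_scalar mulr1n.
  by rewrite !(mxtraceD, mxtraceZ) trK mxtrace_scalar -[_ *+ n]mulr_natl; ring.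
(* The derivatives of [s] cancel, and every remaining term carries the factor n - 1. *)
rewrite TE' // -/t D1rho D1tau /rho /tau; ring.
Qed.

End Radial.

(** * The rescaling map and the flatness of the fibres *)

HB.lock Definition rescale (R : realType) (n : nat) (alpha : R -> R) (g : 'M[R]_n)
    (v : 'rV[R]_n) : 'rV[R]_n := Num.sqrt (alpha (sqn g v)) *: v.

Section Rescale.
Context (R : realType) (n : nat) (g : 'M[R]_n).
Implicit Types (v : 'rV[R]_n) (a b c d e p : 'I_n).
Variables (alpha beta : R -> R).
Local Notation Ipos := [set t : R | 0 < t].
Hypotheses (gs : g^T = g) (gu : g \in unitmx) (aC : Ck 3 Ipos alpha).
Hypotheses (a_gt0 : forall t, Ipos t -> 0 < alpha t)
  (bE : forall t, Ipos t -> beta t = 2 * 'D_1 alpha t + t * 'D_1 alpha t ^+ 2 / alpha t).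

Let D := [set v : 'rV[R]_n | 0 < sqn g v].
Let mu t := Num.sqrt (alpha t).

Lemma Ck_mu : Ck 3 Ipos mu.
Proof. exact: Ck_comp1 (@open_pos R) a_gt0 (Ck_sqrt R 3) aC. Qed.

Lemma mu_gt0 t : Ipos t -> 0 < mu t.
Proof. by move=> It; rewrite /mu sqrtr_gt0 a_gt0. Qed.

Lemma sqr_mu t : Ipos t -> mu t ^+ 2 = alpha t.
Proof. by move=> It; rewrite /mu sqr_sqrtr // ltW // a_gt0. Qed.

Lemma D1_mu t : Ipos t -> 'D_1 mu t = 'D_1 alpha t / (2 * mu t).
Proof.
move=> It; have da : derivable alpha t 1 by exact: Ck_derivable aC It.
have a0 := a_gt0 It.
have ds : derivable Num.sqrt (alpha t) (1 : R) by have [] := is_derive1_sqrt a0.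
have [_ ->] := derive_comp1 ds da.
by rewrite derive_sqrt // mulrC.
Qed.

Lemma Ck_rescale : Ck 3 D (rescale alpha g).
Proof.
have oD := @open_D R n g; rewrite rescale.unlock.
exact: Ck_scalemx oD (Ck_radial_comp g Ck_mu) (Ck_id 3 oD).
Qed.

Definition rescale_jac v : 'M[R]_n := \matrix_d pd d (rescale alpha g) v.

Lemma rescale_jacE v : D v -> rescale_jac v =
  (mu (sqn g v))%:M + ('D_1 alpha (sqn g v) / mu (sqn g v)) *: ((flat_co g v)^T *m v).
Proof.
move=> Dv; have oD := @open_D R n g; apply/row_matrixP => d; rewrite rowK.
have m1 : Ck 1 D (fun v => mu (sqn g v)) := Ck_radial_comp g (Ck_le (isT : (1 <= 3)%N) Ck_mu).
rewrite rescale.unlock (pdZ d oD Dv m1 (Ck_id 1 oD)) pd_id.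
rewrite (partial_radial gs d (Ck_le (isT : (1 <= 3)%N) Ck_mu) Dv) (D1_mu Dv).
have m0 := mu_gt0 Dv.
rewrite linearD linearZ /= addrC; congr (_ + _).
  by rewrite -scalemx1 linearZ /= row1.
apply/rowP => j; rewrite !mxE big_ord1 !mxE; field.
by rewrite gt_eqF.
Qed.

(** By [rescale_jacE] the coefficient of v^* v^* in the pull-back is 2 alpha' + |v|^2 alpha'^2 /
    alpha, which is [bE]. *)
Lemma rescale_isometry v : D v ->
  rescale_jac v *m g *m (rescale_jac v)^T = radial_metric alpha beta g v.
Proof.
move=> Dv; rewrite rescale_jacE // radial_metric.unlock bE //.
have m0 := mu_gt0 Dv; rewrite -sqr_mu //.
move: (mu _) ('D_1 alpha _) m0 => m b m0.
set vl := flat_co g v; set r := sqn g v.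
have vg : v *m g = vl by rewrite /vl flat_co.unlock.
rewrite linearD linearZ /= tr_scalar_mx trmx_mul trmxK.
rewrite !mulmxDl !mulmxDr !mul_scalar_mx -!scalemxAl -!scalemxAr !mul_mx_scalar.
rewrite -!mulmxA vg.
have gv : g *m v^T = vl^T by rewrite -vg trmx_mul gs.
have K : v *m (g *m (v^T *m vl)) = r *: vl by rewrite mulmxA vg mulmxA flat_sqn mul_scalar_mx.
have L : g *m (v^T *m vl) = vl^T *m vl by rewrite mulmxA gv.
rewrite K L -scalemxAr !scalerA -!addrA -!scalerDl.
congr (_ *: _ + _ *: _); field; exact: lt0r_neq0.
Qed.

(** The Jacobian is a coframe in which the metric is the constant [g] and the connection is zero;
    vanishing torsion is the symmetry of the second derivatives of the map. *)
Lemma fibre_flat v a b : D v -> radial_metric alpha beta g v \in unitmx ->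
  (forall v, D v -> radial_metric alpha beta g v \in unitmx) ->
  Ck 2 D (radial_metric alpha beta g) ->
  riem (radial_metric alpha beta g) a b v = 0.
Proof.
move=> Dv Wu0 Wu WC; have oD := @open_D R n g.
have jC : Ck 2 D rescale_jac.
  apply: (Ck_entries oD) => i j.
  apply: (Ck_eq oD _ (Ck_entry 0 j oD (Ck_pd i oD Ck_rescale))).
  by move=> y _; rewrite [RHS]mxE.
have rj i j y : row j (pd i rescale_jac y) = pd i (pd j (rescale alpha g)) y.
  apply/rowP => k; rewrite [LHS]mxE 2!pdE; apply: eq_partial => u.
  by rewrite [LHS]mxE.
have fr : lc_frame D (radial_metric alpha beta g) rescale_jac (fun=> g) (fun _ _ => 0).
  split.
  - exact: oD.
  - exact: Wu.
  - exact: CkS.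
  - exact: Ck_cst.
  - by [].
  - by move=> y Dy; rewrite rescale_isometry.
  - by move=> y i Dy; rewrite pd_cst mul0mx trmx0 mulmx0 addr0.
  - move=> y i j Dy; rewrite !mulmx0 !addr0 !rj.
    exact: pdC oD Dy (CkS Ck_rescale).
have := frame_riemann fr a b jC (fun c => Ck_cst _ _ _) WC Dv.
rewrite /curv !pd_cst !mulmx0 !subr0 addr0 mulmx0 => E.
by apply: (can_inj (mulmxK (fr_th_unit fr Dv))); rewrite E mul0mx.
Qed.

End Rescale.

(** * The total space outside the zero section *)

Section RadialFibration.
Context (R : realType) (n : nat) (g : 'rV[R]_n -> 'M[R]_n) (U : set 'rV[R]_n).
Variables (alpha beta : R -> R) (h : 'rV[R]_(n + n) -> 'M[R]_(n + n)).
Implicit Types (z : 'rV[R]_(n + n)) (a b c d : 'I_n).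
Local Notation Ipos := [set t : R | 0 < t].

Hypotheses (oU : open U) (gs : forall x, U x -> (g x)^T = g x)
  (gu : forall x, U x -> g x \in unitmx) (gC : Ck 3 U g).
Hypotheses (aC : Ck 3 Ipos alpha) (bC : Ck 2 Ipos beta).
Hypotheses (a_gt0 : forall t, Ipos t -> 0 < alpha t)
  (phi_gt0 : forall t, Ipos t -> 0 < alpha t + t * beta t).

Let gz z := g (lsubmx z).
Let vl z := flat_co (gz z) (rsubmx z).
Let rz z := sqn (gz z) (rsubmx z).
Let W z := radial_metric alpha beta (gz z) (rsubmx z).
Let V0 := [set z : 'rV[R]_(n + n) | U (lsubmx z)].
Definition slit_domain := [set z : 'rV[R]_(n + n) | U (lsubmx z) /\ 0 < rz z].
Let V := slit_domain.

Lemma open_preimage_within (T S : topologicalType) (A : set T) (B : set S) (f : T -> S) :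
  open A -> open B -> (forall x, A x -> {for x, continuous f}) ->
  open [set x | A x /\ B (f x)].
Proof.
move=> oA oB cf; rewrite openE => x [Ax Bfx]; apply: filterI.
  exact: open_nbhs_nbhs.
by apply: (cf x Ax); apply: open_nbhs_nbhs.
Qed.

Lemma open_V0 : open V0.
Proof. by apply: (open_comp (f := @lsubmx R 1 n n)) => // z _; exact: lsubmx_continuous. Qed.

Lemma Ck_gz k : Ck k U g -> Ck k V0 gz.
Proof. exact: Ck_lsub. Qed.

Lemma vl_mul z : vl z = rsubmx z *m gz z.
Proof. by rewrite /vl flat_co.unlock. Qed.

Lemma Ck_vl k : Ck k U g -> Ck k V0 vl.
Proof.
move=> gk; have := Ck_mulmx open_V0 (Ck_rsubmx k V0) (Ck_gz gk).
by apply: (Ck_eq open_V0) => z _; rewrite vl_mul.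
Qed.

Lemma rz_mul z : (rz z)%:M = vl z *m (rsubmx z)^T.
Proof. by rewrite flat_sqn. Qed.

Lemma Ck_rz k : Ck k U g -> Ck k V0 rz.
Proof.
move=> gk; have := Ck_entry 0 0 open_V0 (Ck_mulmx open_V0 (Ck_vl gk) (Ck_trmx open_V0 (Ck_rsubmx k V0))).
by apply: (Ck_eq open_V0) => z _; rewrite -rz_mul mxE eqxx mulr1n.
Qed.

Lemma open_slit : open V.
Proof.
have [c _] := Ck_rz (Ck_le (isT : (0 <= 3)%N) gC).
exact: (@open_preimage_within _ R V0 Ipos rz open_V0 (@open_pos R) c).
Qed.

Lemma slit_sub z : V z -> V0 z.
Proof. by case. Qed.

Lemma Ck_rz_comp k (f : R -> R) : Ck k Ipos f -> Ck k U g -> Ck k V (fun z => f (rz z)).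
Proof.
move=> fC gk; apply: (Ck_comp1 open_slit _ fC (CkW slit_sub (Ck_rz gk))).
by move=> z [].
Qed.

Lemma partial_rz_comp i z (f : R -> R) : Ck 1 Ipos f -> V z ->
  partial (fun y => f (rz y)) i z = 'D_1 f (rz z) * partial rz i z.
Proof.
move=> fC Vz; have [Uz rz0] := Vz.
have df : derivable f (rz z) 1 by exact: Ck_derivable fC rz0.
have dr : derivable rz z (delta_mx 0 i).
  by apply: Ck_derivable (Ck_rz (Ck_le (isT : (1 <= 3)%N) gC)) _; exact: slit_sub.
by have [_ E] := derive_comp1 df dr.
Qed.

Lemma Ck_W : Ck 2 V W.
Proof.
have g2 := CkS gC; have v2 := CkW slit_sub (Ck_vl g2); have oV := open_slit.
rewrite /W radial_metric.unlock; apply: (CkD oV); apply: (Ck_scalemx oV).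
- exact: Ck_rz_comp (CkS aC) g2.
- exact: CkW slit_sub (Ck_gz g2).
- exact: Ck_rz_comp bC g2.
- exact: Ck_mulmx oV (Ck_trmx oV v2) v2.
Qed.

Lemma pd_W i z : V z -> pd i W z =
  ('D_1 alpha (rz z) * partial rz i z) *: gz z + alpha (rz z) *: pd i gz z
  + (('D_1 beta (rz z) * partial rz i z) *: ((vl z)^T *m vl z)
     + beta (rz z) *: ((pd i vl z)^T *m vl z + (vl z)^T *m pd i vl z)).
Proof.
move=> Vz; have oV := open_slit.
have g1 : Ck 1 U g := Ck_le (isT : (1 <= 3)%N) gC.
have a1 : Ck 1 Ipos alpha := Ck_le (isT : (1 <= 3)%N) aC.
have b1 : Ck 1 Ipos beta := CkS bC.
have aR := Ck_rz_comp a1 g1; have bR := Ck_rz_comp b1 g1.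
have gR : Ck 1 V gz := CkW slit_sub (Ck_gz g1).
have vR : Ck 1 V vl := CkW slit_sub (Ck_vl g1).
have vvR := Ck_mulmx oV (Ck_trmx oV vR) vR.
rewrite /W radial_metric.unlock.
rewrite (pdD i oV Vz (Ck_scalemx oV aR gR) (Ck_scalemx oV bR vvR)).
rewrite (pdZ i oV Vz aR gR) (pdZ i oV Vz bR vvR) (pdM i oV Vz (Ck_trmx oV vR) vR) pd_trmx.
by rewrite (partial_rz_comp i a1 Vz) (partial_rz_comp i b1 Vz).
Qed.

Lemma pd_vl_l a z : V0 z -> pd (lshift n a) vl z =
  row a (hor_mx g z) *m gz z + vl z *m (chris g a (lsubmx z))^T.
Proof.
move=> Vz; have g1 : Ck 1 U g := Ck_le (isT : (1 <= 3)%N) gC.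
transitivity (pd (lshift n a) (fun z => rsubmx z *m gz z) z).
  by apply: (pd_eq _ open_V0 Vz) => y _; rewrite vl_mul.
rewrite (pdM _ open_V0 Vz (Ck_rsubmx 1 V0) (Ck_gz g1)) pd_rsubmx_l mul0mx add0r.
rewrite (pd_lsub_l g) (chris_metric a oU Vz gs (gu Vz)) mulmxDr !mulmxA -vl_mul.
by rewrite row_hor_mx.
Qed.

Lemma pd_vl_r d z : V0 z -> pd (rshift n d) vl z = row d (gz z).
Proof.
move=> Vz; have g1 : Ck 1 U g := Ck_le (isT : (1 <= 3)%N) gC.
transitivity (pd (rshift n d) (fun z => rsubmx z *m gz z) z).
  by apply: (pd_eq _ open_V0 Vz) => y _; rewrite vl_mul.
rewrite (pdM _ open_V0 Vz (Ck_rsubmx 1 V0) (Ck_gz g1)) pd_rsubmx_r.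
by rewrite (pd_lsub_r g) mulmx0 addr0 rowE.
Qed.

Lemma gz_flat z : V0 z -> gz z *m (rsubmx z)^T = (vl z)^T.
Proof. by move=> Vz; rewrite vl_mul trmx_mul gs. Qed.

Lemma partial_rz i z : V0 z -> partial rz i z =
  (pd i vl z *m (rsubmx z)^T) 0 0 + (vl z *m (pd i (@rsubmx R 1 n n) z)^T) 0 0.
Proof.
move=> Vz; have g1 : Ck 1 U g := Ck_le (isT : (1 <= 3)%N) gC.
transitivity (pd i (fun y => vl y *m (rsubmx y)^T) z 0 0).
  by rewrite pdE; apply: eq_partial => y; rewrite -rz_mul mxE eqxx mulr1n.
by rewrite (pdM i open_V0 Vz (Ck_vl g1) (Ck_trmx open_V0 (Ck_rsubmx 1 V0))) pd_trmx mxE.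
Qed.

Lemma partial_rz_l a z : V0 z ->
  partial rz (lshift n a) z = 2 * (row a (hor_mx g z) *m (vl z)^T) 0 0.
Proof.
move=> Vz; rewrite partial_rz // pd_rsubmx_l trmx0 mulmx0 [X in _ + X]mxE addr0.
rewrite pd_vl_l // mulmxDl -mulmxA gz_flat // mxE mulr2n mulrDl mul1r; congr (_ + _).
rewrite -mulmxA -trmx_mul -row_hor_mx.
transitivity (((vl z *m (row a (hor_mx g z))^T)^T) 0 0); first by rewrite [RHS]mxE.
by rewrite trmx_mul trmxK.
Qed.

Lemma partial_rz_r d z : V0 z -> partial rz (rshift n d) z = 2 * vl z 0 d.
Proof.
move=> Vz; rewrite partial_rz // pd_rsubmx_r pd_vl_r // -row_mul gz_flat //.
by rewrite trmx_delta -colE !mxE mulr2n mulrDl mul1r.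
Qed.

(** [W] is built from g, |v|^2 and v^*, all invariant under parallel transport; the sum over [c]
    converts a coordinate derivative into one along a horizontal lift. *)
Lemma radial_parallel a z : V z -> pd (lshift n a) W z =
    chris g a (lsubmx z) *m W z + W z *m (chris g a (lsubmx z))^T
    + \sum_c hor_mx g z a c *: pd (rshift n c) W z.
Proof.
move=> Vz; have V0z := slit_sub Vz; have oV := open_slit.
pose N := row a (hor_mx g z).
(* |v|^2 is constant along horizontal lifts. *)
have sumN : \sum_c hor_mx g z a c * partial rz (rshift n c) z = partial rz (lshift n a) z.
  rewrite partial_rz_l // mxE mulr_sumr; apply: eq_bigr => c _.
  by rewrite partial_rz_r // !mxE mulrCA.
have sumG : \sum_c hor_mx g z a c *: row c (gz z) = N *m gz z.
  by rewrite mulmx_sum_row; apply: eq_bigr => c _; rewrite /N mxE.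
have -> : \sum_c hor_mx g z a c *: pd (rshift n c) W z =
   ('D_1 alpha (rz z) * partial rz (lshift n a) z) *: gz z
   + (('D_1 beta (rz z) * partial rz (lshift n a) z) *: ((vl z)^T *m vl z)
     + beta (rz z) *: ((N *m gz z)^T *m vl z + (vl z)^T *m (N *m gz z))).
  transitivity (\sum_c ((hor_mx g z a c * partial rz (rshift n c) z) *: ('D_1 alpha (rz z) *: gz z)
     + ((hor_mx g z a c * partial rz (rshift n c) z) *: ('D_1 beta (rz z) *: ((vl z)^T *m vl z))
     + beta (rz z) *: ((hor_mx g z a c *: row c (gz z))^T *m vl z + (vl z)^T *m (hor_mx g z a c *: row c (gz z)))))).
    apply: eq_bigr => c _; rewrite pd_W // (pd_lsub_r g) scaler0 addr0 pd_vl_r //.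
    rewrite !scalerDr !scalerA linearZ /= -!scalemxAl -!scalemxAr !scalerA.
    by congr (_ *: _ + (_ *: _ + (_ *: _ + _ *: _))); ring.
  rewrite 2!big_split /= -!scaler_suml -scaler_sumr big_split /= -mulmx_suml -mulmx_sumr.
  by rewrite -linear_sum /= sumN sumG !scalerA ![partial _ _ _ * _]mulrC.
rewrite pd_W // (pd_lsub_l g) pd_vl_l // (chris_metric a oU V0z gs (gu V0z)) -/N.
have -> : W z = alpha (rz z) *: gz z + beta (rz z) *: ((vl z)^T *m vl z).
  by rewrite /W radial_metric.unlock.
rewrite !mulmxDl !mulmxDr -!scalemxAl -!scalemxAr !linearD /= !trmx_mul !trmxK !mulmxDl !mulmxA /gz.
move: (chris g a (lsubmx z)) => G1.
apply/matrixP => p q; rewrite !mxE; ring.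
Qed.

Hypothesis hE : forall z, V z -> h z =
  fibration_frame g z *m block_mx (gz z) 0 0 (W z) *m (fibration_frame g z)^T.

Lemma radial_natural_fibration : natural_fibration g U V W h.
Proof.
split; [exact: oU|exact: open_slit|exact: slit_sub|exact: gs|exact: gu|exact: CkS| | |exact: Ck_W|exact: hE|exact: radial_parallel].
- by move=> z Vz; apply: radial_sym; apply: gs; apply: slit_sub.
- move=> z Vz; have V0z := slit_sub Vz; have [_ r0] := Vz.
  by apply: radial_unit; [exact: gs|exact: a_gt0|exact: phi_gt0|exact: gu|exact: r0].
Qed.

Hypothesis bE : forall t, Ipos t -> beta t = 2 * 'D_1 alpha t + t * 'D_1 alpha t ^+ 2 / alpha t.
Hypothesis riem0 : forall x a b, U x -> riem g a b x = 0.
Hypothesis hC : Ck 2 V h.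

Let mu t := Num.sqrt (alpha t).
Let F z := rescale alpha (gz z) (rsubmx z).

(** The pull-back of the Levi-Civita connection of the base to the total space; it is zero in
    vertical directions. *)
Definition pullback_chris (i : 'I_(n + n)) z : 'M[R]_n :=
  match fintype.split i with inl a => chris g a (lsubmx z) | inr _ => 0 end.

Lemma pullback_chris_l a : pullback_chris (lshift n a) = fun z => chris g a (lsubmx z).
Proof. by apply/funext => z; rewrite /pullback_chris (unsplitK (inl a)). Qed.

Lemma pullback_chris_r d : pullback_chris (rshift n d) = fun=> 0.
Proof. by apply/funext => z; rewrite /pullback_chris (unsplitK (inr d)). Qed.

Lemma Ck_pullback_chris i : Ck 2 V (pullback_chris i).
Proof.
case: (split_ordP i) => a ->; last by rewrite pullback_chris_r; exact: Ck_cst.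
rewrite pullback_chris_l; exact: CkW slit_sub (Ck_lsub _ (Ck_chris a oU gu gC)).
Qed.

Lemma curv_pullback i j z : V z -> curv pullback_chris i j z = 0.
Proof.
move=> Vz; have Uz := slit_sub Vz.
case: (split_ordP i) => a ->; case: (split_ordP j) => b ->; rewrite /curv ?pullback_chris_l ?pullback_chris_r.
- by rewrite !(pd_lsub_l (chris g _)) -/(curv (chris g) a b (lsubmx z)) -riemE riem0.
- by rewrite pd_cst (pd_lsub_r (chris g a)) mul0mx mulmx0 !subr0 add0r.
- by rewrite pd_cst (pd_lsub_r (chris g b)) mul0mx mulmx0 !subr0 add0r.
- by rewrite !pd_cst mulmx0 !subr0 add0r.
Qed.

Lemma Ck_F : Ck 3 V F.
Proof.
rewrite /F rescale.unlock; have oV := open_slit.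
exact: Ck_scalemx oV (Ck_rz_comp (Ck_mu aC a_gt0) gC) (Ck_rsubmx 3 V).
Qed.

(** The coframe (d pi, D F) with values in two copies of the pulled-back tangent bundle, where D is
    the pulled-back covariant derivative and [F] the rescaling, seen as a section. *)
Definition developing_frame z : 'M[R]_(n + n) :=
  row_mx (col_mx 1%:M 0) (\matrix_i (pd i F z + F z *m pullback_chris i z)).

(** D F vanishes on horizontal lifts, because |v|^2 is constant along them. A coordinate field
    differs from its lift by the vertical row of [hor_mx], on which D F is the fibrewise
    Jacobian. *)
Lemma rescale_horizontal a z : V z ->
  pd (lshift n a) F z + F z *m chris g a (lsubmx z) =
  row a (hor_mx g z) *m rescale_jac (gz z) alpha (rsubmx z).
Proof.
move=> Vz; have V0z := slit_sub Vz; have oV := open_slit; have [_ r0] := Vz.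
have g1 : Ck 1 U g := Ck_le (isT : (1 <= 3)%N) gC.
have mC : Ck 1 Ipos mu := Ck_le (isT : (1 <= 3)%N) (Ck_mu aC a_gt0).
rewrite (rescale_jacE (gs V0z) aC a_gt0 r0) -/(rz z) -/(vl z).
have -> : F z = mu (rz z) *: rsubmx z by rewrite /F rescale.unlock.
have -> : pd (lshift n a) F z = partial (fun z => mu (rz z)) (lshift n a) z *: rsubmx z.
  rewrite /F rescale.unlock (pdZ _ oV Vz (Ck_rz_comp mC g1) (Ck_rsubmx 1 V)).
  by rewrite pd_rsubmx_l scaler0 addr0.
rewrite (partial_rz_comp _ mC Vz) partial_rz_l // (D1_mu aC a_gt0 r0).
rewrite -scalemxAl -row_hor_mx mulmxDr mul_mx_scalar addrC; congr (_ + _).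
rewrite -scalemxAr mulmxA [row a _ *m _]mx11_scalar mul_scalar_mx scalerA; congr (_ *: _).
have m0 : 0 < Num.sqrt (alpha (rz z)) := mu_gt0 a_gt0 r0.
by rewrite [_%:M 0 0]mxE eqxx mulr1n; field; rewrite gt_eqF.
Qed.

Lemma developing_frameE z : V z -> developing_frame z =
  fibration_frame g z *m block_mx 1%:M 0 0 (rescale_jac (gz z) alpha (rsubmx z)).
Proof.
move=> Vz; rewrite /developing_frame /fibration_frame mulmx_block !mulmx0 !mul0mx !mulmx1 !mul1mx.
rewrite !addr0 !add0r block_mxEh; congr row_mx.
apply/row_matrixP => i; rewrite rowK.
case: (split_ordP i) => a ->; rewrite ?rowKu ?rowKd ?pullback_chris_l ?pullback_chris_r.
  by rewrite rescale_horizontal // row_mul.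
rewrite mulmx0 addr0 pd_rslice [RHS]rowK.
congr (pd _ _ _); apply/funext => v; by rewrite /F /gz row_mxKl row_mxKr.
Qed.

(** In the coframe [developing_frame] the metric is two copies of [g], and two copies of the
    pulled-back connection, flat by [curv_pullback], form its Levi-Civita connection. *)
Lemma radial_flat i j z : V z -> riem h i j z = 0.
Proof.
move=> Vz; have oV := open_slit.
pose RR z := \matrix_i (pd i F z + F z *m pullback_chris i z).
pose w i z : 'M[R]_(n + n) := block_mx (pullback_chris i z) 0 0 (pullback_chris i z).
have RRr i' j' y : row j' (pd i' RR y) = pd i' (fun y => pd j' F y + F y *m pullback_chris j' y) y.
  apply/rowP => k; rewrite [LHS]mxE 2!pdE; apply: eq_partial => u.
  by rewrite [LHS]mxE.
have RRC i' : Ck 2 V (fun y => pd i' F y + F y *m pullback_chris i' y).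
  exact: CkD oV (Ck_pd i' oV Ck_F) (Ck_mulmx oV (CkS Ck_F) (Ck_pullback_chris i')).
have FC2 := CkS Ck_F; have FC1 := CkS FC2.
have dC2 : Ck 2 V developing_frame.
  apply: (Ck_entries oV) => i' j'; case: (split_ordP j') => k ->.
    by apply: (Ck_eq oV _ (Ck_cst V 2 ((col_mx 1%:M 0 : 'M[R]_(n + n, n)) i' k))) => y _; rewrite row_mxEl.
  by apply: (Ck_eq oV _ (Ck_entry 0 k oV (RRC i'))) => y _; rewrite row_mxEr [RHS]mxE.
have pdd i' y : pd i' developing_frame y = row_mx 0 (pd i' RR y).
  apply/matrixP => p q; rewrite pdE; case: (split_ordP q) => k ->.
    rewrite row_mxEl mxE; transitivity (partial (fun=> (col_mx 1%:M 0 : 'M[R]_(n + n, n)) p k) i' y).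
      by apply: eq_partial => u; rewrite row_mxEl.
    exact: derive_cst.
  by rewrite row_mxEr pdE; apply: eq_partial => u; rewrite row_mxEr.
have nf := radial_natural_fibration.
have hu := fr_unit (fibration_lc_frame nf).
have gzC : Ck 1 V gz := CkW slit_sub (Ck_gz (Ck_le (isT : (1 <= 3)%N) gC)).
have wC (k : 'I_(n + n)) : Ck 1 V (w k).
  have pc := CkS (Ck_pullback_chris k).
  exact (Ck_block oV pc (Ck_cst _ _ _) (Ck_cst _ _ _) pc).
have fr : lc_frame V h developing_frame (fun z => block_mx (gz z) 0 0 (gz z)) w.
  split.
  - exact: oV.
  - exact: hu.
  - exact: CkS.
  - exact (Ck_block oV gzC (Ck_cst _ _ _) (Ck_cst _ _ _) gzC).
  - by move=> y Vy; rewrite tr_block_mx !trmx0 gs //; exact: slit_sub.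
  - move=> y Vy; have [_ r0] := Vy; have V0y := slit_sub Vy.
    rewrite developing_frameE // hE // [in RHS]trmx_mul !mulmxA; congr (_ *m _).
    rewrite -!mulmxA; congr (_ *m _).
    rewrite tr_block_mx !mulmx_block !trmx0 trmx1 !mulmx0 !mul0mx !mulmx1 !mul1mx !addr0 !add0r.
    by rewrite mulmx0 mulmxA (rescale_isometry (gs V0y) aC a_gt0 bE r0).
  - move=> y i' Vy; have Uy := slit_sub Vy.
    rewrite pd_block !pd_cst /w tr_block_mx !mulmx_block !trmx0 !mulmx0 !mul0mx.
    rewrite add_block_mx !addr0 !add0r.
    suff -> : pd i' gz y = pullback_chris i' y *m gz y + gz y *m (pullback_chris i' y)^T by [].
    case: (split_ordP i') => a ->.
      by rewrite pullback_chris_l (pd_lsub_l g) (chris_metric a oU Uy gs (gu Uy)).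
    by rewrite pullback_chris_r (pd_lsub_r g) mul0mx trmx0 mulmx0 addr0.
  - move=> y i' j' Vy; have Uy := slit_sub Vy.
    have E k l : row l (pd k developing_frame y + developing_frame y *m w k y) =
       row_mx (row l (col_mx (pullback_chris k y) 0))
        (row l (pd k RR y) + row l (RR y) *m pullback_chris k y).
      rewrite pdd /w {1}/developing_frame -/(RR y) mul_row_block !mulmx0 addr0 add0r.
      rewrite add_row_mx add0r mul_col_mx mul1mx mul0mx row_row_mx.
      by congr row_mx; rewrite linearD /= row_mul.
    rewrite !E; congr row_mx.
      case: (split_ordP i') => a ->; case: (split_ordP j') => b ->;
        rewrite ?rowKu ?rowKd ?pullback_chris_l ?pullback_chris_r //.
      + by apply/rowP => k; rewrite !mxE (chris_sym oU Uy gs).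
      + by rewrite !linear0.
      + by rewrite !linear0.
      + by rewrite !linear0.
    have pF k l : pd k (fun y => pd l F y + F y *m pullback_chris l y) y =
        pd k (pd l F) y + (pd k F y *m pullback_chris l y + F y *m pd k (pullback_chris l) y).
      have c1 := CkS (Ck_pullback_chris l).
      rewrite (pdD k oV Vy (Ck_pd l oV FC2) (Ck_mulmx oV FC1 c1)).
      by rewrite (pdM k oV Vy FC1 c1).
    rewrite !RRr !pF !rowK (pdC i' j' oV Vy FC2) -!addrA; congr (_ + _).
    (* Torsion of the second copy: the antisymmetrized second covariant derivative of [F] is the
       curvature applied to [F], and the base is flat. *)
    have := congr1 (mulmx (F y)) (curv_pullback i' j' Vy).
    rewrite mulmx0 /curv !mulmxDr !mulmxN !mulmxDl -!mulmxA => /eqP E0.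
    apply/eqP; rewrite -subr_eq0 -(eqP E0); apply/eqP; rewrite !opprD.
    by apply/rowP => k; rewrite !mxE; ring.
have := frame_riemann fr i j dC2 wC hC Vz.
have -> : curv w i j z = 0.
  have c1 k := CkS (Ck_pullback_chris k).
  have := curv_pullback i j Vz; rewrite /curv /w !pd_block !pd_cst !mulmx_block.
  rewrite !mulmx0 !mul0mx !addr0 !add0r !opp_block_mx !add_block_mx !oppr0 !addr0 => ->.
  by apply/matrixP => p q; case: (split_ordP p) => p' ->; case: (split_ordP q) => q' ->;
    rewrite ?(block_mxEul, block_mxEur, block_mxEdl, block_mxEdr) !mxE.
rewrite mulmx0 => E.
by apply: (can_inj (mulmxK (fr_th_unit fr Vz))); rewrite E mul0mx.
Qed.

End RadialFibration.

(** * The radial differential equation *)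

Section RadialODE.
Context (R : realType).
Variables (alpha beta : R -> R).
Local Notation Ipos := [set t : R | 0 < t].
Hypotheses (sa : smooth_halfline alpha) (sb : smooth_halfline beta).
Hypotheses (a_gt0 : forall t, 0 <= t -> 0 < alpha t)
  (phi_gt0 : forall t, 0 <= t -> 0 < alpha t + t * beta t).
Let phi (t : R) : R := alpha t + t * beta t.
Let a := log_der alpha.
Let s := log_der phi.
Hypothesis ode : forall t : R, 0 < t ->
  s t - 3 * a t - 2 * t * 'D_1 a t + t * a t * s t - t * a t ^+ 2 = 0.

(** The first integral (alpha + t alpha')^2 / (alpha phi), written with the logarithmic derivative
    [a]. *)
Let Q (t : R) : R := alpha t * (1 + t * a t) ^+ 2 / phi t.

(** With alpha' = a alpha and phi' = s phi, the derivative of [Q] is the left-hand side of [ode]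
    times - alpha (1 + t a) / phi. *)
Lemma ode_is_derive (t : R) : 0 < t -> is_derive t (1 : R) Q 0.
Proof.
move=> t0.
have aC : Ck 2 Ipos alpha := smooth_halfline_Ck 2 0 sa.
have bC : Ck 2 Ipos beta := smooth_halfline_Ck 2 0 sb.
have pa u : Ipos u -> 0 < alpha u by move=> /ltW; exact: a_gt0.
have pp u : Ipos u -> 0 < phi u by move=> /ltW; exact: phi_gt0.
have pC : Ck 2 Ipos phi := phiC aC bC.
have da : is_derive t (1 : R) alpha ('D_1 alpha t) by apply: derivableP; exact: Ck_derivable aC t0.
have dp : is_derive t (1 : R) phi ('D_1 phi t) by apply: derivableP; exact: Ck_derivable pC t0.
have dla : is_derive t (1 : R) a ('D_1 a t).
  by apply: derivableP; exact: Ck_derivable (Ck_log_der pa aC) t0.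
have p0 : phi t != 0 by rewrite gt_eqF // pp.
have a0 : alpha t != 0 by rewrite gt_eqF // pa.
have did : is_derive t (1 : R) id 1 := is_derive_id t 1.
have e1 := is_deriveD (is_derive_cst (1 : R) t 1) (is_deriveM did dla).
have e := is_deriveM (is_deriveM da (is_deriveX 2 e1)) (is_deriveV p0 dp).
rewrite [X in is_derive _ _ _ X](_ : _ = 0) in e; first exact: e.
have Da : 'D_1 alpha t = a t * alpha t by rewrite /a /log_der divfK.
have Dp : 'D_1 phi t = s t * phi t by rewrite /s /log_der divfK.
rewrite Da Dp; move: (ode t0) => E.
change (alpha t * (1 + t * a t) ^+ 2 * (- phi t ^- 2 * (s t * phi t)) +
    (phi t)^-1 * (alpha t * (2 * (1 + t * a t) * (0 + (t * 'D_1 a t + a t * 1))) +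
      (1 + t * a t) ^+ 2 * (a t * alpha t)) = 0).
  transitivity (- (alpha t * (1 + t * a t) / phi t) *
     (s t - 3 * a t - 2 * t * 'D_1 a t + t * a t * s t - t * a t ^+ 2)); last by rewrite E mulr0.
by field.
Qed.

Lemma ode_const x y : 0 < x -> x <= y -> Q x = Q y.
Proof.
move=> x0 xy; have dQ u : 0 < u -> derivable Q u (1 : R) by move=> /ode_is_derive[].
have [||c] := @MVT_segment R Q (fun=> 0) x y xy.
- move=> u; rewrite in_itv /= => /andP[xu _]; apply: ode_is_derive; exact: lt_trans xu.
- apply: derivable_within_continuous => u; rewrite in_itv /= => /andP[xu _].
  apply: dQ; exact: lt_le_trans xu.
- by move=> _ /eqP; rewrite mul0r subr_eq0 => /eqP.
Qed.

Lemma halfline_derive_eq (f : R -> R) (t : R) : smooth_halfline f -> 0 < t -> 'D_1 f t = derive_halfline f t.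
Proof. by move=> sf t0; have [] := halfline_is_derive t0 (sf 0%N t (ltW t0)). Qed.

(* [Q] is constant and tends to 1 at the zero section. *)
Lemma ode_solution t : 0 < t -> beta t = 2 * 'D_1 alpha t + t * 'D_1 alpha t ^+ 2 / alpha t.
Proof.
move=> t0; pose c := Q 1.
have Qc u : 0 < u -> Q u = c.
  by move=> u0; rewrite /c; case: (leP u 1) => [/(ode_const u0)//|/ltW/(ode_const ltr01)].
have E u : 0 < u -> (alpha u + u * 'D_1 alpha u) ^+ 2 = c * (alpha u * phi u).
  move=> u0; rewrite -(Qc u u0) /Q /a /log_der.
  have p0 : phi u != 0 by rewrite gt_eqF // phi_gt0 // ltW.
  have a0 : alpha u != 0 by rewrite gt_eqF // a_gt0 // ltW.
  by field; rewrite p0 a0.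
have c1 : c = 1.
  have ca := halfline_cvg0 (@sa 0%N _ (lexx 0)).
  have cb := halfline_cvg0 (@sb 0%N _ (lexx 0)).
  (* The one-sided derivative of [alpha] is continuous at 0, so that t alpha'(t) tends to 0. *)
  have cd := halfline_cvg0 (@sa 1%N _ (lexx 0)).
  have ci : (fun t : R => t) @ 0^'+ --> (0 : R) by apply: cvg_at_right_filter; exact: cvg_id.
  set d0 := iter _ _ _ _ in cd.
  have l1 : (alpha t + t * derive_halfline alpha t) * (alpha t + t * derive_halfline alpha t) @[t --> 0^'+]
      --> (alpha 0 + 0 * d0) * (alpha 0 + 0 * d0).
    by apply: cvgM; apply: cvgD ca _; apply: cvgM ci cd.
  have l2 : c * (alpha t * phi t) @[t --> 0^'+] --> c * (alpha 0 * (alpha 0 + 0 * beta 0)).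
    apply: cvgM; first exact: cvg_cst.
    apply: cvgM; first exact: ca.
    by apply: cvgD; [exact: ca|apply: cvgM; [exact: ci|exact: cb]].
  have l3 : c * (alpha t * phi t) @[t --> 0^'+] --> (alpha 0 + 0 * d0) * (alpha 0 + 0 * d0).
    apply: cvg_trans l1; apply: near_eq_cvg; near=> u.
    have u0 : 0 < u by near: u; exact: nbhs_right_gt.
    by rewrite -expr2 -halfline_derive_eq // E.
  have a0 : alpha 0 != 0 by rewrite gt_eqF // a_gt0.
  have := etrans (esym (cvg_lim (@Rhausdorff R) l2)) (cvg_lim (@Rhausdorff R) l3).
  rewrite !mul0r !addr0 => E0.
  by apply: (mulIf (mulf_neq0 a0 a0)); rewrite mul1r; exact: E0.
have a0 : alpha t != 0 by rewrite gt_eqF // a_gt0 // ltW.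
have := E t t0; rewrite c1 mul1r /phi => Et.
(* Expanded, [Et] loses alpha^2 on both sides; the factor t alpha that remains in front of [beta] is
   then cancelled. *)
apply: (mulfI (mulf_neq0 (lt0r_neq0 t0) a0)).
have -> : t * alpha t * beta t = (alpha t + t * 'D_1 alpha t) ^+ 2 - alpha t ^+ 2.
  by rewrite Et; ring.
by field.
Unshelve. all: by end_near. Qed.

End RadialODE.

(** * Positive definite matrices *)

Section PositiveDefinite.
Context (R : realType).

(** Gram-Schmidt by blocks: [L] normalizes the first vector and clears its row and column, leaving
    the Schur complement [S], which is again positive definite. *)
Lemma posdef_basis n (g : 'M[R]_n) : g^T = g ->
  (forall x : 'rV[R]_n, x != 0 -> 0 < (x *m g *m x^T) 0 0) ->
  exists B : 'M[R]_n, B *m g *m B^T = 1%:M.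
Proof.
elim: n g => [|n IH] g gs gp; first by exists 0; apply/matrixP => -[].
pose g' : 'M[R]_(1 + n) := g.
pose a := g' 0 0; pose b := ursubmx g'; pose d := drsubmx g'.
have gE : g' = block_mx a%:M b b^T d.
  rewrite -[LHS]submxK -/b -/d; congr (block_mx _ _ _ _).
    rewrite [LHS]mx11_scalar; congr (_%:M); rewrite !mxE; congr (g' _ _); exact: val_inj.
  by rewrite trmx_ursub /g' gs.
have ds : d^T = d.
  by rewrite /d trmx_drsub /g' gs.
have a0 : 0 < a.
  have := gp (delta_mx 0 0); rewrite -rowE trmx_delta -colE !mxE; apply.
  by apply/eqP => /rowP/(_ 0); rewrite !mxE eqxx; apply/eqP; rewrite oner_eq0.
pose S := d - a^-1 *: (b^T *m b).
have [|x x0|B' B'E] := IH S.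
- by rewrite /S linearB linearZ /= trmx_mul trmxK ds.
(* The first coordinate makes [y] orthogonal to the first basis vector, so that the form of [g'] at
   [y] is that of [S] at [x]. *)
- pose y : 'rV[R]_(1 + n) := row_mx (- (a^-1 *: (x *m b^T))) x.
  have y0 : y != 0.
    apply: contra x0 => /eqP/(congr1 rsubmx); rewrite row_mxKr => ->.
    by apply/eqP/rowP => i; rewrite !mxE.
  have gp' : forall y : 'rV[R]_(1 + n), y != 0 -> 0 < (y *m g' *m y^T) 0 0 := gp.
  have := gp' y y0; rewrite gE /y mul_row_block tr_row_mx mul_row_col.
  rewrite mul_mx_scalar mulNmx -scalemxAl scalerN scalerA mulfV ?gt_eqF // scale1r addNr mul0mx add0r.
  by rewrite /S mulmxBr -scalemxAr mulmxA addrC.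
- pose c := (Num.sqrt a)^-1.
  pose L : 'M[R]_(1 + n) := block_mx c%:M 0 (- (a^-1 *: b^T)) 1%:M.
  have c2 : c * a * c = 1.
    rewrite /c mulrC mulrA -invfM -expr2 sqr_sqrtr ?ltW // mulVf // gt_eqF //.
  have LE : L *m g' *m L^T = block_mx 1%:M 0 0 S.
    rewrite gE /L tr_block_mx !mulmx_block tr_scalar_mx !trmx0 trmx1 [(- _)^T]linearN /= [(_ *: _)^T]linearZ /= trmxK.
    have DL0 : - (a^-1 *: b^T) *m a%:M + b^T = 0.
      by rewrite mulNmx mul_mx_scalar scalerA mulfV ?gt_eqF // scale1r addNr.
    rewrite !mul0mx !addr0 !mul1mx !mulmx1 DL0 !mul0mx add0r.
    have -> : c%:M *m a%:M *m c%:M = 1%:M :> 'M[R]_1 by rewrite -!scalar_mxM c2.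
    have -> : c%:M *m a%:M *m - (a^-1 *: b) + c%:M *m b = 0.
      rewrite mulmxN -scalar_mxM !mul_scalar_mx scalerA mulfK ?gt_eqF //.
      by rewrite addNr.
    by rewrite !mulmx0 addr0 add0r mulNmx -scalemxAl addrC.
  pose P : 'M[R]_(1 + n) := block_mx 1%:M 0 0 B'.
  have PE : (P *m L) *m g' *m (P *m L)^T = 1%:M.
    rewrite trmx_mul !mulmxA -(mulmxA P L g') -(mulmxA P (L *m g')) LE.
    rewrite /P tr_block_mx !mulmx_block !trmx0 trmx1 !mul0mx !mulmx0 !addr0 !add0r !mul1mx.
    by rewrite B'E !mul0mx -scalar_mx_block.
  by exists (P *m L); exact: PE.
Qed.

Lemma posdef_unit n (g : 'M[R]_n) :
  (forall x : 'rV[R]_n, x != 0 -> 0 < (x *m g *m x^T) 0 0) -> g \in unitmx.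
Proof.
move=> gp; rewrite -row_free_unit -kermx_eq0; apply/eqP/row_matrixP => i; rewrite row0.
apply/eqP; apply: contraT => /gp.
have -> : row i (kermx g) *m g = 0 by rewrite -row_mul mulmx_ker row0.
by rewrite mul0mx mxE ltxx.
Qed.

(* In an orthonormal basis the trace is minus the sum of the squares of the entries. *)
Lemma trace_antisym_eq0 n (g S : 'M[R]_n) : g^T = g ->
  (forall x : 'rV[R]_n, x != 0 -> 0 < (x *m g *m x^T) 0 0) ->
  S^T = - S -> \tr (S *m invmx g *m (S *m invmx g)) = 0 -> S = 0.
Proof.
move=> gs gp Sa tr0.
have [B BE] := posdef_basis gs gp.
have [BU _] : B \in unitmx /\ B^T \in unitmx.
  by have := mulmx1_unit BE; rewrite unitmx_mul => -[/andP[]].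
have gi : invmx g = B^T *m B.
  have gu := posdef_unit gp.
  apply: (can_inj (mulmxK gu)); rewrite mulVmx // -mulmxA.
  by rewrite (mulmx1C BE).
pose T := B *m S *m B^T.
have Ta i j : T j i = - T i j.
  have : T^T = - T by rewrite /T !trmx_mul trmxK Sa mulNmx mulmxN mulmxA.
  by move=> /matrixP/(_ i j); rewrite !mxE.
have : \tr (T *m T) = 0.
  by rewrite -tr0 gi /T -!mulmxA mxtrace_mulC -!mulmxA.
rewrite /mxtrace => /eqP; rewrite -oppr_eq0 -sumrN => /eqP sum0.
have T0 : T = 0.
  apply/matrixP => i j; rewrite [RHS]mxE.
  have pos k : 0 <= - (T *m T) k k.
    rewrite mxE -sumrN; apply: sumr_ge0 => l _; rewrite (Ta k l) mulrN opprK.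
    by rewrite -expr2 sqr_ge0.
  have := psumr_eq0P (fun k _ => pos k) sum0 => /(_ i isT)/eqP.
  rewrite mxE -sumrN => /eqP sumi.
  have := psumr_eq0P _ sumi => /(_ _ j isT) E.
  apply/eqP; rewrite -sqrf_eq0 expr2; apply/eqP.
  rewrite -E; first by rewrite (Ta i j) mulrN opprK.
  by move=> k _; rewrite (Ta i k) mulrN opprK -expr2 sqr_ge0.
have : invmx B *m T *m invmx B^T = S
  by rewrite /T !mulmxA mulVmx // mul1mx mulmxK // unitmx_tr.
by rewrite T0 mulmx0 mul0mx.
Qed.

End PositiveDefinite.

(** * The local statement *)

Section LocalTheorem.
Context (R : realType) (n : nat) (g : 'rV[R]_n -> 'M[R]_n) (U : set 'rV[R]_n).
Hypotheses (oU : open U) (gs : forall x, U x -> (g x)^T = g x) (gC : Ck 3 U g).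
Hypothesis gp : forall x (v : 'rV[R]_n), U x -> v != 0 -> 0 < (v *m g x *m v^T) 0 0.
Implicit Types (a b c d : 'I_n) (x v : 'rV[R]_n) (z : 'rV[R]_(n + n)).

Lemma local_unit x : U x -> g x \in unitmx.
Proof. by move=> Ux; apply: posdef_unit => v; exact: gp. Qed.

Let gu := local_unit.

(** Metricity differentiated once more: the second derivatives of [g] commute, so the commutator of
    covariant derivatives kills [g]. *)
Lemma riem_metric a b x : U x -> (riem g a b x *m g x)^T = - (riem g a b x *m g x).
Proof.
move=> Ux; have g2 := CkS gC; have g1 := CkS g2.
have cC c : Ck 1 U (chris g c) := Ck_chris c oU gu g2.
have ctC c := Ck_trmx oU (cC c).
pose X a b := pd a (chris g b) x *m g x + chris g b x *m (chris g a x *m g x + g x *m (chris g a x)^T).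
have E a' b' : pd a' (pd b' g) x = X a' b' + (X a' b')^T.
  rewrite (pd_eq a' oU Ux (fun y Uy => chris_metric b' oU Uy gs (gu Uy))).
  rewrite (pdD a' oU Ux (Ck_mulmx oU (cC b') g1) (Ck_mulmx oU g1 (ctC b'))).
  rewrite (pdM a' oU Ux (cC b') g1) (pdM a' oU Ux g1 (ctC b')) pd_trmx.
  rewrite (chris_metric a' oU Ux gs (gu Ux)) /X; congr (_ + _).
  rewrite [RHS]linearD /= !trmx_mul [(_ + _)^T]linearD /= !trmx_mul trmxK gs //.
  by rewrite addrC; congr (_ + _ *m _); rewrite addrC.
have := pdC a b oU Ux g2; rewrite !E => /eqP; rewrite -subr_eq0 => /eqP E0.
have RE : riem g a b x *m g x = X a b - X b a - (chris g b x *m g x *m (chris g a x)^T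
     - (chris g b x *m g x *m (chris g a x)^T)^T).
  rewrite riemE /curv /X !trmx_mul trmxK gs // !mulmxDl !mulNmx !mulmxDr !mulmxA.
  by apply/matrixP => i j; rewrite !mxE; ring.
apply/eqP; rewrite -addr_eq0 {1}RE [_^T]linearB /= [(_ - X b a)^T]linearB /= [(_ - _^T)^T]linearB /= trmxK RE.
apply/eqP; rewrite -[RHS]E0.
by apply/matrixP => i j; rewrite !mxE; ring.
Qed.

Variables (alpha beta : R -> R) (h : 'rV[R]_(n + n) -> 'M[R]_(n + n)).
Hypotheses (n2 : (2 <= n)%N) (sa : smooth_halfline alpha) (sb : smooth_halfline beta).
Hypotheses (a_gt0 : forall t, 0 <= t -> 0 < alpha t)
  (phi_gt0 : forall t, 0 <= t -> 0 < alpha t + t * beta t).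
Let V := slit_domain g U.
Let W z := radial_metric alpha beta (g (lsubmx z)) (rsubmx z).
Hypothesis hE : forall z, V z -> h z =
  fibration_frame g z *m block_mx (g (lsubmx z)) 0 0 (W z) *m (fibration_frame g z)^T.
Hypothesis hC : Ck 2 V h.
Hypothesis h_ricci : forall z d e, V z -> ricci h (rshift n d) (rshift n e) z = 0.

Let aC k : Ck k [set t : R | 0 < t] alpha := smooth_halfline_Ck k 0 sa.
Let bC k : Ck k [set t : R | 0 < t] beta := smooth_halfline_Ck k 0 sb.
Let a_pos (t : R) (t0 : 0 < t) := a_gt0 (ltW t0).
Let phi_pos (t : R) (t0 : 0 < t) := phi_gt0 (ltW t0).

Lemma local_fibration : natural_fibration g U V W h.
Proof. exact: radial_natural_fibration oU gs gu gC (aC 3) (bC 2) a_pos phi_pos hE. Qed.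

Lemma local_fibre_ricci z d e : V z ->
  ricci (radial_metric alpha beta (g (lsubmx z))) d e (rsubmx z) =
  \tr (oneill g W e z *m oneill g W d z).
Proof.
move=> Vz; have -> : radial_metric alpha beta (g (lsubmx z)) = (fun v => W (row_mx (lsubmx z) v)).
  by apply/funext => v; rewrite /W row_mxKl row_mxKr.
have := ricci_vertical local_fibration d e hC Vz; rewrite h_ricci // => /esym/eqP.
by rewrite subr_eq0 => /eqP.
Qed.

Lemma slit_in x v : U x -> v != 0 -> V (row_mx x v).
Proof. by move=> Ux v0; split; rewrite row_mxKl // row_mxKr sqn.unlock; exact: gp. Qed.

(* The curvature endomorphisms are antisymmetric, so O'Neill's tensor vanishes on
   the radial direction. *)
Lemma oneill_radial z : V z -> \sum_d rsubmx z 0 d *: oneill g W d z = 0.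
Proof.
move=> Vz; have [Uz r0] := Vz; set x := lsubmx z in Uz; set v := rsubmx z.
have low0 : \sum_d v 0 d *: oneill_low g W d z = 0.
  apply/matrixP => a b; rewrite summxE mxE.
  transitivity ((curv_vec g a z *m (W z *m v^T)) b 0).
    by rewrite mulmxA mxE; apply: eq_bigr => d _; rewrite !mxE mulrC.
  have -> : W z *m v^T = (alpha (sqn (g x) v) + sqn (g x) v * beta (sqn (g x) v)) *: (flat_co (g x) v)^T.
    have := congr1 trmx (radial_mul alpha beta (gs Uz) v).
    by rewrite trmx_mul radial_sym ?gs // linearZ.
  rewrite -scalemxAr mxE.
  have -> : (curv_vec g a z *m (flat_co (g x) v)^T) b 0 = (v *m (riem g a b x *m g x) *m v^T) 0 0.
    rewrite flat_co.unlock trmx_mul gs // !mulmxA.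
    transitivity (row b (curv_vec g a z *m g x *m v^T) 0 0); first by rewrite [RHS]mxE.
    by rewrite !row_mul /curv_vec rowK.
  set K := riem g a b x *m g x.
  suff /eqP : (v *m K *m v^T) 0 0 = - (v *m K *m v^T) 0 0.
    by rewrite -addr_eq0 -mulr2n mulrn_eq0 /= => /eqP ->; rewrite mulr0.
  transitivity ((v *m K *m v^T)^T 0 0); first by rewrite [RHS]mxE.
  have KA : K^T = - K by exact: riem_metric.
  clearbody K; by rewrite 2!trmx_mul trmxK KA mulNmx mulmxN mulmxA mxE.
have -> : \sum_d v 0 d *: oneill g W d z =
    2^-1 *: ((\sum_d v 0 d *: oneill_low g W d z) *m invmx (g x)).
  rewrite mulmx_suml scaler_sumr; apply: eq_bigr => d _.
  by rewrite /oneill -scalemxAl !scalerA mulrC.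
by rewrite low0 mul0mx scaler0.
Qed.

(** Contract the vertical Ricci identity twice with a vector v such that |v|^2 = t: the O'Neill term
    vanishes by [oneill_radial], and [radial_ricci] evaluates the other side. *)
Lemma local_ode t : (exists x, U x) -> 0 < t ->
  let a := log_der alpha in let s := log_der (fun t => alpha t + t * beta t) in
  s t - 3 * a t - 2 * t * 'D_1 a t + t * a t * s t - t * a t ^+ 2 = 0.
Proof.
move=> [x Ux] t0 a s.
pose i0 : 'I_n := Ordinal (ltnW n2).
pose e0 : 'rV[R]_n := delta_mx 0 i0.
have e00 : e0 != 0 by apply/eqP => /rowP/(_ i0); rewrite !mxE !eqxx => /eqP; rewrite oner_eq0.
have r0 := gp Ux e00.
(* The factor for which [k *: e0] has squared norm [t]. *)
pose k := Num.sqrt (t / (e0 *m g x *m e0^T) 0 0).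
pose v := k *: e0.
have vt : sqn (g x) v = t.
  rewrite sqn.unlock /v linearZ /= -!scalemxAl -scalemxAr scalerA mxE -expr2 sqr_sqrtr.
    by rewrite divfK // gt_eqF.
  by rewrite divr_ge0 // ltW.
have v0 : v != 0 by rewrite scaler_eq0 negb_or e00 andbT gt_eqF // sqrtr_gt0 divr_gt0.
have Vz := slit_in Ux v0.
have v_r : 0 < sqn (g x) v by rewrite vt.
have := radial_ricci (gs Ux) (aC 2) (bC 2) a_pos phi_pos (gu Ux) v_r.
rewrite vt /= -/a -/s => E.
have E0 : \sum_b \sum_c v 0 b * (v 0 c * ricci (radial_metric alpha beta (g x)) b c v) = 0.
  transitivity (\tr ((\sum_d v 0 d *: oneill g W d (row_mx x v)) *m
     (\sum_d v 0 d *: oneill g W d (row_mx x v)))).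
    rewrite mulmx_sumr linear_sum /=; apply: eq_bigr => b _.
    rewrite -scalemxAr linearZ /= mulmx_suml linear_sum /= mulr_sumr.
    apply: eq_bigr => c _; rewrite -scalemxAl linearZ /=; congr (_ * (_ * _)).
    have := local_fibre_ricci b c Vz; rewrite row_mxKl row_mxKr; exact.
  have := oneill_radial Vz; rewrite row_mxKr => ->.
  by rewrite mul0mx mxtrace0.
(* The factor (n - 1) t is not zero because n >= 2. *)
move/eqP: E; rewrite E0 eq_sym mulf_eq0 => /orP[|/eqP->//].
rewrite mulf_eq0 (gt_eqF t0) orbF subr_eq0 => /eqP.
by move=> /(@mulrIn R 1 (oner_neq0 _) n 1) n1; move: n2; rewrite n1.
Qed.

Lemma local_betaE t : (exists x, U x) -> 0 < t ->
  beta t = 2 * 'D_1 alpha t + t * 'D_1 alpha t ^+ 2 / alpha t.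
Proof.
move=> Ux t0; apply: ode_solution => // u u0; exact: local_ode.
Qed.

(** A vanishing [oneill_low] says that W(R(X_a, X_b)v, .) = 0. As [W] is nondegenerate and v is an
    arbitrary nonzero vector over [x], the endomorphism R(X_a, X_b) is zero. *)
Lemma local_base_flat x a b : U x -> riem g a b x = 0.
Proof.
move=> Ux.
have bE t : 0 < t -> beta t = 2 * 'D_1 alpha t + t * 'D_1 alpha t ^+ 2 / alpha t.
  by apply: local_betaE; exists x.
suff H v : v != 0 -> v *m riem g a b x = 0.
  apply/row_matrixP => i; rewrite rowE H ?row0 //.
  by apply/eqP => /rowP/(_ i); rewrite !mxE !eqxx => /eqP; rewrite oner_eq0.
move=> v0; have Vz := slit_in Ux v0.
have [_ r0] := Vz; rewrite row_mxKl row_mxKr in r0.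
pose D := [set v : 'rV[R]_n | 0 < sqn (g x) v].
have Wu y : D y -> radial_metric alpha beta (g x) y \in unitmx.
  by move=> Dy; exact: (radial_unit (gs Ux) a_pos phi_pos (gu Ux) Dy).
have WC := Ck_radial (g x) (aC 2) (bC 2).
have low0 d : oneill_low g W d (row_mx x v) = 0.
  have gpx (y : 'rV[R]_n) : y != 0 -> 0 < (y *m g x *m y^T) 0 0 by exact: gp.
  apply: (trace_antisym_eq0 (gs Ux) gpx); first exact: oneill_low_antisym.
  have := local_fibre_ricci d d Vz; rewrite row_mxKl row_mxKr.
  rewrite /oneill row_mxKl -scalemxAl -scalemxAr scalerA linearZ /=.
  have -> : ricci (radial_metric alpha beta (g x)) d d v = 0.
    rewrite /ricci big1 // => c _; rewrite -riem_entry.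
    by rewrite (fibre_flat (gs Ux) (aC 3) a_pos bE _ _ r0 (Wu v r0) Wu WC) mxE.
  move=> /esym/eqP; rewrite mulf_eq0 => /orP[|/eqP //].
  by rewrite mulf_eq0 invr_eq0 orbb pnatr_eq0.
have : row b (curv_vec g a (row_mx x v) *m W (row_mx x v)) = 0.
  apply/rowP => d; rewrite [LHS]mxE [RHS]mxE.
  by have := low0 d => /matrixP/(_ a b); rewrite !mxE.
rewrite row_mul /curv_vec rowK row_mxKl row_mxKr => E.
apply: (can_inj (mulmxK (Wu v r0))); rewrite mul0mx -[RHS]E.
by rewrite /W row_mxKl row_mxKr.
Qed.

Lemma local_total_flat z i j : V z -> riem h i j z = 0.
Proof.
move=> Vz; have [Uz _] := Vz.
apply: (radial_flat oU gs gu gC (aC 3) (bC 2) a_pos phi_pos hE) => //.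
- by move=> t; apply: local_betaE; exists (lsubmx z).
- by move=> x a b; exact: local_base_flat.
Qed.

End LocalTheorem.

(** * Jacobian matrices and the chain rule *)

HB.lock Definition jac (R : realType) (m p : nat) (f : 'rV[R]_m -> 'rV[R]_p)
    (x : 'rV[R]_m) : 'M[R]_(m, p) :=
  \matrix_(a, c) partial (fun y => f y 0 c) a x.

(** The curve need not be a straight line, so directional derivatives of [f] do not suffice: its
    total differential comes from [C1_differentiable]. *)
Lemma curve_chain_scalar (R : realType) (m : nat) (U : set 'rV[R]_m) (c : R -> 'rV[R]_m) (f : 'rV[R]_m -> R) : open U -> U (c 0) ->
  Ck 1 U f -> derivable c 0 1 ->
  derivable (fun s => f (c s)) 0 1 /\ 'D_1 (fun s => f (c s)) 0 = 'D_('D_1 c 0) f (c 0).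
Proof.
move=> oU Uc fC dc.
have dcE : differentiable c 0 by exact/derivable1_diffP.
have [df _] := C1_differentiable fC oU Uc.
have d : derivable (fun s => f (c s)) 0 1.
  apply/derivable1_diffP; exact: (@differentiable_comp _ _ _ _ c f _ dcE df).
split=> //; rewrite deriveE; last exact/derivable1_diffP.
by rewrite (diff_comp (f := c) (g := f) dcE df) /= (deriveE _ df) -(deriveE (f := c)).
Qed.

Section ChainRule.
Context (R : realType) (m p : nat).
Implicit Types (f : 'rV[R]_m -> 'rV[R]_p) (U : set 'rV[R]_m).

Lemma jacE f x a c : jac f x a c = partial (fun y => f y 0 c) a x.
Proof. by rewrite jac.unlock mxE. Qed.

Lemma row_jac f x a : row a (jac f x) = pd a f x.
Proof. by apply/rowP => c; rewrite mxE jacE pdE. Qed.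

Lemma derive_jac f U x v : open U -> U x -> Ck 1 U f -> 'D_v f x = v *m jac f x.
Proof.
move=> oU Ux fC; apply/rowP => c.
rewrite derive_mx; last exact (Ck_derivable fC Ux).
rewrite !mxE; have fcC := Ck_entry 0 c oU fC.
have [df dE] := C1_differentiable fcC oU Ux.
by rewrite deriveE // dE; apply: eq_bigr => a _; rewrite jacE.
Qed.

Lemma curve_chain (c : R -> 'rV[R]_m) f U : open U -> U (c 0) -> Ck 1 U f ->
  derivable c 0 1 -> 'D_1 (fun s => f (c s)) 0 = 'D_('D_1 c 0) f (c 0).
Proof.
move=> oU Uc fC dc.
have dk k := curve_chain_scalar oU Uc (Ck_entry 0 k oU fC) dc.
have df : derivable (fun s => f (c s)) 0 1.
  by apply/derivable_mxP => i k; rewrite ord1; have [] := dk k.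
apply/rowP => k; rewrite derive_mx // mxE derive_mx; last exact (Ck_derivable fC Uc).
by rewrite mxE; have [_] := dk k.
Qed.

Lemma chain_partial f (h : 'rV[R]_p -> R) U (U' : set 'rV[R]_p) x a : open U -> U x -> Ck 1 U f ->
  open U' -> U' (f x) -> Ck 1 U' h ->
  partial (fun y => h (f y)) a x = \sum_c jac f x a c * partial h c (f x).
Proof.
move=> oU Ux fC oU' Ufx hC.
pose c (s : R) := f (s *: delta_mx 0 a + x).
have c0 : c 0 = f x by rewrite /c scale0r add0r.
have dfa : derivable f x (delta_mx 0 a) := Ck_derivable fC Ux.
have dc : derivable c 0 1 by move/derivable1P : dfa.
have U'c : U' (c 0) by rewrite c0.
have [_] := curve_chain_scalar oU' U'c hC dc.
rewrite /c (derive_line (fun y => h (f y))) => dE.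
rewrite /partial dE derive_line scale0r add0r.
have [hd hE] := C1_differentiable hC oU' Ufx.
rewrite (deriveE _ hd) hE; apply: eq_bigr => l _.
by rewrite (derive_jac _ oU Ux fC) -rowE mxE.
Qed.

Lemma Ck_jac f U k : open U -> Ck k.+1 U f -> Ck k U (jac f).
Proof.
move=> oU fC; apply: (Ck_entries oU) => a c.
apply: (Ck_eq oU _ (Ck_partial a (Ck_entry 0 c oU fC))) => x _.
by rewrite jacE.
Qed.

Lemma Ck_line f U (U' : set R) k x v : (forall s, U' s -> U (s *: v + x)) -> Ck k U f ->
  Ck k U' (fun s => f (s *: v + x)).
Proof.
move=> UU; apply: (@Ck_comp_affine R _ _ _ U' U k f (fun s => s *: v + x) (fun s => s *: v)) => //.
- exact: line_continuous.
- by move=> h s t; rewrite scalerDl scalerA addrA.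
Qed.
End ChainRule.

Lemma jac_id (R : realType) m (x : 'rV[R]_m) : jac (fun y => y) x = 1%:M.
Proof. by apply/matrixP => a c; rewrite jacE partial_coord mxE. Qed.

Lemma Ck_row_mx (R : realType) m p q (U : set 'rV[R]_m) k (f : 'rV[R]_m -> 'rV[R]_p) (g : 'rV[R]_m -> 'rV[R]_q) :
  open U -> Ck k U f -> Ck k U g -> Ck k U (fun x => row_mx (f x) (g x)).
Proof.
move=> oU fC gC; apply: (Ck_entries oU) => i j; rewrite ord1.
case: (fintype.splitP j) => l jl.
- have -> : j = lshift q l by exact/val_inj.
  by apply: (Ck_eq oU _ (Ck_entry 0 l oU fC)) => x _; rewrite row_mxEl.
- have -> : j = rshift p l by exact/val_inj.
  by apply: (Ck_eq oU _ (Ck_entry 0 l oU gC)) => x _; rewrite row_mxEr.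
Qed.

Lemma pd_row_mx (R : realType) m p q (f : 'rV[R]_m -> 'rV[R]_p) (g : 'rV[R]_m -> 'rV[R]_q) a x :
  pd a (fun y => row_mx (f y) (g y)) x = row_mx (pd a f x) (pd a g x).
Proof.
apply/rowP => j; rewrite pdE.
case: (fintype.splitP j) => l jl.
- have -> : j = lshift q l by exact/val_inj.
  by rewrite row_mxEl pdE; apply: eq_partial => y; rewrite row_mxEl.
- have -> : j = rshift p l by exact/val_inj.
  by rewrite row_mxEr pdE; apply: eq_partial => y; rewrite row_mxEr.
Qed.

(** * Charts of the tangent bundle *)

(** Formulated apart so that the same lemmas serve for the manifold and, by [tangent_charted], for
    its tangent atlas. *)
Record charted (R : realType) (n : nat) (A : atlas R n) : Prop := Charted {
  charted_inj : forall (i : index A) p q,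
    dom i p -> dom i q -> coord i p = coord i q -> p = q ;
  charted_transition : forall i j : index A,
    smooth_on (coord i @` (dom i `&` dom j)) (chart_rep i (coord j)) }.

Lemma manifold_charted (R : realType) (n : nat) (A : atlas R n) :
  is_manifold A -> charted A.
Proof. by case=> _ inj tr _ _; split. Qed.

(** Injectivity is assumed at [p] only, which lets the lemma be applied to the tangent atlas on the
    way to [tangent_charted]. *)
Lemma chart_rep_inj (R : realType) (n : nat) (A : atlas R n) (W : pointedType) (i : index A)
    (f : A -> W) p :
  (forall q, dom i q -> dom i p -> coord i q = coord i p -> q = p) ->
  dom i p -> chart_rep i f (coord i p) = f p.
Proof.
move=> inj ip; rewrite /chart_rep.
have := @getPex W [set w | exists q, [/\ dom i q, coord i q = coord i p & f q = w]].
case; first by exists (f p), p.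
by move=> q [iq qp <-]; rewrite (inj q iq ip qp).
Qed.

Section Charts.
Context (R : realType) (n : nat) (A : atlas R n) (chA : charted A).
Implicit Types (i j k : index A) (p q : A) (t : tangent A) (w v : 'rV[R]_n).

Definition overlap i j : set 'rV[R]_n := coord i @` (dom i `&` dom j).
Definition transition i j : 'rV[R]_n -> 'rV[R]_n := chart_rep i (coord j).

Lemma chart_repE (W : pointedType) i (f : A -> W) p : dom i p ->
  chart_rep i f (coord i p) = f p.
Proof. by move=> ip; apply: chart_rep_inj ip => q; exact: charted_inj. Qed.

Lemma overlap_open i j : open (overlap i j).
Proof. by have [] := charted_transition chA i j. Qed.

Lemma chart_open i : open (coord i @` dom i).
Proof. by have := @overlap_open i i; rewrite /overlap setIid. Qed.

Lemma transition_Ck i j (k : nat) : Ck k (overlap i j) (transition i j).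
Proof. by have [_] := charted_transition chA i j; apply. Qed.

Lemma overlap_coord i j p : dom i p -> dom j p -> overlap i j (coord i p).
Proof. by move=> ip jp; exists p. Qed.

Lemma overlap_dom i j p : dom i p -> overlap i j (coord i p) -> dom j p.
Proof. by move=> ip [q [iq jq] /(charted_inj chA iq ip) <-]. Qed.

Lemma transitionE i j p : dom i p -> transition i j (coord i p) = coord j p.
Proof. exact: chart_repE. Qed.

Lemma transition_jac i j p w : dom i p -> dom j p ->
  'D_w (transition i j) (coord i p) = w *m jac (transition i j) (coord i p).
Proof.
by move=> ip jp; apply: derive_jac (@overlap_open i j) (overlap_coord ip jp) (transition_Ck i j 1).
Qed.

Lemma tvec_jac t i j : dom i (tpt t) -> dom j (tpt t) ->
  tvec t j = tvec t i *m jac (transition i j) (coord i (tpt t)).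
Proof. by move=> it jt; rewrite (tvec_compat it jt) -transition_jac. Qed.

Lemma transition_id i p : dom i p -> jac (transition i i) (coord i p) = 1%:M.
Proof.
move=> ip; rewrite -(jac_id (coord i p)); apply/matrixP => a c; rewrite !jacE.
apply: (derive_open _ (@overlap_open i i) _ (overlap_coord ip ip)) => y [q [iq _] <-].
by rewrite transitionE.
Qed.

(** The chain rule for the cocycle identity; it provides the field [tvec_compat] of the vectors
    built in [tangent_exists]. *)
Lemma transition_comp i j k p w : dom i p -> dom j p -> dom k p ->
  'D_w (transition i k) (coord i p) =
  'D_('D_w (transition i j) (coord i p)) (transition j k) (coord j p).
Proof.
move=> ip jp kp.
have Oij := @overlap_open i j; have Ojk := @overlap_open j k.
pose c (s : R) := transition i j (s *: w + coord i p).
have c0 : c 0 = coord j p by rewrite /c scale0r add0r transitionE.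
have oij := overlap_coord ip jp; have ojk := overlap_coord jp kp.
have dij := Ck_derivable (transition_Ck i j 1) oij.
have dc : derivable c 0 1.
  have := is_derive_line (t := 0) (f := transition i j) (x := coord i p) (v := w).
  by rewrite scale0r add0r => /(_ (dij w)) [].
have := curve_chain (c := c) Ojk _ (transition_Ck j k 1) dc.
rewrite c0 derive_line => /(_ ojk) <-.
rewrite -(derive_line (transition i k)).
(* The cocycle identity holds only where the line meets the common domain of the three charts, that
   is, for small parameters. *)
apply: near_eq_derive.
have cc : {for (0 : R), continuous c}.
  by apply: differentiable_continuous; apply/derivable1_diffP.
have lc := @line_continuous R _ (coord i p) w 0.
have N1 : \forall s \near (0 : R), overlap i j (s *: w + coord i p).
  by apply: lc; rewrite scale0r add0r; exact: open_nbhs_nbhs.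
have N2 : \forall s \near (0 : R), overlap j k (c s).
  by apply: cc; rewrite c0; exact: open_nbhs_nbhs.
near=> s.
have [q [iq jq] qE] : overlap i j (s *: w + coord i p) by near: s.
have : overlap j k (c s) by near: s.
rewrite /c -qE transitionE // => /(overlap_dom jq) kq.
by rewrite !transitionE.
Unshelve. all: by end_near. Qed.

(** The components in the other charts are the images of [w] under the derivatives of the
    transitions, and 0 away from their domains, as [tvec_out] prescribes. *)
Lemma tangent_exists i p w : dom i p -> exists t, tpt t = p /\ tvec t i = w.
Proof.
move=> ip.
pose tv j : 'rV[R]_n := if pselect (dom j p) then 'D_w (transition i j) (coord i p) else 0.
have tvE j : dom j p -> tv j = 'D_w (transition i j) (coord i p).
  by rewrite /tv; case: pselect.
have tv_compat j k : dom j p -> dom k p -> tv k = 'D_(tv j) (chart_rep j (coord k)) (coord j p).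
  by move=> jp kp; rewrite (tvE j jp) (tvE k kp); exact (transition_comp w ip jp kp).
have tv_out j : ~ dom j p -> tv j = 0 by rewrite /tv; case: pselect.
exists (Tangent tv_compat tv_out); split => //=.
by rewrite tvE // transition_jac // transition_id // mulmx1.
Qed.

Lemma tangent_ext i t t' : dom i (tpt t) -> tpt t' = tpt t -> tvec t' i = tvec t i -> t' = t.
Proof.
case: t => p tv tc to /= ip.
case: t' => p' tv' tc' to' /= pE vE; subst p'.
have tvE : tv' = tv.
  apply/funext => j; have [jp|nj] := pselect (dom j p); last by rewrite to // to'.
  transitivity ('D_(tv' i) (chart_rep i (coord j)) (coord i p)); first exact (tc' i j ip jp).
  rewrite vE; symmetry; exact (tc i j ip jp).
subst tv'; congr Tangent; exact: Prop_irrelevance.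
Qed.

(* The straight line in one chart. *)
Lemma curve_exists (w : tangent A) : (exists i, dom i (tpt w)) ->
  exists c : R -> A, smooth_curve c /\ velocity0 c w.
Proof.
move=> [i ip]; set p := tpt w in ip.
pose l (s : R) : 'rV[R]_n := s *: tvec w i + coord i p.
have cP s : exists q, (coord i @` dom i) (l s) -> dom i q /\ coord i q = l s.
  have [[q iq qE]|no] := pselect ((coord i @` dom i) (l s)); first by exists q.
  by exists p.
have [c cE] := choice cP.
have l0 : l 0 = coord i p by rewrite /l scale0r add0r.
have c0 : c 0 = p.
  have [] := cE 0; first by rewrite l0; exists p.
  by rewrite l0 => ic /(charted_inj chA ic ip).
have cj j s : overlap i j (l s) -> [/\ dom i (c s), dom j (c s) & coord j (c s) = transition i j (l s)].
  move=> [q [iq jq] qE].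
  have [ic cl] : dom i (c s) /\ coord i (c s) = l s by apply: cE; exists q.
  have cq : c s = q by apply: (charted_inj chA ic iq); rewrite cl.
  by rewrite cq -qE transitionE.
have oU j : open [set s | overlap i j (l s)].
  by apply: open_comp (@overlap_open i j) => s _; exact: line_continuous.
exists c; split.
  move=> j; rewrite c0 => jp; exists [set s | overlap i j (l s)]; split.
  - by rewrite /= l0; exact: overlap_coord.
  - by move=> s /cj[].
  - split => // k; apply: (Ck_eq (oU j) _ (Ck_line (U := overlap i j) _ (transition_Ck i j k))).
      by move=> s /cj[_ _ E]; exact (esym E).
    by [].
split; first by rewrite c0.
move=> j; rewrite c0 => jp.
rewrite derive1E (derive_open (U := [set s | overlap i j (l s)]) (g := fun s => transition i j (l s))) //.
- by rewrite derive_line; exact: tvec_compat.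
- by move=> s /cj[_ _ <-].
- by rewrite /= l0; exact: overlap_coord.
Qed.

End Charts.

Section TangentCharts.
Context (R : realType) (n : nat) (M : atlas R n) (chM : charted M).
Let TM := tangent_atlas M.
Implicit Types (i j : index M) (z : 'rV[R]_(n + n)) (V : TM).

Definition tangent_transition i j z : 'rV[R]_(n + n) :=
  row_mx (transition i j (lsubmx z)) (rsubmx z *m jac (transition i j) (lsubmx z)).

Lemma tangent_overlapE i j :
  overlap (i : index TM) (j : index TM) = [set z | overlap i j (lsubmx z)].
Proof.
apply/seteqP; split => z /=.
  by move=> [V [iV jV] <-] /=; rewrite row_mxKl; exact: overlap_coord.
move=> [p [ip jp] pE].
have [V [Vp Vv]] := tangent_exists chM (rsubmx z) ip.
exists V; first by split; rewrite /= Vp.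
by rewrite /= Vp Vv pE hsubmxK.
Qed.

Lemma tangent_inj (i : index TM) V V' : dom i V -> dom i V' -> coord i V = coord i V' -> V = V'.
Proof.
move=> /= iV iV' E; have [E1 E2] := eq_row_mx E.
exact (@tangent_ext _ _ M i V' V iV' (charted_inj chM iV iV' E1) E2).
Qed.

Lemma tangent_transitionE i j z : overlap (i : index TM) (j : index TM) z ->
  transition (i : index TM) (j : index TM) z = tangent_transition i j z.
Proof.
move=> [V [iV jV] <-]; rewrite /transition chart_rep_inj //; last first.
  by move=> V' iV' _; exact: tangent_inj.
by rewrite /tangent_transition row_mxKl row_mxKr /= (transitionE chM) // -tvec_jac.
Qed.

Lemma tangent_overlap_open i j : open (overlap (i : index TM) (j : index TM)).
Proof.
rewrite tangent_overlapE; apply: open_comp (@overlap_open _ _ _ chM i j) => z _.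
exact: lsubmx_continuous.
Qed.

Lemma Ck_tangent_transition i j k :
  Ck k (overlap (i : index TM) (j : index TM)) (tangent_transition i j).
Proof.
have oO := @overlap_open _ _ _ chM i j.
have oT := @tangent_overlap_open i j.
have sub z : overlap (i : index TM) (j : index TM) z -> overlap i j (lsubmx z).
  by rewrite tangent_overlapE.
apply: (Ck_row_mx oT); first exact: Ck_lsub sub (transition_Ck chM i j k).
apply: (Ck_mulmx oT); first exact: Ck_rsubmx.
exact: Ck_lsub sub (Ck_jac oO (transition_Ck chM i j k.+1)).
Qed.

Lemma tangent_charted : charted TM.
Proof.
split; first exact: tangent_inj.
move=> i j; split; first exact: tangent_overlap_open.
move=> k; apply: (Ck_eq (@tangent_overlap_open i j) _ (Ck_tangent_transition i j k)) => z zO.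
exact (esym (tangent_transitionE zO)).
Qed.

(* The second component is the velocity of a vector field along a curve; the
   term with the second derivatives of the transition is what the Christoffel
   symbols compensate. *)
Lemma tangent_transition_derive i j z zeta : overlap (i : index TM) (j : index TM) z ->
  'D_zeta (tangent_transition i j) z =
  row_mx (lsubmx zeta *m jac (transition i j) (lsubmx z))
    (rsubmx zeta *m jac (transition i j) (lsubmx z)
     + rsubmx z *m \sum_a lsubmx zeta 0 a *: pd a (jac (transition i j)) (lsubmx z)).
Proof.
move=> zO.
have oO := @overlap_open _ _ _ chM i j.
have oT := @tangent_overlap_open i j.
have xO : overlap i j (lsubmx z) by move: zO; rewrite tangent_overlapE.
have sub y : overlap (i : index TM) (j : index TM) y -> overlap i j (lsubmx y).
  by rewrite tangent_overlapE.
have jC : Ck 1 (overlap (i : index TM) (j : index TM)) (fun z => jac (transition i j) (lsubmx z)).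
  exact: Ck_lsub sub (Ck_jac oO (transition_Ck chM i j 2)).
rewrite (derive_jac zeta oT zO (Ck_tangent_transition i j 1)) mulmx_sum_row big_split_ord /=.
have El a : row (lshift n a) (jac (tangent_transition i j) z) =
    row_mx (row a (jac (transition i j) (lsubmx z)))
      (rsubmx z *m pd a (jac (transition i j)) (lsubmx z)).
  rewrite row_jac pd_row_mx pd_lsub_l -row_jac (pdM _ oT zO (Ck_rsubmx 1 _) jC).
  by rewrite pd_rsubmx_l mul0mx add0r pd_lsub_l.
have Er a : row (rshift n a) (jac (tangent_transition i j) z) =
    row_mx 0 (row a (jac (transition i j) (lsubmx z))).
  rewrite row_jac pd_row_mx pd_lsub_r (pdM _ oT zO (Ck_rsubmx 1 _) jC).
  by rewrite pd_rsubmx_r pd_lsub_r mulmx0 addr0 -rowE.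
rewrite (eq_bigr (fun a => lsubmx zeta 0 a *: row_mx (row a (jac (transition i j) (lsubmx z)))
      (rsubmx z *m pd a (jac (transition i j)) (lsubmx z)))); last by move=> a _; rewrite El mxE.
rewrite [X in _ + X](eq_bigr (fun a => rsubmx zeta 0 a *: row_mx 0 (row a (jac (transition i j) (lsubmx z)))));
  last by move=> a _; rewrite Er mxE.
rewrite (mulmx_sum_row (lsubmx zeta)) (mulmx_sum_row (rsubmx zeta)) mulmx_sumr.
rewrite -[LHS]hsubmxK linearD /= [rsubmx (_ + _)]linearD /= !raddf_sum /=.
congr row_mx.
  rewrite [X in _ + X]big1 ?addr0; last by move=> a _; rewrite linearZ /= row_mxKl scaler0.
  by apply: eq_bigr => a _; rewrite linearZ /= row_mxKl.
rewrite addrC; congr (_ + _).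
  by apply: eq_bigr => a _; rewrite linearZ /= row_mxKr.
by apply: eq_bigr => a _; rewrite linearZ /= row_mxKr scalemxAr.
Qed.

End TangentCharts.

(** * Metric and Christoffel symbols in overlapping charts *)

Section LocalMetric.
Context (R : realType) (n : nat) (A : atlas R n) (chA : charted A) (g : metric A).
Implicit Types (i j : index A) (p : A) (x : 'rV[R]_n).

Lemma local_metricE i p : dom i p -> local_metric g i (coord i p) = mcoef g i p.
Proof. exact: chart_repE. Qed.

Lemma local_metric_sym i x : (coord i @` dom i) x -> (local_metric g i x)^T = local_metric g i x.
Proof. by move=> [p ip <-]; rewrite local_metricE // mcoef_sym. Qed.

Lemma local_metric_pos i x (v : 'rV[R]_n) : (coord i @` dom i) x -> v != 0 ->
  0 < (v *m local_metric g i x *m v^T) 0 0.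
Proof. by move=> [p ip <-] v0; rewrite local_metricE // mcoef_pos. Qed.

Lemma local_metric_unit i x : (coord i @` dom i) x -> local_metric g i x \in unitmx.
Proof. by move=> xi; apply: posdef_unit => v; exact: local_metric_pos. Qed.

Lemma local_metric_Ck i k : Ck k (coord i @` dom i) (local_metric g i).
Proof. by have [_] := mcoef_smooth g i; apply. Qed.

Lemma overlap_sub i j x : overlap i j x -> (coord i @` dom i) x.
Proof. by move=> [p [ip _] <-]; exists p. Qed.

Lemma overlap_target i j x : overlap i j x -> (coord j @` dom j) (transition i j x).
Proof. by move=> [p [ip jp] <-]; rewrite transitionE //; exists p. Qed.

(** The intrinsic [mval] of two tangent vectors with coordinate components in chart [i] is computed
    in both charts. *)
Lemma local_metric_transition i j x : overlap i j x ->
  local_metric g i x =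
  jac (transition i j) x *m local_metric g j (transition i j x) *m (jac (transition i j) x)^T.
Proof.
move=> [p [ip jp] <-]; rewrite transitionE // !local_metricE //.
set J := jac _ _; apply/matrixP => a b.
have [ta [tap tav]] := tangent_exists chA (delta_mx 0 a) ip.
have [tb [tbp tbv]] := tangent_exists chA (delta_mx 0 b) ip.
have E (K : 'M[R]_n) : ((delta_mx 0 a : 'rV[R]_n) *m K *m (delta_mx 0 b : 'rV[R]_n)^T) 0 0 = K a b.
  by rewrite -rowE trmx_delta -colE !mxE.
have tab : tpt tb = tpt ta by rewrite tap.
have ia : dom i (tpt ta) by rewrite tap.
have ja : dom j (tpt ta) by rewrite tap.
have := mvalE g ia tab; rewrite (mvalE g ja tab) tap tav tbv E => <-.
rewrite (tvec_jac chA ia ja) (tvec_jac (t := tb) (i := i) (j := j) chA) ?tbp //.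
by rewrite tap tav tbv -[RHS]E trmx_mul !mulmxA.
Qed.

Lemma transition_jac_unit i j x : overlap i j x -> jac (transition i j) x \in unitmx.
Proof.
move=> xO; have := local_metric_unit (overlap_sub xO).
by rewrite (local_metric_transition xO) !unitmx_mul => /andP[/andP[]].
Qed.

(** The connection matrices of chart [j], pulled back by the change of charts. *)
Definition transition_conn i j a x : 'M[R]_n :=
  \sum_c jac (transition i j) x a c *: chris (local_metric g j) c (transition i j x).

(** The Jacobian is a coframe of chart [i] with values in the coordinates of chart [j]. Torsion
    vanishes by the symmetry of the second derivatives of the transition together with that of the
    Christoffel symbols of chart [j]. *)
Lemma transition_frame i j : lc_frame (overlap i j) (local_metric g i) (jac (transition i j))
  (fun x => local_metric g j (transition i j x)) (transition_conn i j).
Proof.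
have oO := @overlap_open _ _ _ chA i j.
have oj := @chart_open _ _ _ chA j.
have jC k : Ck k (overlap i j) (jac (transition i j)) := Ck_jac oO (transition_Ck chA i j k.+1).
split.
- exact: oO.
- by move=> x xO; exact: local_metric_unit (overlap_sub xO).
- exact: jC.
(* Solving the transformation law for the composite metric reduces its regularity to that of the
   metric in chart [i] and of the Jacobian. *)
- have jiC := Ck_invmx oO (@transition_jac_unit i j) (jC 1).
  have gC : Ck 1 (overlap i j) (local_metric g i).
    exact: CkW (@overlap_sub i j) (local_metric_Ck i 1).
  apply: (Ck_eq oO _ (Ck_mulmx oO (Ck_mulmx oO jiC gC) (Ck_trmx oO jiC))) => x xO.
  have Ju := transition_jac_unit xO.
  rewrite (local_metric_transition xO) -!mulmxA -trmx_mul mulVmx // trmx1 mulmx1.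
  by rewrite mulmxA mulVmx // mul1mx.
- by move=> x xO; exact: local_metric_sym (overlap_target xO).
- exact: local_metric_transition.
- move=> x a xO; have yj := overlap_target xO; set y := transition i j x in yj.
  have gC := local_metric_Ck j 1.
  have -> : pd a (fun x => local_metric g j (transition i j x)) x =
      \sum_c jac (transition i j) x a c *: pd c (local_metric g j) y.
    apply/matrixP => r s; rewrite pdE summxE.
    rewrite (chain_partial a oO xO (transition_Ck chA i j 1) oj yj (Ck_entry r s oj gC)).
    by apply: eq_bigr => c _; rewrite mxE pdE.
  rewrite /transition_conn mulmx_suml linear_sum /= mulmx_sumr -big_split /=.
  apply: eq_bigr => c _.
  rewrite (chris_metric c oj yj (@local_metric_sym j) (local_metric_unit yj)).
  by rewrite scalerDr -scalemxAl linearZ /= -scalemxAr.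
- move=> x a b xO; have yj := overlap_target xO; set y := transition i j x in yj.
  have tC c := Ck_entry 0 c oO (transition_Ck chA i j 2).
  rewrite !linearD /=; congr (_ + _).
    apply/rowP => c; rewrite [LHS]mxE [RHS]mxE !pdE.
    have P r s : partial (fun y => jac (transition i j) y s c) r x =
        partial (partial (fun y => transition i j y 0 c) s) r x.
      by apply: eq_partial => u; rewrite jacE.
    rewrite !P; exact: schwarz oO xO (tC c).
  rewrite !row_mul /transition_conn !mulmx_sumr.
  transitivity (\sum_c \sum_d jac (transition i j) x a c *:
     (jac (transition i j) x b d *: row d (chris (local_metric g j) c y))).
    apply: eq_bigr => c _; rewrite -scalemxAr mulmx_sum_row scaler_sumr.
    by apply: eq_bigr => d _; rewrite mxE.
  rewrite exchange_big /=; apply: eq_bigr => d _; rewrite -scalemxAr mulmx_sum_row scaler_sumr.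
  apply: eq_bigr => c _; rewrite mxE !scalerA mulrC; congr (_ *: _).
  by apply/rowP => e; rewrite [LHS]mxE [RHS]mxE (chris_sym oj yj (@local_metric_sym j)).
Qed.

(** The classical inhomogeneous transformation law, as an instance of [frame_christoffel]. *)
Lemma chris_transition i j a x : overlap i j x ->
  chris (local_metric g i) a x *m jac (transition i j) x =
  pd a (jac (transition i j)) x + jac (transition i j) x *m transition_conn i j a x.
Proof. by move=> xO; exact (frame_christoffel (transition_frame i j) a xO). Qed.

End LocalMetric.

(** * The connection map in charts *)

Section Connection.
Context (R : realType) (n : nat) (M : atlas R n) (chM : charted M) (g : metric M).
Let TM := tangent_atlas M.
Implicit Types (i j : index M) (w : tangent TM) (u : tangent M).

(* The local expression of the connection map. *)
Definition vert_part i w : 'rV[R]_n :=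
  rsubmx (tvec w i) + lsubmx (tvec w i) *m
    hor_mx (local_metric g i) (coord (i : index TM) (tpt w)).

Lemma mul_hor_mx (h : 'rV[R]_n -> 'M[R]_n) (xi : 'rV[R]_n) z :
  xi *m hor_mx h z = rsubmx z *m \sum_a xi 0 a *: chris h a (lsubmx z).
Proof.
rewrite mulmx_sum_row mulmx_sumr; apply: eq_bigr => a _.
by rewrite row_hor_mx scalemxAr.
Qed.

Lemma tangent_tvec_change i j w : dom i (tpt (tpt w)) -> dom j (tpt (tpt w)) ->
  tvec w j = 'D_(tvec w i) (tangent_transition i j) (coord (i : index TM) (tpt w)).
Proof.
move=> iw jw; have chT := tangent_charted chM.
have oT := @overlap_open _ _ _ chT i j.
have zO : overlap (i : index TM) (j : index TM) (coord (i : index TM) (tpt w)) by exists (tpt w).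
rewrite (tvec_compat (t := w) (i := i) (j := j)) //.
by apply: derive_open oT _ zO => z; exact: tangent_transitionE.
Qed.

Lemma hor_part_change i j w : dom i (tpt (tpt w)) -> dom j (tpt (tpt w)) ->
  lsubmx (tvec w j) = lsubmx (tvec w i) *m jac (transition i j) (coord i (tpt (tpt w))).
Proof.
move=> iw jw; have zO : overlap (i : index TM) (j : index TM) (coord (i : index TM) (tpt w)).
  by exists (tpt w).
rewrite (tangent_tvec_change iw jw) (tangent_transition_derive chM _ zO) row_mxKl.
by rewrite /= row_mxKl.
Qed.

(** The second derivatives of the transition, which occur in the change of charts of the tangent
    bundle, cancel against the inhomogeneous term of [chris_transition]; hence [vert_part] changes
    like a tangent vector. *)
Lemma vert_part_change i j w : dom i (tpt (tpt w)) -> dom j (tpt (tpt w)) ->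
  vert_part j w = vert_part i w *m jac (transition i j) (coord i (tpt (tpt w))).
Proof.
move=> iw jw; have zO : overlap (i : index TM) (j : index TM) (coord (i : index TM) (tpt w)).
  by exists (tpt w).
rewrite /vert_part mulmxDl [in LHS]mul_hor_mx (hor_part_change iw jw) mul_hor_mx.
rewrite (tangent_tvec_change iw jw) (tangent_transition_derive chM _ zO) row_mxKr /=.
rewrite !row_mxKl !row_mxKr.
set x := coord i _; set v := tvec (tpt w) i.
have xO : overlap i j x := overlap_coord iw jw.
rewrite -addrA; congr (_ + _).
rewrite (tvec_jac chM iw jw) -/x -/v -!mulmxA -mulmxDr; congr (_ *m _).
rewrite -(transitionE chM j iw) -/x.
rewrite mulmx_suml mulmx_sumr.
have -> : \sum_a lsubmx (tvec w i) 0 a *: chris (local_metric g i) a x *m jac (transition i j) x =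
    \sum_a lsubmx (tvec w i) 0 a *: pd a (jac (transition i j)) x +
    \sum_a lsubmx (tvec w i) 0 a *: (jac (transition i j) x *m transition_conn g i j a x).
  rewrite -big_split; apply: eq_bigr => a _ /=.
  by rewrite -scalemxAl (chris_transition chM) // scalerDr.
congr (_ + _).
transitivity (\sum_c \sum_a (lsubmx (tvec w i) 0 a * jac (transition i j) x a c) *:
    (jac (transition i j) x *m chris (local_metric g j) c (transition i j x))).
  by apply: eq_bigr => c _; rewrite -scalemxAr mxE scaler_suml.
rewrite exchange_big; apply: eq_bigr => a _ /=.
rewrite /transition_conn mulmx_sumr scaler_sumr; apply: eq_bigr => c _.
by rewrite -scalemxAr scalerA.
Qed.

(** The covariant derivative sees [Y] only through its velocity, whose two blocks are the
    derivatives of the base point and of the components. *)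
Lemma covariant_derivativeP (Y : R -> TM) w u : smooth_curve Y -> velocity0 Y w ->
  tpt u = tpt (tpt w) ->
  (forall i, dom i (tpt (tpt w)) -> tvec u i = vert_part i w) ->
  covariant_derivative0 g Y u.
Proof.
move=> sY [wY wv] uw uv; split; first by rewrite uw wY.
move=> i; rewrite -wY => iw c; rewrite (uv i iw).
have iY : dom (i : index TM) (Y 0) by rewrite /= -wY.
have [U [U0 UY [oU YC]]] := sY i iY.
have dY : derivable (fun s => coord (i : index TM) (Y s)) (0 : R) 1.
  exact (Ck_derivable (YC 1) U0).
have wE k : tvec w i 0 k = derive1 (fun s => coord (i : index TM) (Y s) 0 k) 0.
  by rewrite (wv i iY) !derive1E (derive_mx dY) mxE.
have -> : derive1 (fun s => tvec (Y s) i 0 c) 0 = rsubmx (tvec w i) 0 c.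
  rewrite mxE wE; congr (derive1 _ 0); apply/funext => s.
  by rewrite /= row_mxEr.
rewrite /vert_part mul_hor_mx mxE; congr (_ + _).
rewrite mulmx_sumr summxE; apply: eq_bigr => a _.
have -> : derive1 (fun s => coord i (tpt (Y s)) 0 a) 0 = lsubmx (tvec w i) 0 a.
  rewrite mxE wE; congr (derive1 _ 0); apply/funext => s.
  by rewrite /= row_mxEl.
rewrite -scalemxAr [LHS]mxE [X in _ * X = _]mxE mulr_sumr; apply: eq_bigr => b _.
by rewrite /= row_mxKl row_mxKr chrisE; ring.
Qed.

(** One chart is enough, since both sides change in the same way; any curve with velocity [w] serves
    as witness. *)
Lemma connection_mapP i w u : dom i (tpt (tpt w)) -> tpt u = tpt (tpt w) ->
  tvec u i = vert_part i w -> connection_map g w u.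
Proof.
move=> iw uw uv; have chT := tangent_charted chM.
have [Y [sY vY]] : exists Y : R -> TM, smooth_curve Y /\ velocity0 Y w.
  by apply: (curve_exists chT); exists i.
exists Y; split => //; apply: (covariant_derivativeP sY vY uw) => j jw.
by rewrite (vert_part_change iw jw) -uv -uw; apply: tvec_jac => //; rewrite uw.
Qed.

Lemma tmap_tprojP i w u : dom i (tpt (tpt w)) -> tpt u = tpt (tpt w) ->
  tvec u i = lsubmx (tvec w i) -> tmap (@tproj R n M) w u.
Proof.
move=> iw uw uv; split; first exact: uw.
move=> k j kw; rewrite uw => jw; have chT := tangent_charted chM.
have kw' : dom (k : index M) (tpt (tpt w)) := kw.
have -> : 'D_(tvec w k) (chart_rep k (coord j \o @tproj R n M)) (coord (k : index TM) (tpt w)) =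
    'D_(tvec w k) (fun z => transition (k : index M) j (lsubmx z)) (coord (k : index TM) (tpt w)).
  apply: derive_open (@overlap_open _ _ _ chT k (j : index TM)) _ _; last by exists (tpt w).
  by move=> z [V [kV jV] <-]; rewrite (chart_repE chT) //= row_mxKl (transitionE chM).
rewrite derive_lsubmx /= row_mxKl (transition_jac chM) // -(hor_part_change kw' jw).
rewrite (hor_part_change iw jw) -uv -uw; apply: tvec_jac => //; by rewrite uw.
Qed.

Lemma tzero_exists p : (exists i, dom i p) -> exists u, tpt u = p /\ is_tzero u.
Proof.
move=> [i ip]; have [u [up uv]] := tangent_exists chM 0 ip.
exists u; split => // j; have [ju|nj] := pselect (dom j (tpt u)); last exact: tvec_out.
have iu : dom i (tpt u) by rewrite up.
by rewrite (tvec_jac chM iu ju) uv mul0mx.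
Qed.

End Connection.

Lemma row_form (R : realType) (m n : nat) (B : 'M[R]_(m, n)) (K : 'M[R]_n) a b :
  (row a B *m K *m (row b B)^T) 0 0 = (B *m K *m B^T) a b.
Proof. by rewrite -row_mul !mxE; apply: eq_bigr => c _; rewrite !mxE. Qed.

(** * The matrix of the natural metric in a chart *)

Section NaturalMetric.
Context (R : realType) (n : nat) (M : atlas R n) (chM : charted M) (g : metric M).
Variables (G : metric (tangent_atlas M)) (alpha beta : R -> R).
Hypothesis charG : characterized_by g G alpha beta.
Let TM := tangent_atlas M.
Let chT := tangent_charted chM.
Implicit Types (i : index M).

(** Components of an adapted basis when the rows of [B] are those of the u_a: the horizontal lifts
    are (u_a, - u_a N) and the vertical vectors are (0, u_a). *)
Definition adapted_mx (B N : 'M[R]_n) : 'M[R]_(n + n) := block_mx B (- (B *m N)) 0 B.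

(** The condition on [B] makes its rows an orthonormal basis, and [tvec V i *m invmx B] are the
    coordinates xi of [V] in it. Each vector is given by its components in the chart [i], and the
    conditions on curves and differentials are then checked in this chart. *)
Lemma adapted_basis_exists i (V : TM) (B : 'M[R]_n) : dom i (tpt V) ->
  B *m mcoef g i (tpt V) *m B^T = 1%:M ->
  exists (u : 'I_n -> tangent M) (e : 'I_(n + n) -> tangent TM),
    adapted_basis g (tpt V) u (tvec V i *m invmx B) V e /\
    forall k, tvec (e k) i =
      row k (adapted_mx B (hor_mx (local_metric g i) (coord (i : index TM) V))).
Proof.
move=> iV BE; set q := tpt V in iV BE *; set N := hor_mx _ _.
have Bu : B \in unitmx.
  by have := (mulmx1_unit BE).1; rewrite unitmx_mul => /andP[].
have uP (a : 'I_n) : exists t : tangent M, tpt t = q /\ tvec t i = row a B := tangent_exists chM _ iV.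
have [u uE] := choice uP.
have eP (k : 'I_(n + n)) : exists t : tangent TM, tpt t = V /\ tvec t i = row k (adapted_mx B N).
  exact: (@tangent_exists R _ TM chT i V).
have [e eE] := choice eP.
have e_l a : tvec (e (lshift n a)) i = row_mx (row a B) (- (row a B *m N)).
  by rewrite (eE _).2 /adapted_mx rowKu row_row_mx raddfN /= row_mul.
have e_r a : tvec (e (rshift n a)) i = row_mx 0 (row a B).
  by rewrite (eE _).2 /adapted_mx rowKd row_row_mx row0.
have ept k : tpt (e k) = V := (eE k).1.
have iee k : dom i (tpt (tpt (e k))) by rewrite ept.
exists u, e; split; last by move=> k; exact: (eE k).2.
split.
- split=> [a|a b]; first exact: (uE a).1.
  have ab : tpt (u b) = tpt (u a) by rewrite !(uE _).1.
  have ia : dom i (tpt (u a)) by rewrite (uE a).1.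
  rewrite (mvalE g ia ab) !(uE _).1 !(uE _).2.
  have -> : (a == b)%:R = (B *m mcoef g i q *m B^T) a b by rewrite BE mxE.
  by rewrite row_form.
- by [].
- move=> j; have [jV|nj] := pselect (dom j q); last first.
    rewrite (tvec_out (t := V)) // big1 // => a _.
    by rewrite (tvec_out (t := u a)) ?scaler0 // (uE a).1.
  rewrite (tvec_jac chM iV jV) -{1}(mulmxKV Bu (tvec V i)) (mulmx_sum_row _ B) mulmx_suml.
  apply: eq_bigr => a _; rewrite -scalemxAl.
  have iu : dom i (tpt (u a)) by rewrite (uE a).1.
  have ju : dom j (tpt (u a)) by rewrite (uE a).1.
  by rewrite (tvec_jac chM iu ju) (uE a).1 (uE a).2.
- exact: ept.
- move=> a; have w1 : tpt (u a) = tpt (tpt (e (lshift n a))) by rewrite ept (uE a).1.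
  split; first by apply: (tmap_tprojP chM (iee _) w1); rewrite e_l row_mxKl (uE a).2.
  have [z [zq z0]] := tzero_exists chM (p := q) (ex_intro _ i iV).
  exists z => //; apply: (connection_mapP chM (iee (lshift n a))); first by rewrite ept zq.
  by rewrite z0 /vert_part e_l row_mxKl row_mxKr ept addNr.
- move=> a; have w1 : tpt (u a) = tpt (tpt (e (rshift n a))) by rewrite ept (uE a).1.
  split; last first.
    apply: (connection_mapP chM (iee _) w1).
    by rewrite (uE a).2 /vert_part e_r row_mxKl row_mxKr mul0mx addr0.
  have [z [zq z0]] := tzero_exists chM (p := q) (ex_intro _ i iV).
  exists z => //; apply: (tmap_tprojP chM (iee (rshift n a))); first by rewrite ept zq.
  by rewrite z0 e_r row_mxKl.
Qed.

Lemma natural_metric_matrix i (V : TM) (B : 'M[R]_n) : dom i (tpt V) ->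
  B *m mcoef g i (tpt V) *m B^T = 1%:M ->
  let xi := tvec V i *m invmx B in
  let r := \sum_a xi 0 a ^+ 2 in
  let E := adapted_mx B (hor_mx (local_metric g i) (coord (i : index TM) V)) in
  E *m mcoef G i V *m E^T =
  block_mx 1%:M 0 0 (alpha r *: 1%:M + beta r *: (xi^T *m xi)).
Proof.
move=> iV BE xi r E.
have [u [e [ad eE]]] := adapted_basis_exists iV BE.
have GE k l : (E *m mcoef G i V *m E^T) k l = G (e k) (e l).
  have kl : tpt (e l) = tpt (e k) by rewrite !(adapted_e ad).
  have ik : dom (i : index TM) (tpt (e k)) by rewrite (adapted_e ad).
  rewrite (mvalE G ik kl) !eE (adapted_e ad).
  by rewrite row_form.
have Gs : (E *m mcoef G i V *m E^T)^T = E *m mcoef G i V *m E^T.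
  by rewrite !trmx_mul trmxK mcoef_sym ?mulmxA.
have cm := char_matrix charG ad; rewrite /= -/xi -/r in cm.
apply/matrixP => k l.
case: (fintype.splitP k) => a ka; [have {ka} -> : k = lshift n a by exact/val_inj
  |have {ka} -> : k = rshift n a by exact/val_inj];
case: (fintype.splitP l) => b lb; [have {lb} -> : l = lshift n b by exact/val_inj
  |have {lb} -> : l = rshift n b by exact/val_inj
  |have {lb} -> : l = lshift n b by exact/val_inj
  |have {lb} -> : l = rshift n b by exact/val_inj].
- by rewrite GE block_mxEul mxE; have [->] := cm a b.
- by rewrite GE block_mxEur mxE; have [_ ->] := cm a b.
(* [char_matrix] lists the mixed products in one order; the other block follows by symmetry. *)
- by rewrite -Gs mxE GE block_mxEdl mxE; have [_ ->] := cm b a.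
- rewrite GE block_mxEdr; have [_ _ ->] := cm a b.
  by rewrite !mxE big_ord1 !mxE mulrA.
Qed.

(** The matrix in an adapted basis is carried back to coordinates. The auxiliary orthonormal basis
    disappears, because the product of [invmx B] with its transpose is g: this turns |xi|^2 into
    |v|^2 and xi into v^*. *)
Lemma natural_metric_local i (z : 'rV[R]_(n + n)) : (coord i @` dom i) (lsubmx z) ->
  local_metric G i z =
  fibration_frame (local_metric g i) z *m
  block_mx (local_metric g i (lsubmx z)) 0 0
    (radial_metric alpha beta (local_metric g i (lsubmx z)) (rsubmx z)) *m
  (fibration_frame (local_metric g i) z)^T.
Proof.
move=> [q iq qz]; have [V [Vq Vv]] := tangent_exists chM (rsubmx z) iq.
have zE : z = coord (i : index TM) V by rewrite /= Vq Vv qz hsubmxK.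
have iV : dom i (tpt V) by rewrite Vq.
rewrite zE (local_metricE chT) //= row_mxKl row_mxKr (local_metricE chM) //.
set g0 := mcoef g i (tpt V); set v := tvec V i.
have g0s : g0^T = g0 by exact: mcoef_sym.
have [B BE] : exists B : 'M[R]_n, B *m g0 *m B^T = 1%:M.
  by apply: posdef_basis => // y; exact: mcoef_pos.
have Bu : B \in unitmx.
  by have := (mulmx1_unit BE).1; rewrite unitmx_mul => /andP[].
have := natural_metric_matrix iV BE; rewrite /= -/v -/g0.
set N := hor_mx _ _; set xi := v *m invmx B; set E := adapted_mx B N.
have BgB : invmx B *m (invmx B)^T = g0.
  have := congr1 (fun K => invmx B *m K *m (invmx B)^T) BE.
  rewrite /= mulmx1 => <-; rewrite !mulmxA mulVmx // mul1mx -!mulmxA -trmx_mul mulVmx //.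
  by rewrite trmx1 mulmx1.
have rE : \sum_a xi 0 a ^+ 2 = sqn g0 v.
  rewrite sqn.unlock -BgB mulmxA -(mulmxA (v *m _)) -trmx_mul -/xi mxE.
  by apply: eq_bigr => a _; rewrite [X in _ = _ * X]mxE.
have xE : xi *m (invmx B)^T = flat_co g0 v by rewrite flat_co.unlock -BgB mulmxA.
rewrite rE; set K := block_mx _ _ _ _ => GE.
pose F := fibration_frame (local_metric g i) (row_mx (coord i (tpt V)) v) *m block_mx (invmx B) 0 0 (invmx B).
(* [F] inverts the adapted basis: [invmx B] undoes the orthonormal basis and [fibration_frame] the
   horizontal lift. *)
have FE : F *m E = 1%:M.
  have D : block_mx (invmx B) 0 0 (invmx B) *m E = block_mx 1%:M (- N) 0 1%:M.
    rewrite mulmx_block !mul0mx !mulmx0 !addr0 !add0r mulVmx // mulmxN mulmxA mulVmx //.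
    by rewrite mul1mx.
  rewrite /F -mulmxA D mulmx_block !mulmx0 !mul0mx !mul1mx !mulmx1 !addr0 !add0r.
  by rewrite addNr -scalar_mx_block.
have -> : mcoef G i V = F *m K *m F^T.
  rewrite -GE !mulmxA FE mul1mx -!mulmxA -trmx_mul FE trmx1 mulmx1 //.
rewrite /F trmx_mul -!mulmxA; congr (_ *m _); rewrite !mulmxA; congr (_ *m _).
rewrite tr_block_mx !trmx0 /K !mulmx_block !mul0mx !mulmx0 !addr0 !add0r mulmx1 BgB mul0mx.
congr block_mx; rewrite radial_metric.unlock mulmxDr mulmxDl -!scalemxAr -!scalemxAl mulmx1 BgB.
congr (_ + _ *: _); rewrite -xE; clearbody xi.
by rewrite trmx_mul trmxK -!mulmxA.
Qed.

End NaturalMetric.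

(** * Flatness in the charts of the manifold and of its tangent bundle *)

Section Flatness.
Context (R : realType) (n : nat) (M : atlas R n) (chM : charted M) (g : metric M).
Variables (G : metric (tangent_atlas M)) (alpha beta : R -> R).
Hypotheses (n2 : (2 <= n)%N) (charG : characterized_by g G alpha beta) (ricG : ricci_flat G).
Let TM := tangent_atlas M.
Let chT := tangent_charted chM.
Variable i : index M.
Let U := coord i @` dom i.
Let gl := local_metric g i.
Let h := local_metric G i.
Let TU := coord (i : index TM) @` dom (i : index TM).

Lemma tangent_chartE : TU = [set z | U (lsubmx z)].
Proof. by have := tangent_overlapE chM i i; rewrite /overlap !setIid. Qed.

Let oU : open U := @chart_open _ _ _ chM i.
Let oTU : open TU := @chart_open _ _ _ chT i.
Let hC k : Ck k TU h := local_metric_Ck (A := TM) G i k.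
Let glC k : Ck k U gl := local_metric_Ck g i k.

Let slit_sub z : slit_domain gl U z -> TU z.
Proof. by rewrite tangent_chartE => -[]. Qed.

Let h_form z : slit_domain gl U z -> h z =
  fibration_frame gl z *m
  block_mx (gl (lsubmx z)) 0 0 (radial_metric alpha beta (gl (lsubmx z)) (rsubmx z)) *m
  (fibration_frame gl z)^T.
Proof. by move=> [Uz _]; exact (natural_metric_local chM charG Uz). Qed.

Let h_ricci (z : 'rV[R]_(n + n)) (d e : 'I_n) : slit_domain gl U z ->
  ricci h (rshift n d) (rshift n e) z = 0.
Proof. by move=> /slit_sub[V iV <-]; exact (ricG iV _ _). Qed.

Let glS x : U x -> (gl x)^T = gl x.
Proof. exact: local_metric_sym. Qed.
Let glP x (v : 'rV[R]_n) : U x -> v != 0 -> 0 < (v *m gl x *m v^T) 0 0.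
Proof. exact: local_metric_pos. Qed.
Let hC2 : Ck 2 (slit_domain gl U) h := CkW slit_sub (hC 2).

Lemma base_flat x a b : U x -> riem gl a b x = 0.
Proof.
exact (local_base_flat oU glS (glC 3) glP n2 (char_alpha_smooth charG)
  (char_beta_smooth charG) (char_alpha_gt0 charG) (char_sum_gt0 charG) h_form hC2 h_ricci a b).
Qed.

Lemma total_flat_slit z a b : slit_domain gl U z -> riem h a b z = 0.
Proof.
exact (local_total_flat oU glS (glC 3) glP n2 (char_alpha_smooth charG)
  (char_beta_smooth charG) (char_alpha_gt0 charG) (char_sum_gt0 charG) h_form hC2 h_ricci a b).
Qed.

(* The zero section is reached by continuity. *)
Lemma total_flat z a b : TU z -> riem h a b z = 0.
Proof.
move=> Tz; have Uz : U (lsubmx z) by move: Tz; rewrite tangent_chartE.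
have [v0|v0] := eqVneq (rsubmx z) 0; last first.
  apply: total_flat_slit; rewrite -(hsubmxK z).
  by apply: (slit_in (g := gl)) v0 => // x v; exact: glP.
have hu y : TU y -> h y \in unitmx by move=> yT; exact (local_metric_unit chT G yT).
have [rC _] := Ck_riem a b oTU hu (hC 2).
pose e0 : 'rV[R]_n := delta_mx 0 (Ordinal (ltnW n2)).
have e00 : e0 != 0 by apply/eqP => /rowP/(_ (Ordinal (ltnW n2))); rewrite !mxE !eqxx => /eqP; rewrite oner_eq0.
pose l (s : R) : 'rV[R]_(n + n) := s *: row_mx 0 e0 + z.
have l0 : l 0 = z by rewrite /l scale0r add0r.
have cl : {for (0 : R), continuous (fun s => riem h a b (l s))}.
  apply: (@continuous_comp _ _ _ l (riem h a b)); first exact: line_continuous.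
  by rewrite l0; exact: rC.
have lim0 : riem h a b (l s) @[s --> 0^'+] --> riem h a b z.
  by rewrite -l0; exact: cvg_at_right_filter cl.
have lim1 : riem h a b (l s) @[s --> 0^'+] --> (0 : 'M[R]_(n + n)).
  apply: cvg_near_cst; near=> s; apply: total_flat_slit; rewrite -(hsubmxK (l s)).
  have -> : lsubmx (l s) = lsubmx z by rewrite /l lsubmx_affine row_mxKl scaler0 add0r.
  have -> : rsubmx (l s) = s *: e0 by rewrite /l rsubmx_affine row_mxKr v0 addr0.
  apply: (slit_in (g := gl)) Uz _; first by move=> x v; exact: glP.
  by rewrite scaler_eq0 negb_or e00 andbT gt_eqF.
exact: cvg_unique lim0 lim1.
Unshelve. all: by end_near. Qed.

End Flatness.

Theorem corollary4p12 (R : realType) (n : nat) (n_ge2 : (2 <= n)%N)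
    (M : atlas R n) (M_manifold : is_manifold M) (g : metric M)
    (G : metric (tangent_atlas M)) (alpha beta : R -> R)
    (G_natural : natural_metric g G)
    (G_char : characterized_by g G alpha beta)
    (alpha_cond : forall t : R, 0 <= t ->
       0 < alpha t + t * derive_halfline alpha t)
    (G_ricci_flat : ricci_flat G) :
  flat g /\ flat G.
Proof.
have chM := manifold_charted M_manifold.
split=> i p ip a b c d; rewrite -riem_entry.
  by rewrite (base_flat chM n_ge2 G_char G_ricci_flat) ?mxE //; exists p.
by rewrite (total_flat chM n_ge2 G_char G_ricci_flat) ?mxE //; exists p.
Qed.
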